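(* Let $P\subset\mathbb{R}^2$ be a convex polygon. Then $P$ is $L^2$-regular if and only if $P\notin\mathfrak{P}$, where $\mathfrak{P}$ is the family of all convex polygons in $\mathbb{R}^2$ that can be inscribed in a circle and are symmetric about the centre of that circle.
   Context: For a bounded measurable set $C\subset\mathbb{R}^d$, $\rho\ge 1$, $\sigma\in SO(d)$ and $t\in\mathbb{T}^d=\mathbb{R}^d/\mathbb{Z}^d$ (identified with $[-\tfrac12,\tfrac12)^d$), define the discrepancy $D_C^{\rho}(\sigma,t):=\operatorname{card}\big(\mathbb{Z}^d\cap(\rho\sigma(C)+t)\big)-\rho^d|C|$, where $|C|$ is the volume of $C$. Its norm is $\|D_C^\rho\|_{L^2(SO(d)\times\mathbb{T}^d)}=\big(\int_{\mathbb{T}^d}\int_{SO(d)}|D_C^\rho(\sigma,t)|^2\,d\sigma\,dt\big)^{1/2}$, with $d\sigma$ the normalized Haar measure on $SO(d)$ and $dt$ Lebesgue measure on $\mathbb{T}^d$. A set $C$ is called $L^2$-regular if there is a constant $c_1>0$ such that $\|D_C^\rho\|_{L^2(SO(d)\times\mathbb{T}^d)}\ge c_1\rho^{(d-1)/2}$ for all $\rho\ge1$; otherwise it is $L^2$-irregular. (It is known that an upper bound $\le c_2\rho^{(d-1)/2}$ always holds for convex bodies.) *)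

(* Defs.v *)
From HB Require Import structures.
From mathcomp Require Import all_boot all_order all_algebra.
From mathcomp Require Import all_classical all_reals all_analysis.
Set Implicit Arguments. Unset Strict Implicit. Unset Printing Implicit Defensive.
Import Order.TTheory GRing.Theory Num.Theory.
Local Open Scope classical_set_scope.
Local Open Scope ring_scope.

Definition rot (R : realType) (th : R) (p : R * R) : R * R :=
  (cos th * p.1 - sin th * p.2, sin th * p.1 + cos th * p.2).

Definition dil_rot_trans (R : realType) (rho th : R) (t : R * R)
  (C : set (R * R)) : set (R * R) :=
  [set (rho * (rot th p).1 + t.1, rho * (rot th p).2 + t.2) | p in C].

Definition area (R : realType) (C : set (R * R)) : \bar R :=
  ((@lebesgue_measure R) \x (@lebesgue_measure R))%E C.

Definition lattice_count (R : realType) (A : set (R * R)) : \bar R :=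
  (\esum_(k in [set k : int * int | A ((k.1)%:~R, (k.2)%:~R)]) 1)%E.

Definition discrepancy (R : realType) (C : set (R * R)) (rho th : R)
  (t : R * R) : \bar R :=
  (lattice_count (dil_rot_trans rho th t C) - (rho ^+ 2)%:E * area C)%E.

(* || D_C^rho ||_{L^2(SO(2) x T^2)}^2 : SO(2) parametrized by the angle
   th in [0, 2 pi) with normalized measure d th / (2 pi); T^2 identified
   with [-1/2, 1/2)^2 with Lebesgue measure. *)
Definition L2sq_discrepancy (R : realType) (C : set (R * R)) (rho : R)
  : \bar R :=
  (((2 * pi)^-1)%:E *
   \int[@lebesgue_measure R]_(th in [set th : R | (0 <= th < 2 * pi)%R])
    \int[@lebesgue_measure R]_(t1 in [set t : R | (- 2^-1 <= t < 2^-1)%R])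
     \int[@lebesgue_measure R]_(t2 in [set t : R | (- 2^-1 <= t < 2^-1)%R])
      (`|discrepancy C rho th (t1, t2)| * `|discrepancy C rho th (t1, t2)|))%E.

Definition L2norm_discrepancy (R : realType) (C : set (R * R)) (rho : R)
  : \bar R := ((L2sq_discrepancy C rho) `^ (2^-1))%E.

(* L^2-regular in dimension d = 2: exponent (d-1)/2 = 1/2. *)
Definition L2_regular (R : realType) (C : set (R * R)) : Prop :=
  exists c1 : R, 0 < c1 /\
    forall rho : R, 1 <= rho ->
      ((c1 * rho `^ (2^-1))%:E <= L2norm_discrepancy C rho)%E.

Definition conv_hull_pts (R : realType) (n : nat) (v : 'I_n -> R * R)
  : set (R * R) :=
  [set x | exists w : 'I_n -> R, (forall i, 0 <= w i) /\
     \sum_(i < n) w i = 1 /\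
     x = (\sum_(i < n) w i * (v i).1, \sum_(i < n) w i * (v i).2)].

Definition convex_polygon (R : realType) (P : set (R * R)) : Prop :=
  (exists (n : nat) (v : 'I_n -> R * R), P = conv_hull_pts v) /\
  (exists (c : R * R) (r : R), 0 < r /\
     forall x : R * R, (x.1 - c.1) ^+ 2 + (x.2 - c.2) ^+ 2 < r ^+ 2 -> P x).

Definition extreme_point (R : realType) (P : set (R * R)) (x : R * R) : Prop :=
  P x /\ forall (y z : R * R) (s : R), P y -> P z -> 0 < s < 1 ->
    x = ((1 - s) * y.1 + s * z.1, (1 - s) * y.2 + s * z.2) -> y = z.

Definition inscribed_centrally_symmetric (R : realType) (P : set (R * R))
  : Prop :=
  exists (c : R * R) (r : R), 0 < r /\
    (forall v, extreme_point P v ->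
       (v.1 - c.1) ^+ 2 + (v.2 - c.2) ^+ 2 = r ^+ 2) /\
    (forall x, P x -> P (2 * c.1 - x.1, 2 * c.2 - x.2)).

(* Main.v *)
(* By Parseval on the torus, the squared discrepancy is comparable with the sum over
   frequencies k of the angular averages of |FT(k)|^2, where Green's formula writes the
   Fourier transform of the rotated polygon as a sum over its edges; an edge e only
   contributes near the angles at which it is orthogonal to k, with a phase carried by
   its end points.
   If some endpoint of some edge e faces no endpoint of a parallel edge orthogonally,
   nothing cancels its contribution to the single frequency (0, m), m fixed, on a window
   of angles of length of order 1/rho, and P is regular.  Otherwise every edge is the
   side of a rectangle whose opposite side is an edge; going around the polygon, these
   rectangles all share their centre and diameter, so P is inscribed and symmetric.
   Conversely, if P is inscribed and symmetric, antipodal edges combine into a factor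
   sin(2 pi rho xi.M), where M is the apothem of e; as M is orthogonal to e, this factor
   is stationary and close to sin(2 pi rho |k||M|) where e contributes.  Dirichlet's
   simultaneous approximation gives arbitrarily large rho making it small for all
   edges and all small k, while large k contribute little because the sum of |k|^-3
   over Z^2 converges. *)

Require Import Defs.
From HB Require Import structures.
From mathcomp Require Import all_boot all_order all_algebra.
From mathcomp Require Import all_classical all_reals all_analysis.
From mathcomp Require Import measurable_realfun zify ring lra.
Set Implicit Arguments.
Unset Strict Implicit.
Unset Printing Implicit Defensive.
Import Order.TTheory GRing.Theory Num.Theory numFieldNormedType.Exports.
Local Open Scope classical_set_scope.
Local Open Scope ring_scope.

(** * Piecewise continuous functions *)

(** Regularity quantifies over every [rho >= 1], so no estimate may hold for large [rho] only. In
    the regular case [m] supplies the largeness: the estimates see [rho] through s = 2 pi m rho. On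
    a window of length W = Z / s the wave of the distinguished end point integrates to about W and
    every other wave of a parallel edge to O(1 / s), which a constant Z beats. Slanted edges and the
    curvature of the phase cost a further relative O(1 / s), absorbed by a large [m]. In the
    irregular case the obstacle is that smallness of the sine at the stationary angle says nothing
    about other angles. The square of an edge term decays like 1 / (1 + t^2), where t is [rho] times
    the frequency component along the edge. Where |t| > Z the angular integral is already smaller by
    a factor 1 / Z; where |t| <= Z the phase is within O(Z^2 / rho) of its stationary value. Only
    inequalities are needed: Bessel for one coefficient below, and Parseval up to a factor 2 per
    variable above. The latter follows from Fejér means. *)

Section PiecewiseContinuous.
Variable R : realType.
Implicit Types (f g : R -> R) (a b c x y : R) (S : seq R).
Notation mu := (@lebesgue_measure R).

(** A class stable under sums, products and shifts. Its first two clauses give integrability on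
    bounded intervals; the third gives convergence of Fejér means off a finite, hence null, set. *)
Definition pcf f := [/\ measurable_fun setT f,
  (forall L, exists M : R, forall x : R, `|x| <= L -> `|f x| <= M) &
  exists S : seq R, forall x : R, x \notin S -> {for x, continuous f}].

Lemma pcf_continuous f : continuous f -> pcf f.
Proof.
move=> cf; split.
- exact: continuous_measurable_fun.
- move=> L; rewrite /= in L *; have [L0|L0] := ltP L 0.
    by exists 0 => x xL; have := le_lt_trans xL L0; rewrite ltNge normr_ge0.
  have [] := @EVT_max R (fun x => `|f x|) (- L) L.
  + by rewrite ge0_cp.
  + by apply: continuous_subspaceT => x; apply: cvg_norm; exact: cf.
  + move=> c _ H.
    by exists `|f c| => x xL; apply: H; rewrite in_itv /= -ler_norml.
- by exists [::] => x _; exact: cf.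
Qed.

Lemma pcf_cst c : pcf (fun=> c).
Proof. by apply: pcf_continuous => x; exact: cvg_cst. Qed.

Lemma pcf_step a : pcf (fun x => (a < x)%R%:R).
Proof.
split.
- have -> : (fun x : R => (a < x)%R%:R) = \1_(`]a, +oo[%classic) :> (R -> R).
    apply/funext => x; rewrite indicE; congr (_%:R).
    by congr nat_of_bool; apply/idP/idP => [?|]; rewrite ?inE /= ?in_itv /= ?andbT.
  exact: measurable_indic.
- by move=> L; exists 1 => x _; case: (a < x); rewrite ?normr1 ?normr0.
- exists [:: a] => x; rewrite inE => xa.
  apply/cvgrPdist_lt => e e0; have [ax|xa'] := ltP a x.
    near=> t; rewrite (_ : a < t) ?subrr ?normr0//.
    by near: t; exact: lt_nbhsr.
  have {}xa' : x < a by rewrite lt_neqAle xa.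
  near=> t; have ta : t <= a; last by rewrite (ltNge a) ta subrr normr0.
  by apply/ltW; near: t; exact: lt_nbhsl.
Unshelve. all: by end_near. Qed.

Lemma pcfD f g : pcf f -> pcf g -> pcf (fun x => f x + g x).
Proof.
move=> [mf bf [Sf cf]] [mg bg [Sg cg]]; split.
- exact: measurable_funD.
- move=> L; have [M HM] := bf L; have [M' HM'] := bg L.
  by exists (M + M') => x xL; rewrite (le_trans (ler_normD _ _))// lerD ?HM ?HM'.
- exists (Sf ++ Sg) => x; rewrite mem_cat negb_or => /andP[xf xg].
  by apply: cvgD; [exact: cf|exact: cg].
Qed.

Lemma pcfM f g : pcf f -> pcf g -> pcf (fun x => f x * g x).
Proof.
move=> [mf bf [Sf cf]] [mg bg [Sg cg]]; split.
- exact: measurable_funM.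
- move=> L; have [M HM] := bf L; have [M' HM'] := bg L.
  by exists (M * M') => x xL; rewrite normrM ler_pM ?HM ?HM'.
- exists (Sf ++ Sg) => x; rewrite mem_cat negb_or => /andP[xf xg].
  by apply: cvgM; [exact: cf|exact: cg].
Qed.

Lemma pcfZ c f : pcf f -> pcf (fun x => c * f x).
Proof. by move=> pf; apply: pcfM => //; exact: pcf_cst. Qed.

Lemma pcfN f : pcf f -> pcf (fun x => - f x).
Proof.
move=> /(pcfZ (-1)); rewrite (_ : (fun x => -1 * f x) = (fun x => - f x))//.
by apply/funext => x; rewrite mulN1r.
Qed.

Lemma pcfB f g : pcf f -> pcf g -> pcf (fun x => f x - g x).
Proof. by move=> pf pg; apply: pcfD => //; exact: pcfN. Qed.

Lemma pcf_sum (I : Type) (r : seq I) (P : pred I) (F : I -> R -> R) :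
  (forall i, P i -> pcf (F i)) -> pcf (fun x => \sum_(i <- r | P i) F i x).
Proof.
move=> pF; elim: r => [|i r IH].
  rewrite (_ : (fun x => _) = fun=> 0); first exact: pcf_cst.
  by apply/funext => x; rewrite big_nil.
case: (boolP (P i)) => Pi.
  rewrite (_ : (fun x => _) = (fun x => F i x + \sum_(j <- r | P j) F j x)).
    by apply: pcfD => //; exact: pF.
  by apply/funext => x; rewrite big_cons Pi.
rewrite (_ : (fun x => _) = (fun x => \sum_(j <- r | P j) F j x))//.
by apply/funext => x; rewrite big_cons (negbTE Pi).
Qed.

Lemma pcf_shift c f : pcf f -> pcf (fun x => f (x + c)).
Proof.
move=> [mf bf [Sf cf]]; split.
- apply: (measurableT_comp mf).
  apply: continuous_measurable_fun => x.
  by apply: cvgD; [exact: cvg_id|exact: cvg_cst].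
- move=> L; have [M HM] := bf (L + `|c|); exists M => x xL.
  by apply: HM; rewrite (le_trans (ler_normD _ _))// lerD2r.
- exists [seq s - c | s <- Sf] => x xS.
  apply: (@continuous_comp _ _ _ (fun x => x + c) f).
    by apply: cvgD; [exact: cvg_id|exact: cvg_cst].
  apply: cf; apply: contra xS => xS; apply/mapP; exists (x + c) => //.
  by rewrite addrK.
Qed.

Lemma pcf_norm f : pcf f -> pcf (fun x => `|f x|).
Proof.
move=> [mf bf [Sf cf]]; split.
- exact: measurableT_comp.
- by move=> L; have [M HM] := bf L; exists M => x xL; rewrite normr_id HM.
- by exists Sf => x xS; apply: cvg_norm; exact: cf.
Qed.

Definition integ a b f : R := Rintegral mu `[a, b]%classic f.

Lemma pcf_integrable a b f : pcf f -> mu.-integrable `[a, b] (EFin \o f).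
Proof.
move=> [mf bf _]; apply: measurable_bounded_integrable => //.
- by rewrite /= lebesgue_measure_itv /=; case: ifP => // _; rewrite -EFinD ltry.
- exact: measurable_funTS.
- have [M HM] := bf (Num.max `|a| `|b|); exists M; split; first exact: num_real.
  move=> N MN x /=; rewrite in_itv /= => /andP[ax xb].
  apply/ltW/(le_lt_trans _ MN)/HM; rewrite le_max !ler_normr.
  have [x0|x0] := leP 0 x.
    by rewrite ger0_norm// xb orbT.
  by rewrite ltr0_norm// lerN2 ax orbT.
Qed.

Lemma EFin_int a b f : pcf f ->
  (\int[mu]_(x in `[a, b]) (f x)%:E)%E = (integ a b f)%:E.
Proof.
move=> /pcf_integrable H; rewrite /integ /Rintegral fineK//.
exact: integrable_fin_num.
Qed.

Lemma intD a b f g : pcf f -> pcf g ->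
  integ a b (fun x => f x + g x) = integ a b f + integ a b g.
Proof. by move=> pf pg; apply: RintegralD => //; exact: pcf_integrable. Qed.

Lemma intZ a b c f : pcf f -> integ a b (fun x => c * f x) = c * integ a b f.
Proof. by move=> pf; apply: RintegralZl => //; exact: pcf_integrable. Qed.

Lemma intN a b f : pcf f -> integ a b (fun x => - f x) = - integ a b f.
Proof.
move=> pf; rewrite -mulN1r -intZ//; congr integ.
by apply/funext => x; rewrite mulN1r.
Qed.

Lemma intB a b f g : pcf f -> pcf g ->
  integ a b (fun x => f x - g x) = integ a b f - integ a b g.
Proof. by move=> pf pg; rewrite intD ?intN//; exact: pcfN. Qed.

Lemma int_cst a b c : a <= b -> integ a b (fun=> c) = c * (b - a).
Proof.
move=> ab; rewrite /integ Rintegral_cst//= lebesgue_measure_itv /= lte_fin.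
move: ab; rewrite le_eqVlt => /predU1P[->|->]; last by rewrite -EFinD.
by rewrite ltxx subrr.
Qed.

Lemma int_sum a b (I : Type) (r : seq I) (P : pred I) (F : I -> R -> R) :
  (forall i, P i -> pcf (F i)) ->
  integ a b (fun x => \sum_(i <- r | P i) F i x) = \sum_(i <- r | P i) integ a b (F i).
Proof.
move=> pF; elim: r => [|i r IH].
  rewrite big_nil (_ : (fun x => _) = fun=> 0).
    by rewrite /integ Rintegral_cst// mul0r.
  by apply/funext => x; rewrite big_nil.
rewrite big_cons; case: ifPn => Pi; last first.
  by rewrite -IH; congr integ; apply/funext => x; rewrite big_cons (negbTE Pi).
rewrite -IH -intD; [|exact: pF|exact: pcf_sum].
by congr integ; apply/funext => x; rewrite big_cons Pi.
Qed.

Lemma int_le a b f g : pcf f -> pcf g -> (forall x, a <= x <= b -> f x <= g x) ->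
  integ a b f <= integ a b g.
Proof.
move=> pf pg fg; apply: (le_Rintegral _ (pcf_integrable a b pf) (pcf_integrable a b pg)) => //.
Qed.

Lemma eq_int a b f g : (forall x, a <= x <= b -> f x = g x) -> integ a b f = integ a b g.
Proof.
by move=> fg; apply: eq_Rintegral => x; rewrite inE /= in_itv /=; exact: fg.
Qed.

Lemma int_ge0 a b f : (forall x, a <= x <= b -> 0 <= f x) -> 0 <= integ a b f.
Proof. by move=> f0; apply: Rintegral_ge0 => x /=; rewrite in_itv /=; exact: f0. Qed.

Lemma int_chasles a b c f : pcf f -> a <= b -> b <= c ->
  integ a b f + integ b c f = integ a c f.
Proof.
move=> pf ab bc; have := @Rintegral_itvB R f (BLeft a) (BRight c) b.
rewrite (@Rintegral_itv_obnd_cbnd R b (BRight c)); last first.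
  by apply: (integrableS _ _ _ (pcf_integrable b c pf)) => //; exact: subset_itv_oc_cc.
rewrite /integ => <-//; first by rewrite addrC subrK.
- exact: pcf_integrable.
Qed.

Lemma int_ftc a b f F : a <= b -> continuous f ->
  (forall x, is_derive x 1 F (f x)) -> integ a b f = F b - F a.
Proof.
rewrite le_eqVlt => /predU1P[->|ab] cf dF.
  by rewrite /integ subrr set_itv1 Rintegral_set1.
rewrite /integ /Rintegral (@continuous_FTC2 R f F a b)//.
- exact: continuous_subspaceT.
- have cF x : {for x, continuous F}.
    by apply: differentiable_continuous; apply/derivable1_diffP; exact: ex_derive.
  split.
  + by move=> x _; exact: ex_derive.
  + exact/cvg_at_right_filter/cF.
  + exact/cvg_at_left_filter/cF.
- by move=> x _; rewrite derive1E derive_val.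
Qed.

Lemma lebesgue_measure_shift c (A : set R) : measurable A ->
  pushforward mu (fun x : R => x + c : measurableTypeR R) A = mu A.
Proof.
have mc : measurable_fun setT (fun x : R => x + c : measurableTypeR R).
  apply: continuous_measurable_fun => x.
  by apply: cvgD; [exact: cvg_id|exact: cvg_cst].
move=> mA; apply/esym; apply: lebesgue_measure_unique => //=; last first.
move=> _ [[a b]] _ <-.
rewrite /pushforward (_ : _ @^-1` _ = `]a - c, b - c]%classic).
  by rewrite !lebesgue_measure_itv/= !lte_fin ltrD2r -!EFinD; case: ifP => // _; congr EFin; ring.
by apply/seteqP; split => x /=; rewrite !in_itv /= lerBrDr ltrBlDr.
Qed.

Lemma int_shift a b c f : pcf f -> integ a b (fun x => f (x + c)) = integ (a + c) (b + c) f.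
Proof.
move=> pf; rewrite /integ /Rintegral; congr fine.
pose phi : measurableTypeR R -> measurableTypeR R := fun x : R => x + c.
have mc : measurable_fun setT phi.
  apply: continuous_measurable_fun => x.
  by apply: cvgD; [exact: cvg_id|exact: cvg_cst].
have pre : phi @^-1` `[a + c, b + c]%classic = `[a, b]%classic.
  by apply/seteqP; split => x /=; rewrite !in_itv /= !lerD2r.
have mf : measurable_fun [set: measurableTypeR R] (EFin \o f).
  by apply/measurable_EFinP; case: pf.
have fi : mu.-integrable (phi @^-1` `[a + c, b + c]) (EFin \o f \o phi).
  by rewrite pre; exact: (@pcf_integrable _ _ (fun x => f (x + c)) (pcf_shift c pf)).
transitivity (\int[mu]_(x in `[a, b]) ((EFin \o f) \o phi) x)%E => //.
rewrite -pre -(integral_pushforward mc mf fi)//.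
by apply: eq_measure_integral => A mA _; exact: lebesgue_measure_shift.
Qed.

(** Monotonicity without measurability: the integral of a nonnegative function is a supremum over
    the simple functions below it. *)
Lemma ge0_le_integral_nm (D : set R) (f g : R -> \bar R) :
  (forall x, D x -> 0 <= f x)%E -> (forall x, D x -> f x <= g x)%E ->
  (\int[mu]_(x in D) f x <= \int[mu]_(x in D) g x)%E.
Proof.
move=> f0 fg; have g0 x : D x -> (0 <= g x)%E.
  by move=> Dx; exact: le_trans (f0 _ Dx) (fg _ Dx).
rewrite !ge0_integralE//; apply: le_ereal_sup => _ [h /= hf <-].
exists h => //= x; rewrite (le_trans (hf x))//.
by rewrite /patch; case: ifPn => // /set_mem; exact: fg.
Qed.

(* The inner integrals of [L2sq_discrepancy] are not known to be measurable. *)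
Lemma le_integral_off_seq (D E : set R) S (f g : R -> \bar R) :
  measurable E -> measurable_fun E g ->
  (forall x, D x -> 0 <= f x)%E -> (forall x, E x -> 0 <= g x)%E ->
  (forall x, D x -> x \notin S -> E x /\ (f x <= g x)%E) ->
  (\int[mu]_(x in D) f x <= \int[mu]_(x in E) g x)%E.
Proof.
move=> mE mg f0 g0 fg.
rewrite integral_mkcond [leRHS]integral_mkcond.
have mS : measurable [set` S] by apply: countable_measurable; [exact: measurable_set1|exact/finite_set_countable/finite_seq].
(* The value +oo on the null set [S] makes [h] a majorant everywhere without changing its
   integral. *)
pose h x := if x \in S then +oo%E else (g \_ E) x.
have h0 x : (0 <= h x)%E.
  rewrite /h; case: ifP => // _; rewrite /patch.
  by case: ifPn => // /set_mem /g0.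
have mgE : measurable_fun setT (g \_ E).
  by apply/(measurable_restrictT _ _).1.
have mh : measurable_fun setT h.
  rewrite /h; apply: measurable_fun_ifT => //.
  by apply: (measurable_fun_bool true); rewrite setTI (_ : _ @^-1` _ = [set` S]).
have -> : (\int[mu]_x (g \_ E) x = \int[mu]_x h x)%E.
  apply: ge0_ae_eq_integral => //.
  - by move=> x _; rewrite /patch; case: ifPn => // /set_mem /g0.
  - exists [set` S]; split => //.
      by apply: countable_lebesgue_measure0; exact/finite_set_countable/finite_seq.
    move=> x /= xS; apply/negPn/negP => /negbTE xS'; apply: xS => _.
    by rewrite /h xS'.
apply: ge0_le_integral_nm => x _.
  by rewrite /patch; case: ifPn => // /set_mem; exact: f0.
rewrite {1}/patch; case: ifPn => [/set_mem Dx|_]; last exact: h0.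
rewrite /h; case: ifPn => [|xS]; first by rewrite leey.
by have [Ex fgx] := fg _ Dx xS; rewrite /patch mem_set.
Qed.

(** Dual of [le_integral_off_seq]: now the minorant is the measurable function, and it is set to 0
    on [S]. *)
Lemma ge_integral_off_seq (D E : set R) S (f g : R -> \bar R) :
  measurable E -> measurable_fun E g ->
  (forall x, D x -> 0 <= f x)%E -> (forall x, E x -> 0 <= g x)%E ->
  (forall x, E x -> x \notin S -> D x /\ (g x <= f x)%E) ->
  (\int[mu]_(x in E) g x <= \int[mu]_(x in D) f x)%E.
Proof.
move=> mE mg f0 g0 fg.
rewrite integral_mkcond [leRHS]integral_mkcond.
have mS : measurable [set` S] by apply: countable_measurable; [exact: measurable_set1|exact/finite_set_countable/finite_seq].
pose h x := if x \in S then 0%E else (g \_ E) x.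
have gE0 x : (0 <= (g \_ E) x)%E.
  by rewrite /patch; case: ifPn => // /set_mem /g0.
have h0 x : (0 <= h x)%E by rewrite /h; case: ifP.
have mgE : measurable_fun setT (g \_ E).
  by apply/(measurable_restrictT _ _).1.
have mh : measurable_fun setT h.
  rewrite /h; apply: measurable_fun_ifT => //.
  by apply: (measurable_fun_bool true); rewrite setTI (_ : _ @^-1` _ = [set` S]).
have -> : (\int[mu]_x (g \_ E) x = \int[mu]_x h x)%E.
  apply: ge0_ae_eq_integral => //.
  - exists [set` S]; split => //.
      by apply: countable_lebesgue_measure0; exact/finite_set_countable/finite_seq.
    move=> x /= xS; apply/negPn/negP => /negbTE xS'; apply: xS => _.
    by rewrite /h xS'.
apply: ge0_le_integral_nm => x _ //.
rewrite /h; case: ifPn => [_|xS].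
  by rewrite /patch; case: ifPn => // /set_mem /f0.
rewrite {1}/patch; case: ifPn => [/set_mem Ex|_].
  by have [Dx fgx] := fg _ Ex xS; rewrite /patch mem_set.
by rewrite /patch; case: ifPn => // /set_mem /f0.
Qed.

Lemma eq_int_off_seq a b S f g : pcf f -> pcf g -> (forall x, x \notin S -> f x = g x) ->
  integ a b f = integ a b g.
Proof.
move=> [mf _ _] [mg _ _] fg; rewrite /integ /Rintegral; congr fine.
apply: ae_eq_integral => //.
- exact/measurable_EFinP/measurable_funTS.
- exact/measurable_EFinP/measurable_funTS.
- exists [set` S]; split.
  + by apply: countable_measurable; [exact: measurable_set1|exact/finite_set_countable/finite_seq].
  + by apply: countable_lebesgue_measure0; exact/finite_set_countable/finite_seq.
  + by move=> x /= H; apply/negPn/negP => /fg e; apply: H => _; rewrite e.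
Qed.

End PiecewiseContinuous.

(** * Parseval's inequality *)

Section Parseval.
Variable R : realType.
Implicit Types (f g : R -> R) (a b c d w x y : R).
Notation mu := (@lebesgue_measure R).

Lemma is_derive_affine a b x : is_derive x 1 (fun x : R => a * x + b) a.
Proof.
have -> : (fun x : R => a * x + b) = (fun x : R => a *: x) + cst b.
  by apply/funext => y; rewrite fctE.
by apply: is_derive_eq; rewrite addr0 /GRing.scale /= mulr1.
Qed.

Lemma is_derive_sin_affine a b x :
  is_derive x 1 (fun x : R => sin (a * x + b)) (a * cos (a * x + b)).
Proof.
rewrite mulrC; apply: (@is_derive1_comp R sin (fun x => a * x + b)).
exact: is_derive_affine.
Qed.

Lemma is_derive_cos_affine a b x :
  is_derive x 1 (fun x : R => cos (a * x + b)) (- (a * sin (a * x + b))).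
Proof.
rewrite -mulrN mulrC; apply: (@is_derive1_comp R cos (fun x => a * x + b)).
exact: is_derive_affine.
Qed.

Lemma is_derive_continuous f (df : R -> R) :
  (forall x, is_derive x 1 f (df x)) -> continuous f.
Proof.
move=> H x; apply: differentiable_continuous; apply/derivable1_diffP.
exact: ex_derive.
Qed.

Lemma continuous_affine a b : continuous (fun x : R => a * x + b).
Proof. by apply: is_derive_continuous => x; exact: is_derive_affine. Qed.

Lemma continuous_cos_affine a b : continuous (fun x : R => cos (a * x + b)).
Proof. by apply: is_derive_continuous => x; exact: is_derive_cos_affine. Qed.

Lemma continuous_sin_affine a b : continuous (fun x : R => sin (a * x + b)).
Proof. by apply: is_derive_continuous => x; exact: is_derive_sin_affine. Qed.

Lemma pcf_cos a b : pcf (fun x : R => cos (a * x + b)).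
Proof. exact/pcf_continuous/continuous_cos_affine. Qed.

Lemma is_derive_scale c f (df : R) x : is_derive x 1 f df ->
  is_derive x 1 (fun x => c * f x) (c * df).
Proof.
move=> H; have -> : (fun x : R => c * f x) = c *: f by apply/funext => y; rewrite fctE.
by apply: is_derive_eq.
Qed.

Lemma int_abs_le a b (h H : R -> R) : pcf h -> pcf H ->
  (forall x, a <= x <= b -> `|h x| <= H x) -> `|integ a b h| <= integ a b H.
Proof.
move=> ph pH hH; rewrite ler_norml -intN// !int_le ?pcfN//.
- by move=> x /hH; rewrite ler_norml => /andP[].
- exact: pcfN.
- by move=> x /hH; rewrite ler_norml => /andP[].
Qed.

(** The phases [d = 0] and [d = - (pi / 2)] give the cosine and sine coefficients. The frequency is
    real so that differences [i%:R - j%:R] may be negative. *)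
Definition fcoef g w d := integ (- 2^-1) 2^-1 (fun x => g x * cos (2 * pi * w * x + d)).

Lemma sin_natpi (n : nat) : sin (pi * n%:R) = 0 :> R.
Proof.
elim: n => [|n IH]; first by rewrite mulr0 sin0.
by rewrite -natr1 mulrDr mulr1 sinDpi IH oppr0.
Qed.

Lemma sin_diffpi (i j : nat) : sin (pi * (i%:R - j%:R)) = 0 :> R.
Proof. by rewrite mulrBr sinB !sin_natpi mul0r mulr0 subrr. Qed.

Lemma int_cos w d : w != 0 ->
  integ (- 2^-1) 2^-1 (fun x => cos (2 * pi * w * x + d)) = sin (pi * w) * cos d / (pi * w).
Proof.
move=> w0; have p0 : pi != 0 :> R by rewrite gt_eqF ?pi_gt0.
have dF x : is_derive x 1 (fun x => (2 * pi * w)^-1 * sin (2 * pi * w * x + d)) (cos (2 * pi * w * x + d)).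
  have := is_derive_scale (2 * pi * w)^-1 (is_derive_sin_affine (2 * pi * w) d x).
  by rewrite mulKf// !mulf_neq0 ?pnatr_eq0.
rewrite (int_ftc _ _ dF).
- rewrite (_ : 2 * pi * w * 2^-1 = pi * w); last by field.
  rewrite (_ : 2 * pi * w * - 2^-1 = - (pi * w)); last by field.
  rewrite !sinD sinN cosN; move: (sin (pi * w)) (cos (pi * w)) p0 => s1 c1.
  by move: (pi : R) => p p0; field; rewrite p0 w0.
- by lra.
- exact: continuous_cos_affine.
Qed.

(** Fejér's kernel, written as a Toeplitz double sum so that convolution with it expands directly
    into Fourier coefficients. *)
Definition kernel (N : nat) (u : R) : R :=
  N.+1%:R^-1 * \sum_(i < N.+1) \sum_(j < N.+1) cos (2 * pi * (i%:R - j%:R) * u).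

Lemma kernelE N u : kernel N u = N.+1%:R^-1 *
  ((\sum_(i < N.+1) cos (2 * pi * i%:R * u)) ^+ 2 +
   (\sum_(i < N.+1) sin (2 * pi * i%:R * u)) ^+ 2).
Proof.
congr (_ * _); rewrite !expr2 !big_distrlr /= -big_split /=.
apply: eq_bigr => i _; rewrite -big_split /=; apply: eq_bigr => j _.
by rewrite mulrBr mulrBl cosB.
Qed.

Lemma kernel_ge0 N u : 0 <= kernel N u.
Proof. by rewrite kernelE mulr_ge0 ?invr_ge0// addr_ge0// sqr_ge0. Qed.

(** Multiplied by [2 * sin (pi * u)], the cosine and sine sums telescope. Hence the kernel is O(1 /
    N) away from the integers. *)
Lemma kernel_le N u : kernel N u * sin (pi * u) ^+ 2 <= 2 / N.+1%:R.
Proof.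
have Hc n : 2 * sin (pi * u) * (\sum_(i < n.+1) cos (2 * pi * i%:R * u)) =
    sin (2 * pi * n%:R * u + pi * u) + sin (pi * u).
  elim: n => [|n IH].
    by rewrite big_ord1 mulr0 mul0r cos0 add0r; ring.
  rewrite big_ord_recr mulrDr IH /=.
  have -> : 2 * pi * n%:R * u + pi * u = 2 * pi * n.+1%:R * u - pi * u.
    by rewrite -natr1; ring.
  by rewrite sinB sinD; ring.
have Hs n : 2 * sin (pi * u) * (\sum_(i < n.+1) sin (2 * pi * i%:R * u)) =
    cos (pi * u) - cos (2 * pi * n%:R * u + pi * u).
  elim: n => [|n IH].
    by rewrite big_ord1 mulr0 mul0r sin0 add0r; ring.
  rewrite big_ord_recr mulrDr IH /=.
  have -> : 2 * pi * n%:R * u + pi * u = 2 * pi * n.+1%:R * u - pi * u.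
    by rewrite -natr1; ring.
  by rewrite cosB cosD; ring.
rewrite kernelE -mulrA [leRHS]mulrC ler_wpM2l ?invr_ge0//.
set A := \sum_(i < _) _; set B := \sum_(i < _) _.
have {}Hc := Hc N; have {}Hs := Hs N; rewrite -/A -/B in Hc Hs.
rewrite -(@ler_pM2l _ 4)//.
have -> : 4 * ((A ^+ 2 + B ^+ 2) * sin (pi * u) ^+ 2) =
  (2 * sin (pi * u) * A) ^+ 2 + (2 * sin (pi * u) * B) ^+ 2 by ring.
rewrite Hc Hs; set p := pi * u; set q := _ + p.
have := cos2Dsin2 p; have := cos2Dsin2 q.
set c1 := cos q; set s1 := sin q; set c2 := cos p; set s2 := sin p.
have := sqr_ge0 (s1 - s2); have := sqr_ge0 (c1 + c2).
by rewrite !expr2 => *; nra.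
Qed.

Lemma pcf_kernel N x : pcf (fun y => kernel N (x - y)).
Proof.
apply: pcfZ; apply: pcf_sum => i _; apply: pcf_sum => j _.
rewrite (_ : (fun y => _) = fun y => cos (- (2 * pi * (i%:R - j%:R)) * y + 2 * pi * (i%:R - j%:R) * x)).
  exact: pcf_cos.
by apply/funext => y; congr cos; ring.
Qed.

Definition smooth N g x : R := integ (- 2^-1) 2^-1 (fun y => kernel N (x - y) * g y).

Lemma pcf_fcoef g w d : pcf g -> pcf (fun x => g x * cos (2 * pi * w * x + d)).
Proof. by move=> pg; apply: pcfM => //; exact: pcf_cos. Qed.

Lemma smoothE N g x : pcf g -> smooth N g x = N.+1%:R^-1 *
  \sum_(i < N.+1) \sum_(j < N.+1)
    (cos (2 * pi * (i%:R - j%:R) * x) * fcoef g (i%:R - j%:R) 0 +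
     cos (2 * pi * (i%:R - j%:R) * x - pi / 2) * fcoef g (i%:R - j%:R) (- (pi / 2))).
Proof.
move=> pg; rewrite /smooth.
pose T (i j : nat) d y : R := cos (2 * pi * (i%:R - j%:R) * x + d) *
  (g y * cos (2 * pi * (i%:R - j%:R) * y + d)).
have pT i j d : pcf (T i j d) by apply: pcfZ; exact: pcf_fcoef.
rewrite (eq_int (g := fun y => N.+1%:R^-1 *
  \sum_(i < N.+1) \sum_(j < N.+1) (T i j 0 y + T i j (- (pi / 2)) y))); last first.
  move=> y _; rewrite /kernel -mulrA; congr (_ * _); rewrite mulr_suml.
  apply: eq_bigr => i _; rewrite mulr_suml; apply: eq_bigr => j _.
  by rewrite /T !addr0 !cosBpihalf mulrBr cosB; ring.
rewrite intZ; last first.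
  by apply: pcf_sum => i _; apply: pcf_sum => j _; apply: pcfD.
congr (_ * _); rewrite int_sum; last by move=> i _; apply: pcf_sum => j _; apply: pcfD.
apply: eq_bigr => i _; rewrite int_sum; last by move=> j _; apply: pcfD.
apply: eq_bigr => j _; rewrite intD// /T !intZ ?addr0//; exact: pcf_fcoef.
Qed.

(** This is [smoothE] for the constant 1: only the [N.+1] diagonal terms survive. *)
Lemma int_kernel N x : integ (- 2^-1) 2^-1 (fun y => kernel N (x - y)) = 1.
Proof.
have := @smoothE N (fun=> 1) x (pcf_cst 1).
rewrite /smooth (eq_int (g := fun y => kernel N (x - y))); last first.
  by move=> y _; rewrite mulr1.
move=> ->; rewrite (eq_bigr (fun=> 1)); last first.
  move=> i _; rewrite (bigD1 i)//= big1 ?addr0; last first.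
    move=> j ji; have ij : i%:R - j%:R != 0 :> R.
      by rewrite subr_eq0 eqr_nat; apply: contra ji => /eqP ji; apply/eqP/val_inj.
    rewrite /fcoef.
    under [integ _ _ _]eq_int do rewrite mul1r.
    under [X in _ + _ * X]eq_int do rewrite mul1r.
    by rewrite !int_cos// sin_diffpi !mul0r !mulr0 addr0.
  rewrite subrr !mulr0 !mul0r /fcoef cos0 mul1r add0r.
  rewrite (eq_int (g := fun=> 1)); last by move=> y _; rewrite !(mulr0, mul0r) addr0 cos0 mulr1.
  rewrite cosN cos_pihalf mul0r addr0 int_cst; first by field.
  by lra.
by rewrite sumr_const card_ord mulVf// pnatr_eq0.
Qed.

Lemma smooth_bound N g x (M : R) : pcf g -> (forall y, - 2^-1 <= y <= 2^-1 -> `|g y| <= M) ->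
  `|smooth N g x| <= M.
Proof.
move=> pg gM; rewrite -[M]mulr1 -(int_kernel N x) -intZ; last exact: pcf_kernel.
apply: int_abs_le.
- by apply: pcfM => //; exact: pcf_kernel.
- by apply: pcfZ; exact: pcf_kernel.
- move=> y yT; rewrite normrM ger0_norm ?kernel_ge0// mulrC.
  by rewrite ler_wpM2r ?kernel_ge0// gM.
Qed.

(** Fejér's theorem at an interior point of continuity. *)
Lemma smooth_cvg g x : pcf g -> - 2^-1 < x < 2^-1 -> {for x, continuous g} ->
  (fun N => smooth N g x) @ \oo --> g x.
Proof.
move=> pg xT cg.
have [M gM] : exists M : R, forall y, - 2^-1 <= y <= 2^-1 -> `|g y| <= M.
  case: pg => _ /(_ 2^-1)[M H] _; exists M => y; rewrite -ler_norml; exact: H.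
have M0 : 0 <= M.
  by apply: le_trans (gM x _) => //; case/andP: xT => *; rewrite !ltW.
apply/cvgrPdist_le => e e0.
have [d0 d0p Hd0] : exists2 d0 : R, 0 < d0 & forall y, `|x - y| < d0 -> `|g x - g y| <= e / 2.
  move/cvgrPdist_le : cg => /(_ (e / 2)); rewrite divr_gt0// => /(_ isT).
  by move=> /nbhs_ballP[d0 /= d0p H]; exists d0 => // y /H.
(* The kernel also peaks at 1 and -1. Since [|x| <= 2^-1 - d], the argument [x - y] stays within
   [1 - d], so [sin (pi * (x - y))] is bounded away from 0 as soon as [|x - y| >= d]. *)
have [d [d1 d2 d3 d4]] : exists d : R, [/\ 0 < d, d <= d0, d <= 2^-1 & `|x| <= 2^-1 - d].
  exists (Num.min d0 (2^-1 - `|x|)).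
  have x2 : `|x| < 2^-1 by rewrite ltr_norml.
  rewrite lt_min d0p subr_gt0 x2 ge_min lexx ge_min; split => //=.
  - by rewrite gerBl normr_ge0 orbT.
  - by rewrite lerBrDr -lerBrDl ge_min lexx orbT.
have [s s0 Hs] : exists2 s : R, 0 < s & forall u, d <= `|u| <= 1 - d -> s <= sin (pi * u) ^+ 2.
  have [] := @EVT_min R (fun u => sin (pi * u + 0)) d (1 - d).
  - by lra.
  - by apply: continuous_subspaceT; exact: continuous_sin_affine.
  - move=> c; rewrite in_itv /= => /andP[dc c1] H.
    have sc : 0 < sin (pi * c + 0).
      rewrite addr0 sin_gt0_pi// mulr_gt0 ?pi_gt0 ?(lt_le_trans d1)//=.
      by rewrite gtr_pMr ?pi_gt0//; lra.
    exists (sin (pi * c + 0) ^+ 2); first by rewrite exprn_gt0.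
    move=> u /andP[du u1].
    have -> : sin (pi * u) ^+ 2 = sin (pi * `|u| + 0) ^+ 2.
      rewrite addr0; case: (ger0P u) => // _.
      by rewrite mulrN sinN sqrrN.
    rewrite ler_sqr ?nnegrE ?(ltW sc)//; first by apply: H; rewrite in_itv /= du.
    by rewrite (le_trans (ltW sc))// H// in_itv /= du.
near=> N.
have -> : g x - smooth N g x = integ (- 2^-1) 2^-1 (fun y => kernel N (x - y) * (g x - g y)).
  rewrite (eq_int (g := fun y => g x * kernel N (x - y) - kernel N (x - y) * g y)).
    rewrite intB; last 2 first.
    - by apply: pcfZ; exact: pcf_kernel.
    - by apply: pcfM => //; exact: pcf_kernel.
    by rewrite intZ ?int_kernel ?mulr1//; exact: pcf_kernel.
  by move=> y _; ring.
pose C := 2 * M * (2 / N.+1%:R / s).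
have C0 : 0 <= C by rewrite !mulr_ge0 ?invr_ge0 ?(ltW s0).
apply: (@le_trans _ _ (integ (- 2^-1) 2^-1 (fun y => e / 2 * kernel N (x - y) + C))).
  apply: int_abs_le.
  - apply: pcfM; first exact: pcf_kernel.
    by apply: pcfB => //; exact: pcf_cst.
  - by apply: pcfD; [apply: pcfZ; exact: pcf_kernel|exact: pcf_cst].
  - move=> y yT; rewrite normrM ger0_norm ?kernel_ge0//.
    have [xy|xy] := ltP `|x - y| d.
      rewrite (@le_trans _ _ (e / 2 * kernel N (x - y)))// ?lerDl//.
      by rewrite mulrC ler_wpM2r ?kernel_ge0// Hd0// (lt_le_trans xy).
    apply: (@le_trans _ _ C); last first.
      by rewrite lerDr; apply: mulr_ge0; [rewrite divr_ge0 ?(ltW e0)|exact: kernel_ge0].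
    have xy1 : `|x - y| <= 1 - d.
      rewrite (le_trans (ler_normB _ _))//.
      have : `|y| <= 2^-1 by rewrite ler_norml.
      by move: d4; lra.
    have s1 : s <= sin (pi * (x - y)) ^+ 2 by apply: Hs; rewrite xy.
    rewrite /C mulrC ler_pM ?kernel_ge0 ?normr_ge0//.
      rewrite (le_trans (ler_normB _ _))// mulr_natl mulr2n lerD ?gM//.
      by case/andP: xT => *; rewrite !ltW.
    rewrite ler_pdivlMr// (le_trans _ (kernel_le N (x - y)))//.
    by rewrite ler_wpM2l ?kernel_ge0.
rewrite intD; last 2 first.
- by apply: pcfZ; exact: pcf_kernel.
- exact: pcf_cst.
rewrite intZ ?int_kernel; last exact: pcf_kernel.
rewrite int_cst; last by lra.
rewrite mulr1 (_ : 2^-1 - - 2^-1 = 1); last by field.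
rewrite mulr1 -lerBrDl (_ : e - e / 2 = e / 2); last by field.
have -> : C = (4 * M / s) / N.+1%:R by rewrite /C; ring.
rewrite ler_pdivrMr// -ler_pdivrMl ?divr_gt0//.
rewrite (@le_trans _ _ N%:R) ?ler_nat//.
by near: N; exact: nbhs_infty_ger.
Unshelve. all: by end_near. Qed.

Definition fcoef_sq g (k : nat) := fcoef g k%:R 0 ^+ 2 + fcoef g k%:R (- (pi / 2)) ^+ 2.

Lemma fcoef_sq_ge0 g k : 0 <= fcoef_sq g k.
Proof. by rewrite addr_ge0// sqr_ge0. Qed.

Lemma pcf_smooth N g : pcf g -> pcf (smooth N g).
Proof.
move=> pg; rewrite (_ : smooth N g = fun x => N.+1%:R^-1 *
  \sum_(i < N.+1) \sum_(j < N.+1)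
    (fcoef g (i%:R - j%:R) 0 * cos (2 * pi * (i%:R - j%:R) * x + 0) +
     fcoef g (i%:R - j%:R) (- (pi / 2)) * cos (2 * pi * (i%:R - j%:R) * x + - (pi / 2)))).
  apply: pcfZ; apply: pcf_sum => i _; apply: pcf_sum => j _.
  by apply: pcfD; apply: pcfZ; exact: pcf_cos.
apply/funext => x; rewrite smoothE//; congr (_ * _).
apply: eq_bigr => i _; apply: eq_bigr => j _.
by rewrite addr0 [_ * fcoef _ _ 0]mulrC [_ * fcoef _ _ (- (pi / 2))]mulrC.
Qed.

Lemma int_smooth N g : pcf g -> integ (- 2^-1) 2^-1 (fun x => g x * smooth N g x) =
  N.+1%:R^-1 * \sum_(i < N.+1) \sum_(j < N.+1)
    (fcoef g (i%:R - j%:R) 0 ^+ 2 + fcoef g (i%:R - j%:R) (- (pi / 2)) ^+ 2).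
Proof.
move=> pg.
pose T (i j : nat) d x : R := fcoef g (i%:R - j%:R) d *
  (g x * cos (2 * pi * (i%:R - j%:R) * x + d)).
have pT i j d : pcf (T i j d) by apply: pcfZ; exact: pcf_fcoef.
rewrite (eq_int (g := fun y => N.+1%:R^-1 *
  \sum_(i < N.+1) \sum_(j < N.+1) (T i j 0 y + T i j (- (pi / 2)) y))); last first.
  move=> x _; rewrite smoothE// mulrCA; congr (_ * _); rewrite mulr_sumr.
  apply: eq_bigr => i _; rewrite mulr_sumr; apply: eq_bigr => j _.
  by rewrite /T !addr0; ring.
rewrite intZ; last first.
  by apply: pcf_sum => i _; apply: pcf_sum => j _; apply: pcfD.
congr (_ * _); rewrite int_sum; last by move=> i _; apply: pcf_sum => j _; apply: pcfD.
apply: eq_bigr => i _; rewrite int_sum; last by move=> j _; apply: pcfD.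
apply: eq_bigr => j _; rewrite intD// /T !intZ ?expr2//; exact: pcf_fcoef.
Qed.

(** With truncated subtraction, [i - j + (j - i)] is the distance of [i] and [j]. Changing the sign
    of the frequency only flips the sign of the sine coefficient, which is squared. *)
Lemma fcoef_sqE g (i j : nat) : pcf g ->
  fcoef g (i%:R - j%:R) 0 ^+ 2 + fcoef g (i%:R - j%:R) (- (pi / 2)) ^+ 2 =
  fcoef_sq g (i - j + (j - i)).
Proof.
move=> pg; have [ij|/ltnW ij] := leqP j i.
  by move: (ij); rewrite -subn_eq0 => /eqP ->; rewrite addn0 /fcoef_sq natrB.
move: (ij); rewrite -subn_eq0 => /eqP ->; rewrite add0n /fcoef_sq natrB//.
have -> : i%:R - j%:R = - (j%:R - i%:R) :> R by rewrite opprB.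
set w := j%:R - i%:R; congr (_ + _).
  by congr (_ ^+ 2); apply: eq_int => x _; rewrite !addr0 mulrN mulNr cosN.
rewrite -[RHS]sqrrN; congr (_ ^+ 2).
rewrite /fcoef -intN; last exact: pcf_fcoef.
apply: eq_int => x _; rewrite -[RHS]mulrN -cosDpi -[in RHS]cosN; congr (_ * cos _).
by field.
Qed.

(** In each row a given distance occurs at most twice. *)
Lemma toeplitz_le (q : nat -> R) (N : nat) : (forall k, 0 <= q k) ->
  \sum_(i < N) \sum_(j < N) q (i - j + (j - i))%N <= 2 * N%:R * \sum_(k < N) q k.
Proof.
move=> q0.
have ord_le1 (m : nat) : \sum_(j < N) ((m == j)%:R : R) <= 1.
  have [mN|mN] := ltnP m N.
    rewrite (bigD1 (Ordinal mN))//= eqxx big1 ?addr0// => j jm.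
    case: eqP => // mj; move: jm; rewrite -val_eqE /=.
    by rewrite mj eqxx.
  by rewrite big1// => j _; case: eqP => // mj; move: (ltn_ord j); rewrite -mj ltnNge mN.
have step (i : 'I_N) : \sum_(j < N) q (i - j + (j - i))%N <= 2 * \sum_(k < N) q k.
  apply: (@le_trans _ _ (\sum_(j < N) \sum_(k < N)
      q k * (((i - k)%N == j)%:R + ((i + k)%N == j)%:R))).
    apply: ler_sum => j _.
    have kN : (i - j + (j - i) < N)%N.
      have [ij|ij] := leqP j i.
        rewrite (_ : j - i = 0)%N; last by apply/eqP; rewrite subn_eq0.
        by rewrite addn0 (leq_ltn_trans (leq_subr _ _)).
      rewrite (_ : i - j = 0)%N; last by apply/eqP; rewrite subn_eq0 ltnW.
      by rewrite (leq_ltn_trans (leq_subr _ _)).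
    rewrite (bigD1 (Ordinal kN))//= -[leLHS]addr0 lerD//.
      rewrite -[leLHS]mulr1 ler_wpM2l//.
      have [ij|/ltnW ij] := leqP j i.
        have ji0 : (j - i = 0)%N by apply/eqP; rewrite subn_eq0.
        by rewrite ji0 addn0 subKn// eqxx lerDl.
      have ji0 : (i - j = 0)%N by apply/eqP; rewrite subn_eq0.
      by rewrite ji0 add0n subnKC// eqxx lerDr.
    by apply: sumr_ge0 => k _; rewrite mulr_ge0// addr_ge0.
  rewrite exchange_big mulr_sumr; apply: ler_sum => k _.
  rewrite -mulr_sumr mulrC ler_wpM2r// big_split /=.
  by rewrite mulr2n lerD.
apply: (le_trans (ler_sum _ (fun i _ => step i))).
by rewrite sumr_const card_ord -[leLHS]mulr_natl mulrA [N%:R * 2]mulrC.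
Qed.

Lemma int_smooth_le N g : pcf g ->
  integ (- 2^-1) 2^-1 (fun x => g x * smooth N g x) <= 2 * \sum_(k < N.+1) fcoef_sq g k.
Proof.
move=> pg; rewrite int_smooth// ler_pdivrMl//.
rewrite (eq_bigr (fun i : 'I_N.+1 => \sum_(j < N.+1) fcoef_sq g (i - j + (j - i)))); last first.
  by move=> i _; apply: eq_bigr => j _; rewrite fcoef_sqE.
rewrite mulrA [_ * 2]mulrC; exact: (@toeplitz_le (fcoef_sq g) N.+1 (fcoef_sq_ge0 g)).
Qed.

(** The integral of [g ^+ 2] is the limit of those of [g * smooth N g], by dominated convergence,
    and each of these is a Toeplitz sum of squared coefficients. The factor 2 accounts for negative
    frequencies. *)
Theorem parseval_le g : pcf g ->
  ((integ (- 2^-1) 2^-1 (fun x => g x ^+ 2))%:E <=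
   2%:E * \sum_(0 <= k <oo) (fcoef_sq g k)%:E)%E.
Proof.
move=> pg.
have pg2 : pcf (fun x => g x ^+ 2).
  by rewrite (_ : (fun x => _) = (fun x => g x * g x)); [exact: pcfM|apply/funext => x; rewrite expr2].
have [M gM] : exists M : R, forall y, - 2^-1 <= y <= 2^-1 -> `|g y| <= M.
  case: pg => _ /(_ 2^-1)[M H] _; exists M => y; rewrite -ler_norml; exact: H.
pose f_ (n : nat) (x : R) : \bar R := (g x * smooth n g x)%:E.
have pf n : pcf (fun x => g x * smooth n g x) by apply: pcfM => //; exact: pcf_smooth.
have [||||||_ _] := @dominated_convergence _ _ _ mu `[(- 2^-1 : R), 2^-1]%classic _
  f_ (fun x => (g x ^+ 2)%:E) (fun=> (M * M)%:E).
- by [].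
- by move=> n; apply/measurable_EFinP/measurable_funTS; case: (pf n).
- by apply/measurable_EFinP/measurable_funTS; case: pg2.
- case: (pg) => _ _ [S HS].
  (* [smooth_cvg] needs an interior point, so both end points join the exceptional set. *)
  exists [set` [:: - 2^-1, 2^-1 & S]]; split.
  + by apply: countable_measurable; [exact: measurable_set1|exact/finite_set_countable/finite_seq].
  + by apply: countable_lebesgue_measure0; exact/finite_set_countable/finite_seq.
  + move=> x /= xS; apply/negPn/negP; rewrite !inE !negb_or => /and3P[x1 x2 xS'].
    apply: xS; rewrite in_itv /= => /andP[x3 x4].
    rewrite /f_; apply: cvg_EFin; first exact: nearW.
    rewrite expr2; apply: cvgMr; apply: smooth_cvg => //; last exact: HS.
    by rewrite lt_neqAle eq_sym x1 x3 lt_neqAle x2.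
- exact: (pcf_integrable (- 2^-1) 2^-1 (pcf_cst (M * M))).
- apply: aeW => x n /=; rewrite in_itv /= => xT.
  rewrite lee_fin normrM ler_pM// ?gM//.
  exact: smooth_bound.
rewrite -EFin_int// => cv; apply: cvge_le cv; apply: nearW => n /=.
rewrite /f_ EFin_int//.
apply: (@le_trans _ _ (2 * \sum_(k < n.+1) fcoef_sq g k)%:E).
  by rewrite lee_fin int_smooth_le.
rewrite EFinM lee_wpmul2l// -sumEFin -(big_mkord xpredT (fun k => (fcoef_sq g k)%:E)).
by apply: nneseries_lim_ge => k _ _; rewrite lee_fin fcoef_sq_ge0.
Qed.

End Parseval.

(** * Convex polygons and their edges *)

Section Orientation.
Variable R : realType.
Implicit Types (a b c d p q : R * R).

Definition cross a b : R := a.1 * b.2 - a.2 * b.1.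

Definition vsub a b : R * R := (a.1 - b.1, a.2 - b.2).

Definition orient a b c : R := cross (vsub b a) (vsub c a).

Lemma orientC a b c : orient b a c = - orient a b c.
Proof. by rewrite /orient /cross /vsub /=; ring. Qed.

Lemma orient_rot a b c : orient b c a = orient a b c.
Proof. by rewrite /orient /cross /vsub /=; ring. Qed.

(** Reflection exchanges lower and upper boundary, so facts about upper edges follow from those
    about lower ones. *)
Definition mirror p : R * R := (p.1, - p.2).

Lemma orient_mirror a b c : orient (mirror a) (mirror b) (mirror c) = - orient a b c.
Proof. by rewrite /orient /cross /vsub /mirror /=; ring. Qed.

(** If [a.1 = b.1] the quotient is 0 and the value is [a.2]; for such an edge [jump] vanishes
    anyway. *)
Definition height a b (x : R) : R := a.2 + (b.2 - a.2) / (b.1 - a.1) * (x - a.1).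

Lemma heightC a b x : a.1 != b.1 -> height b a x = height a b x.
Proof.
rewrite /height -subr_eq0 => ab; have ba : b.1 - a.1 != 0 by rewrite -opprB oppr_eq0.
by field; rewrite ?ab ?ba.
Qed.

Lemma height_mirror a b x : height (mirror a) (mirror b) x = - height a b x.
Proof. by rewrite /height /mirror /=; ring. Qed.

Lemma orient_height a b x y : a.1 != b.1 ->
  orient a b (x, y) = (b.1 - a.1) * (y - height a b x).
Proof.
by rewrite eq_sym -subr_eq0 => ab; rewrite /orient /cross /vsub /height /=; field; rewrite ?ab.
Qed.

Lemma height_subl a b c x : a.1 != b.1 -> c.1 != b.1 ->
  height c b x - height a b x = orient a b c * (b.1 - x) / ((b.1 - c.1) * (b.1 - a.1)).
Proof.
rewrite (eq_sym a.1) (eq_sym c.1) -!(subr_eq0 b.1) => ab cb.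
by rewrite /orient /cross /vsub /height /=; field; rewrite ?ab ?cb.
Qed.

Lemma height_subr a b c x : a.1 != b.1 -> a.1 != c.1 ->
  height a c x - height a b x = orient a b c * (x - a.1) / ((c.1 - a.1) * (b.1 - a.1)).
Proof.
rewrite !(eq_sym a.1) -!(subr_eq0 _ a.1) => ab cb.
by rewrite /orient /cross /vsub /height /=; field; rewrite ?ab ?cb.
Qed.

Lemma orient_on_line a b c d x : c.1 != d.1 ->
  orient a b (x, height c d x) * (d.1 - c.1) =
  (d.1 - x) * orient a b c + (x - c.1) * orient a b d.
Proof.
rewrite eq_sym -subr_eq0 => cd.
by rewrite /orient /cross /vsub /height /=; field; rewrite ?cd.
Qed.

End Orientation.

Section Polygon.
Variables (R : realType) (n : nat).
Implicit Types (v : 'I_n -> R * R) (i j k l : 'I_n) (x y : R).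

Definition noncollinear v := forall i j k, i != j -> j != k -> i != k ->
  orient (v i) (v j) (v k) != 0.

Definition no_inner_vertex v := forall i j k l,
  ~ [/\ 0 < orient (v l) (v i) (v j), 0 < orient (v l) (v j) (v k) &
        0 < orient (v l) (v k) (v i)].

Definition convex_position v :=
  [/\ injective v, noncollinear v & no_inner_vertex v].

(** Edges run counterclockwise: all other vertices lie strictly to the left. Successors are
    recovered from this relation, so the vertices need no cyclic numbering. *)
Definition edge v i j := (i != j) &&
  [forall k, (k != i) ==> (k != j) ==> (0 < orient (v i) (v j) (v k))].

Lemma edgeP v i j : reflect
  (i != j /\ forall k, k != i -> k != j -> 0 < orient (v i) (v j) (v k)) (edge v i j).
Proof.
apply: (iffP andP) => -[ij H]; split => //.
  by move=> k ki kj; move/forallP : H => /(_ k); rewrite ki kj.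
by apply/forallP => k; apply/implyP => ki; apply/implyP => kj; exact: H.
Qed.

Lemma edge_ge0 v i j k : edge v i j -> 0 <= orient (v i) (v j) (v k).
Proof.
case/edgeP => ij H; have [->|ki] := eqVneq k i.
  by rewrite /orient /cross /vsub !subrr mulr0 mulr0 subrr.
have [->|kj] := eqVneq k j; last exact/ltW/H.
by rewrite /orient /cross /vsub mulrC subrr.
Qed.

Lemma edge_eq0 v i j k : edge v i j -> orient (v i) (v j) (v k) = 0 -> k = i \/ k = j.
Proof.
case/edgeP => ij H; have [->|ki] := eqVneq k i; first by left.
have [->|kj] := eqVneq k j; first by right.
by move=> H0; have := H _ ki kj; rewrite H0 ltxx.
Qed.

Definition mirrored v := fun i => mirror (v i).

Lemma edge_mirrored v i j : edge (mirrored v) i j = edge v j i.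
Proof.
apply/edgeP/edgeP => -[ij H]; split; rewrite 1?eq_sym// => k ki kj.
  by have := H k kj ki; rewrite orient_mirror -orientC.
by have := H k kj ki; rewrite orient_mirror -orientC.
Qed.

Lemma convex_position_mirrored v : convex_position v -> convex_position (mirrored v).
Proof.
move=> [vi vn vt]; split.
- move=> i j [ij1 /eqP]; rewrite eqr_opp => /eqP ij2; apply: vi.
  by rewrite (surjective_pairing (v i)) ij1 ij2 -surjective_pairing.
- by move=> i j k ij jk ik; rewrite orient_mirror oppr_eq0 vn.
- move=> i j k l; rewrite !orient_mirror => -[h1 h2 h3]; apply: (vt j i k l).
  by split; rewrite -orient_rot orientC orient_rot.
Qed.

(** Gift wrapping around [v i]: unless [j0] already ends an edge, turn clockwise to the last vertex
    on its right. *)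
Lemma edge_next_ex v i : convex_position v -> (1 < n)%N -> exists j, edge v i j.
Proof.
move=> [vi vn vt] n1.
have [j0 j0i] : exists j0, j0 != i.
  have [->|i0] := eqVneq i (Ordinal (ltnW n1)); last by exists (Ordinal (ltnW n1)); rewrite eq_sym.
  by exists (Ordinal n1).
pose A := [pred k | (k != i) && (k != j0) && (orient (v i) (v j0) (v k) < 0)].
have [k1 k1A|A0] := pickP A; last first.
  exists j0; apply/edgeP; split; first by rewrite eq_sym.
  move=> k ki kj0; have := A0 k; rewrite /A /= ki kj0 /= => /negbT.
  by rewrite -leNgt le_eqVlt => /orP[/eqP/esym/eqP|//]; rewrite (negbTE (vn _ _ _ _ _ _))// eq_sym.
pose dot k : R := ((v j0).1 - (v i).1) * ((v k).1 - (v i).1) + ((v j0).2 - (v i).2) * ((v k).2 - (v i).2).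
(* The cotangent of the clockwise angle from [j0], which lies between 0 and pi on [A]; its minimum
   is the largest such angle. *)
pose cot k : R := dot k / - orient (v i) (v j0) (v k).
case: (@arg_minP _ _ _ k1 A cot k1A) => j /= /andP[/andP[ji jj0] Aj] jmin.
have key k : (dot j0) * orient (v i) (v j) (v k) =
    dot j * orient (v i) (v j0) (v k) - orient (v i) (v j0) (v j) * dot k.
  by rewrite /dot /orient /cross /vsub /=; ring.
have d0 : 0 < dot j0.
  rewrite lt_neqAle addr_ge0 ?sqr_ge0 -?expr2 ?sqr_ge0// andbT eq_sym.
  rewrite paddr_eq0 ?sqr_ge0// !sqrf_eq0 !subr_eq0; apply/negP => /andP[/eqP e1 /eqP e2].
  move: j0i; rewrite -(inj_eq vi) (surjective_pairing (v j0)) e1 e2.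
  by rewrite -surjective_pairing eqxx.
exists j; apply/edgeP; split; first by rewrite eq_sym.
move=> k ki kj; have [->|kj0] := eqVneq k j0.
  by rewrite -orient_rot orientC orient_rot oppr_gt0.
have ok : orient (v i) (v j) (v k) != 0 by apply: vn; rewrite 1?eq_sym.
have [Ak|Ak|Ak] := ltgtP (orient (v i) (v j0) (v k)) 0.
- rewrite lt_neqAle eq_sym ok /= -(pmulr_rge0 _ d0) key.
  have := jmin k; rewrite ki kj0 /= Ak => /(_ isT).
  rewrite /cot ler_pdivrMr ?oppr_gt0// mulrAC ler_pdivlMr ?oppr_gt0//.
  by move=> H; lra.
(* A vertex to the left of the ray to [j0] and to the right of the ray to [j] would put [v i] inside
   the triangle of [j0], [k] and [j]. *)
- rewrite ltNge; apply/negP => H; apply: (vt j0 k j i).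
  have {}H : orient (v i) (v j) (v k) < 0 by rewrite lt_neqAle ok.
  split => //.
    by rewrite -orient_rot orientC orient_rot oppr_gt0.
  by rewrite -orient_rot orientC orient_rot oppr_gt0.
- by have := vn i j0 k; rewrite Ak eqxx => H; exfalso; apply/negP: isT; apply: H; rewrite 1?eq_sym.
Qed.

Lemma edge_prev_ex v i : convex_position v -> (1 < n)%N -> exists j, edge v j i.
Proof.
move=> /convex_position_mirrored cv n1; have [j] := edge_next_ex i cv n1.
by rewrite edge_mirrored; exists j.
Qed.

Lemma edge_next_uniq v i j k : edge v i j -> edge v i k -> j = k.
Proof.
move=> /edgeP[ij Hj] /edgeP[ik Hk]; apply/eqP/negPn/negP => jk.
have := Hj k; rewrite eq_sym ik eq_sym jk => /(_ isT isT).
have := Hk j; rewrite eq_sym ij jk => /(_ isT isT).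
rewrite -(orient_rot (v i) (v k)) orientC orient_rot oppr_gt0 => h1 h2.
by have := lt_trans h1 h2; rewrite ltxx.
Qed.

Lemma edge_prev_uniq v i j k : edge v j i -> edge v k i -> j = k.
Proof. by rewrite -(edge_mirrored v i j) -(edge_mirrored v i k); exact: edge_next_uniq. Qed.

(** Every vertex starts exactly one edge and ends exactly one: the boundary is a closed curve. *)
Lemma sum_edges_telescope v (g : 'I_n -> R) : convex_position v -> (1 < n)%N ->
  \sum_i \sum_(j | edge v i j) (g j - g i) = 0.
Proof.
move=> cv n1.
under eq_bigr do rewrite sumrB.
rewrite sumrB; apply/eqP; rewrite subr_eq0; apply/eqP.
rewrite (exchange_big_dep xpredT)//=.
apply: eq_bigr => i _; have [j ji] := edge_prev_ex i cv n1; have [k ik] := edge_next_ex i cv n1.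
rewrite (bigD1 j)//= big1 ?addr0; last first.
  by move=> l /andP[li]; rewrite (edge_prev_uniq li ji) eqxx.
rewrite (bigD1 k)//= big1 ?addr0// => l /andP[il].
by rewrite (edge_next_uniq il ik) eqxx.
Qed.

Definition hull v := conv_hull_pts v.

Lemma hull_vertex v i : hull v (v i).
Proof.
exists (fun k => (k == i)%:R); split => [k|]; first by rewrite ler0n.
have S (f : 'I_n -> R) : \sum_k (k == i)%:R * f k = f i.
  by rewrite (bigD1 i)//= eqxx mul1r big1 ?addr0// => k /negbTE ->; rewrite mul0r.
split; last by rewrite !S -surjective_pairing.
by rewrite -[RHS](S (fun=> 1)); apply: eq_bigr => k _; rewrite mulr1.
Qed.

Lemma hull_segment v (p q : R * R) (s : R) : hull v p -> hull v q -> 0 <= s <= 1 ->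
  hull v ((1 - s) * p.1 + s * q.1, (1 - s) * p.2 + s * q.2).
Proof.
move=> [a [a0 [a1 ->]]] [b [b0 [b1 ->]]] /andP[s0 s1].
exists (fun k => (1 - s) * a k + s * b k); split.
  by move=> k; rewrite addr_ge0// mulr_ge0// subr_ge0.
split; first by rewrite big_split /= -!mulr_sumr a1 b1; ring.
by congr pair; rewrite /= !mulr_sumr -big_split; apply: eq_bigr => k _ /=; ring.
Qed.

Lemma hull_affine_ge0 v (a b c : R) p : hull v p ->
  (forall k, 0 <= a * (v k).1 + b * (v k).2 + c) -> 0 <= a * p.1 + b * p.2 + c.
Proof.
move=> [w [w0 [w1 ->]]] H /=.
have -> : a * (\sum_(i < n) w i * (v i).1) + b * (\sum_(i < n) w i * (v i).2) + c =
    \sum_(i < n) w i * (a * (v i).1 + b * (v i).2 + c).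
  rewrite -[c in LHS]mulr1 -w1 !mulr_sumr -!big_split /=.
  by apply: eq_bigr => k _; ring.
by apply: sumr_ge0 => k _; rewrite mulr_ge0.
Qed.

Lemma hull_affine_gt0 v (a b c : R) p : hull v p ->
  (forall k, 0 < a * (v k).1 + b * (v k).2 + c) -> 0 < a * p.1 + b * p.2 + c.
Proof.
move=> hp H; rewrite lt_neqAle (hull_affine_ge0 hp (fun k => ltW (H k))) andbT.
case: hp => [w [w0 [w1 ->]]]; rewrite eq_sym /=.
have -> : a * (\sum_(i < n) w i * (v i).1) + b * (\sum_(i < n) w i * (v i).2) + c =
    \sum_(i < n) w i * (a * (v i).1 + b * (v i).2 + c).
  rewrite -[c in LHS]mulr1 -w1 !mulr_sumr -!big_split /=.
  by apply: eq_bigr => k _; ring.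
apply/eqP => /psumr_eq0P E; have {}E k : w k = 0.
  have /eqP : w k * (a * (v k).1 + b * (v k).2 + c) = 0.
    by apply: E => // i _; rewrite mulr_ge0// ltW.
  by rewrite mulf_eq0 => /orP[/eqP//|/eqP e0]; have := H k; rewrite e0 ltxx.
by move: w1; rewrite big1 => [/eqP|k _]; [rewrite eq_sym oner_eq0|exact: E].
Qed.

Lemma hull_orient_ge0 v i j p : edge v i j -> hull v p -> 0 <= orient (v i) (v j) p.
Proof.
move=> e hp; have := @hull_affine_ge0 v (- ((v j).2 - (v i).2)) ((v j).1 - (v i).1)
  (((v j).2 - (v i).2) * (v i).1 - ((v j).1 - (v i).1) * (v i).2) p hp.
have E q : - ((v j).2 - (v i).2) * q.1 + ((v j).1 - (v i).1) * q.2 +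
   (((v j).2 - (v i).2) * (v i).1 - ((v j).1 - (v i).1) * (v i).2) = orient (v i) (v j) q.
  by rewrite /orient /cross /vsub /=; ring.
by rewrite E; apply => k; rewrite E edge_ge0.
Qed.

Lemma hull_height v i j x : (v i).1 < x < (v j).1 -> hull v (x, height (v i) (v j) x).
Proof.
move=> /andP[ix xj]; have ij : 0 < (v j).1 - (v i).1 by rewrite subr_gt0 (lt_trans ix).
have := @hull_segment v (v i) (v j) ((x - (v i).1) / ((v j).1 - (v i).1))
  (hull_vertex v i) (hull_vertex v j).
have s01 : 0 <= (x - (v i).1) / ((v j).1 - (v i).1) <= 1.
  apply/andP; split; first by rewrite divr_ge0// ltW// subr_gt0.
  by rewrite ler_pdivrMr// mul1r lerD2r ltW.
move=> /(_ s01); set p := (X in hull v X -> _); set q := (x, _); suff -> : p = q by [].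
by rewrite /p /q /height; congr pair; field; rewrite gt_eqF.
Qed.

(** Among all segments between vertices that cross the vertical line at [x], the lowest is an edge.
    A vertex below it, joined to the end on the other side of the line, would give a lower
    crossing. *)
Lemma lower_edge_ex v x i0 j0 : noncollinear v -> (forall k, x != (v k).1) ->
  (v i0).1 < x < (v j0).1 ->
  exists i j, edge v i j /\ (v i).1 < x < (v j).1.
Proof.
move=> vn gx /andP[i0x xj0].
pose A := [pred u : 'I_n * 'I_n | (v u.1).1 < x < (v u.2).1].
have A0 : A (i0, j0) by rewrite /A /= i0x xj0.
case: (@arg_minP _ _ _ (i0, j0) A (fun u => height (v u.1) (v u.2) x) A0).
move=> [i j] /= /andP[ix xj] ijmin; exists i, j; split; last by rewrite ix xj.
have ij := lt_trans ix xj.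
apply/edgeP; split; first by apply: contraTneq ij => ->; rewrite ltxx.
move=> k ki kj; rewrite lt_neqAle eq_sym vn/=; last 3 first.
- by apply: contraTneq ij => ->; rewrite ltxx.
- by rewrite eq_sym.
- by rewrite eq_sym.
rewrite leNgt; apply/negP => o0.
have [kx|xk|/eqP] := ltgtP (v k).1 x; last by rewrite eq_sym (negbTE (gx k)).
  have := ijmin (k, j); rewrite /= kx xj => /(_ isT).
  rewrite -subr_ge0 height_subl ?lt_eqF ?(lt_trans kx)//.
  rewrite leNgt => /negP; apply.
  by rewrite pmulr_llt0 ?nmulr_rlt0 ?invr_gt0 ?mulr_gt0 ?subr_gt0 ?(lt_trans kx).
have := ijmin (i, k); rewrite /= xk ix => /(_ isT).
rewrite -subr_ge0 height_subr ?lt_eqF ?(lt_trans ix)//.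
rewrite leNgt => /negP; apply.
by rewrite pmulr_llt0 ?invr_gt0 ?mulr_gt0 ?subr_gt0 ?(lt_trans ix xk)// nmulr_rlt0 ?subr_gt0.
Qed.

Lemma lower_edge_le v x y i j : edge v i j -> (v i).1 < x < (v j).1 ->
  hull v (x, y) -> height (v i) (v j) x <= y.
Proof.
move=> e /andP[ix xj] /(hull_orient_ge0 e); have ij := lt_trans ix xj.
by rewrite orient_height ?lt_eqF// pmulr_rge0 ?subr_gt0// subr_ge0.
Qed.

(** Both edges carry the lowest point of the hull above [x]. That point is interior to the second
    edge, whose ends have nonnegative orientation to the first, so both ends lie on the line of the
    first. *)
Lemma lower_edge_uniq v x i j k l : edge v i j -> edge v k l ->
  (v i).1 < x < (v j).1 -> (v k).1 < x < (v l).1 -> i = k /\ j = l.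
Proof.
move=> e1 e2 h1 h2.
have hh : height (v i) (v j) x = height (v k) (v l) x.
  by apply/eqP; rewrite eq_le (lower_edge_le e1)//= ?(lower_edge_le e2)//; exact: hull_height.
move: h1 h2 => /andP[ix xj] /andP[kx xl].
have ij := lt_trans ix xj; have kl := lt_trans kx xl.
have := @orient_on_line R (v i) (v j) (v k) (v l) x (negbT (lt_eqF kl)).
rewrite -hh orient_height ?lt_eqF// subrr mulr0 mul0r => /esym/eqP.
have lx0 : 0 <= (v l).1 - x by rewrite subr_ge0 ltW.
have xk0 : 0 <= x - (v k).1 by rewrite subr_ge0 ltW.
rewrite paddr_eq0 ?(mulr_ge0 _ (edge_ge0 _ e1))// => /andP[].
rewrite !mulf_eq0 [_ - x == 0]subr_eq0 [x - _ == 0]subr_eq0 (gt_eqF xl) (gt_eqF kx) /=.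
move=> /eqP o1 /eqP o2.
have [ki|kj] := edge_eq0 e1 o1; last by move: kx; rewrite kj (lt_gtF xj).
have [li|lj] := edge_eq0 e1 o2; first by move: xl; rewrite li (lt_gtF ix).
by rewrite ki lj.
Qed.

Lemma vertex_sides v x y : (forall k, x != (v k).1) -> hull v (x, y) ->
  exists i j, (v i).1 < x < (v j).1.
Proof.
move=> gx hx.
have [[i ix]|H] := pselect (exists i, (v i).1 < x); last first.
  have := @hull_affine_gt0 v 1 0 (- x) _ hx; rewrite /= mul1r mul0r addr0 subrr ltxx.
  move=> F; exfalso; suff: false by []; apply: F => k.
  rewrite mul1r mul0r addr0 subr_gt0 lt_neqAle gx leNgt.
  by apply/negP => kx; apply: H; exists k.
have [[j jx]|H'] := pselect (exists j, x < (v j).1); last first.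
  have := @hull_affine_gt0 v (-1) 0 x _ hx; rewrite /= mulN1r mul0r addr0 addNr ltxx.
  move=> F; exfalso; suff: false by []; apply: F => k.
  rewrite mulN1r mul0r addr0 addrC subr_gt0 lt_neqAle eq_sym gx leNgt.
  by apply/negP => kx; apply: H'; exists k.
by exists i, j; rewrite ix jx.
Qed.

Lemma hull_mirrored v x y : hull (mirrored v) (x, y) <-> hull v (x, - y).
Proof.
have N (w : 'I_n -> R) : \sum_(i < n) w i * - (v i).2 = - \sum_(i < n) w i * (v i).2.
  by rewrite -sumrN; apply: eq_bigr => k _; rewrite mulrN.
split=> -[w [w0 [w1 [-> e]]]]; exists w; split=> //; split=> //; congr pair.
  by rewrite e N opprK.
by rewrite N -e opprK.
Qed.

Definition jump v i j x : R := ((v i).1 < x)%R%:R - ((v j).1 < x)%R%:R.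

(* A line missing all vertices meets either no edge, or exactly one lower edge
   (along which [jump] is 1) and one upper edge (along which it is -1). *)
Lemma slice v x : convex_position v -> (forall k, x != (v k).1) ->
  (forall f : R -> R, \sum_i \sum_(j | edge v i j) jump v i j x * f (height (v i) (v j) x) = 0)
    /\ (forall y, ~ hull v (x, y)) \/
  exists lo hi : R, [/\ (forall f : R -> R, \sum_i \sum_(j | edge v i j)
      jump v i j x * f (height (v i) (v j) x) = f lo - f hi),
    lo <= hi & (forall y, hull v (x, y) <-> lo <= y <= hi)].
Proof.
move=> cv gx; have [_ vn _] := cv.
have jump0 i j : ((v i).1 < x) = ((v j).1 < x) -> jump v i j x = 0.
  by move=> e; rewrite /jump e subrr.
have [[i0 [j0 ij0]]|noH] := pselect (exists i j, (v i).1 < x < (v j).1); last first.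
  left; split; last by move=> y hx; apply: noH; exact: (vertex_sides gx hx).
  move=> f; rewrite big1// => i _; rewrite big1// => j _.
  rewrite jump0 ?mul0r//.
  have [ix|xi|/eqP] := ltgtP (v i).1 x; last by rewrite eq_sym (negbTE (gx i)).
    have [jx|xj|/eqP] := ltgtP (v j).1 x => //; last by rewrite eq_sym (negbTE (gx j)).
    by exfalso; apply: noH; exists i, j; rewrite ix xj.
  have [jx|xj|/eqP] := ltgtP (v j).1 x => //.
  by exfalso; apply: noH; exists j, i; rewrite jx xi.
right.
have [a [b [eab xab]]] := lower_edge_ex vn gx ij0.
have [d [c [edc xcd]]] : exists d c, edge v c d /\ (v d).1 < x < (v c).1.
  have [_ vn' _] := convex_position_mirrored cv.
  have [i [j [eij xij]]] := @lower_edge_ex (mirrored v) x i0 j0 vn' gx ij0.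
  by exists i, j; rewrite -edge_mirrored.
have edc' : edge (mirrored v) d c by rewrite edge_mirrored.
have hh : hull v (x, height (v a) (v b) x) by exact: hull_height.
have hdc : height (v d) (v c) x = height (v c) (v d) x.
  by rewrite heightC// gt_eqF//; case/andP: xcd; exact: lt_trans.
have hh' : hull v (x, height (v c) (v d) x) by rewrite -hdc; exact: hull_height.
have up y : hull v (x, y) -> y <= height (v c) (v d) x.
  move=> hx; have := @lower_edge_le (mirrored v) x (- y) d c edc' xcd.
  by rewrite hull_mirrored opprK height_mirror lerN2 hdc; exact.
exists (height (v a) (v b) x), (height (v c) (v d) x); split.
- move=> f.
  have jab : jump v a b x = 1.
    by case/andP: xab => h1 h2; rewrite /jump h1 (lt_gtF h2) subr0.
  have jcd : jump v c d x = - 1.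
    by case/andP: xcd => h1 h2; rewrite /jump h1 (lt_gtF h2) sub0r.
  have E i j : edge v i j -> (i, j) != (a, b) -> (i, j) != (c, d) -> jump v i j x = 0.
    move=> e nab ncd; apply: jump0.
    have [ix|xi|/eqP] := ltgtP (v i).1 x; last by rewrite eq_sym (negbTE (gx i)).
      have [jx|xj|/eqP] := ltgtP (v j).1 x => //; last by rewrite eq_sym (negbTE (gx j)).
      have [] := @lower_edge_uniq v x i j a b e eab _ xab; first by rewrite ix xj.
      by move=> ea eb; move: nab; rewrite ea eb eqxx.
    have [jx|xj|/eqP] := ltgtP (v j).1 x => //.
    have [] := @lower_edge_uniq (mirrored v) x j i d c _ edc' _ xcd.
    - by rewrite edge_mirrored.
    - by rewrite /= jx xi.
    - by move=> ea eb; move: ncd; rewrite ea eb eqxx.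
  rewrite pair_big_dep /= (bigD1 (a, b))//= (bigD1 (c, d))//=.
    rewrite big1 ?addr0 ?jab ?jcd ?mul1r ?mulN1r//.
    by move=> [i j] /= /andP[/andP[e nab] ncd]; rewrite E// mul0r.
  rewrite edc; apply/eqP => -[ca _]; move: jcd; case/andP: xab xcd => h1 h2 /andP[h3 h4].
  by move: h4; rewrite ca (lt_gtF h1).
- exact: up.
- move=> y; split => [hx|/andP[h1 h2]]; first by rewrite up// (lower_edge_le eab).
  have [e|ne] := eqVneq (height (v a) (v b) x) (height (v c) (v d) x).
    by rewrite (_ : y = height (v a) (v b) x)//; apply/eqP; rewrite eq_le h1 e h2.
  have dpos : 0 < height (v c) (v d) x - height (v a) (v b) x.
    by rewrite subr_gt0 lt_neqAle ne (le_trans h1).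
  have := hull_segment hh hh' (s := (y - height (v a) (v b) x) /
    (height (v c) (v d) x - height (v a) (v b) x)).
  rewrite divr_ge0 ?subr_ge0 ?(le_trans h1 h2)//= ler_pdivrMr// mul1r lerD2r h2 => /(_ isT).
  set p := (X in hull v X -> _); suff -> : p = (x, y) by [].
  by rewrite /p /=; congr pair; field; rewrite gt_eqF.
Qed.

End Polygon.

(** * Fourier coefficients of the lattice point count *)

Section Coefficients.
Variables (R : realType).
Implicit Types (a b c d x y : R).

Definition sinc (u : R) : R := if u == 0 then 1 else sin u / u.

Lemma mul_sinc u : u * sinc u = sin u.
Proof.
rewrite /sinc; case: eqP => [->|/eqP u0]; first by rewrite mul0r sin0.
by rewrite mulrC divfK.
Qed.

Lemma ler_sin_self u : `|sin u| <= `|u| :> R.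
Proof.
wlog u0 : u / 0 <= u => [H|].
  have [/H//|u0] := leP 0 u; rewrite -normrN -sinN -[leRHS]normrN.
  by apply: H; rewrite oppr_ge0 ltW.
have -> : sin u = integ 0 u (fun x => cos (1 * x + 0)).
  have dF (x : R) : is_derive x 1 (fun x => sin (1 * x + 0)) (cos (1 * x + 0)).
    by have := is_derive_sin_affine 1 0 x; rewrite mul1r.
  rewrite (int_ftc u0 _ dF); last exact: continuous_cos_affine.
  by rewrite !addr0 !mul1r sin0 subr0.
rewrite (ger0_norm u0); apply: (@le_trans _ _ (integ 0 u (fun=> 1))).
  apply: int_abs_le; [exact: pcf_cos|exact: pcf_cst|by move=> x _; exact: cos_max].
by rewrite int_cst// mul1r subr0.
Qed.

Lemma sinc_max u : `|sinc u| <= 1.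
Proof.
rewrite /sinc; case: eqP => [_|/eqP u0]; first by rewrite normr1.
by rewrite normrM normfV ler_pdivrMr ?normr_gt0// mul1r ler_sin_self.
Qed.

Variables (n : nat) (v : 'I_n -> R * R) (B : nat).
Hypotheses (cv : convex_position v) (n1 : (1 < n)%N).
Hypothesis vB : forall k, `|(v k).1| <= B%:R /\ `|(v k).2| <= B%:R.

(** The 2B + 1 integer translates of [[-1/2, 1/2]] tile [[- L, L]], and this interval contains all
    coordinates of vertices. *)
Let M := (B + B).+1.
Let L : R := B%:R + 2^-1.
Definition shift (m : nat) : R := m%:R - B%:R.

Lemma unfold_periodic f : pcf f ->
  \sum_(m < M) integ (- 2^-1) 2^-1 (fun t => f (t + shift m)) = integ (- L) L f.
Proof.
move=> pf.
have H K : \sum_(m < K) integ (- 2^-1) 2^-1 (fun t => f (t + shift m)) =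
    integ (- L) (K%:R - L) f.
  elim: K => [|K IH].
    by rewrite big_ord0 add0r /integ set_itv1 Rintegral_set1.
  rewrite big_ord_recr /= IH int_shift// /shift.
  rewrite (_ : - 2^-1 + (K%:R - B%:R) = K%:R - L); last by rewrite /L; ring.
  rewrite (_ : 2^-1 + (K%:R - B%:R) = K.+1%:R - L); last by rewrite -natr1 /L; field.
  rewrite int_chasles//; first by rewrite lerDr.
  by rewrite lerD2r ler_nat.
rewrite H; congr integ; rewrite /M /L -natr1 natrD; by field.
Qed.

Lemma cos_shift (k : nat) (m : nat) x d :
  cos (2 * pi * k%:R * (x + shift m) + d) = cos (2 * pi * k%:R * x + d).
Proof.
have P (j : nat) y : cos (y + 2 * pi * j%:R) = cos y.
  elim: j y => [|j IH] y; first by rewrite mulr0 addr0.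
  rewrite -[RHS]IH -[RHS]cosD2pi -[j.+1]addn1 natrD.
  by congr cos; ring.
rewrite -[LHS](P (k * B)%N) -[RHS](P (k * m)%N); congr cos.
by rewrite /shift !natrM; ring.
Qed.

(** An antiderivative of [cos (2 * pi * k%:R * y + d)]; frequency 0 is separate because the general
    formula divides by [k]. *)
Definition Phi (k : nat) d y : R :=
  if k == 0%N then cos d * y else (2 * pi * k%:R)^-1 * sin (2 * pi * k%:R * y + d).

Lemma is_derive_Phi k d x : is_derive x 1 (Phi k d) (cos (2 * pi * k%:R * x + d)).
Proof.
rewrite /Phi; case: eqP => [->|/eqP k0].
  have := is_derive_affine (cos d) 0 x.
  rewrite (_ : (fun x0 : R => _) = (fun y => cos d * y)); last by apply/funext => y; rewrite addr0.
  by rewrite mulr0 mul0r add0r.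
have := is_derive_scale (2 * pi * k%:R)^-1 (is_derive_sin_affine (2 * pi * k%:R) d x).
by rewrite mulKf// !mulf_neq0 ?pnatr_eq0// gt_eqF// pi_gt0.
Qed.

Lemma int_step_mul b (g Psi : R -> R) : `|b| <= L -> continuous g -> (forall x, is_derive x 1 Psi (g x)) ->
  integ (- L) L (fun x => (b < x)%R%:R * g x) = Psi L - Psi b.
Proof.
move=> bL cg dP; have [bL1 bL2] : - L <= b /\ b <= L by move: bL; rewrite ler_norml => /andP[].
have pg : pcf (fun x => (b < x)%R%:R * g x).
  by apply: pcfM; [exact: pcf_step|exact: pcf_continuous].
rewrite -(int_chasles pg bL1 bL2).
rewrite (eq_int (g := fun=> 0)); last first.
  by move=> x /andP[_ xb]; rewrite ltNge xb mul0r.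
rewrite int_cst// mul0r add0r -(int_ftc bL2 cg dP) /integ /Rintegral; congr fine.
rewrite -(@integral_itv_obnd_cbnd R b (BRight L)); last first.
  by apply/measurable_EFinP/measurable_funTS; case: pg.
rewrite -(@integral_itv_obnd_cbnd R b (BRight L)); last first.
  by apply/measurable_EFinP/measurable_funTS; case: (pcf_continuous cg).
by apply: eq_integral => x; rewrite inE /= in_itv /= => /andP[-> _]; rewrite mul1r.
Qed.

Lemma pcf_jump i j : pcf (jump v i j).
Proof. by apply: pcfB; exact: pcf_step. Qed.

Lemma vL k : `|(v k).1| <= L.
Proof. by have [H _] := vB k; rewrite (le_trans H)// lerDl. Qed.

Lemma int_jump i j (g Psi : R -> R) : continuous g -> (forall x, is_derive x 1 Psi (g x)) ->
  integ (- L) L (fun x => jump v i j x * g x) = Psi (v j).1 - Psi (v i).1.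
Proof.
move=> cg dP; rewrite (eq_int (g := fun x => ((v i).1 < x)%R%:R * g x - ((v j).1 < x)%R%:R * g x)).
  rewrite intB; last 2 first.
  - by apply: pcfM; [exact: pcf_step|exact: pcf_continuous].
  - by apply: pcfM; [exact: pcf_step|exact: pcf_continuous].
  by rewrite !(int_step_mul _ cg dP) ?vL//; ring.
by move=> x _; rewrite /jump; ring.
Qed.

Lemma jump_height i j x : jump v i j x != 0 -> `|height (v i) (v j) x| <= B%:R.
Proof.
have [_ /ler_normlP[a1 a2]] := vB i; have [_ /ler_normlP[b1 b2]] := vB j.
have gen (p q : R * R) : p.1 < q.1 -> p.1 <= x <= q.1 ->
    `|p.2| <= B%:R -> `|q.2| <= B%:R -> `|height p q x| <= B%:R.
  move=> pq /andP[px xq] hp hq; have d0 : 0 < q.1 - p.1 by rewrite subr_gt0.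
  have -> : height p q x = ((q.1 - x) * p.2 + (x - p.1) * q.2) / (q.1 - p.1).
    by rewrite /height; field; rewrite gt_eqF.
  rewrite normrM normfV (gtr0_norm d0) ler_pdivrMr// (le_trans (ler_normD _ _))//.
  rewrite !normrM (ger0_norm (_ : 0 <= q.1 - x)) ?subr_ge0//.
  rewrite (ger0_norm (_ : 0 <= x - p.1)) ?subr_ge0//.
  rewrite (_ : B%:R * (q.1 - p.1) = (q.1 - x) * B%:R + (x - p.1) * B%:R); last by ring.
  by rewrite lerD// ler_wpM2l// subr_ge0.
rewrite /jump; have [ix|xi] := ltP (v i).1 x; have [jx|xj] := ltP (v j).1 x; rewrite ?subrr ?eqxx// => _.
  by apply: gen; rewrite ?(lt_le_trans ix)// ?(ltW ix)//; [case: (vB i)|case: (vB j)].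
rewrite -heightC ?gt_eqF ?(lt_le_trans jx)//.
by apply: gen; rewrite ?(lt_le_trans jx)// ?(ltW jx)//; [case: (vB j)|case: (vB i)].
Qed.

Lemma sum_jump x c : \sum_i \sum_(j | edge v i j) jump v i j x * c = 0.
Proof.
have := sum_edges_telescope (fun k => - ((v k).1 < x)%R%:R * c) cv n1.
move=> S0; apply: etrans S0.
by apply: eq_bigr => i _; apply: eq_bigr => j _; rewrite /jump; ring.
Qed.

Definition count t1 t2 : R := \sum_(m1 < M) \sum_(m2 < M)
  ((t1 + shift m1, t2 + shift m2) \in hull v)%:R.

(** On a generic vertical line the indicator of the hull at height y is [(lo < y) - (hi < y)] off
    two points, a signed sum over the edges. In this form the count is [pcf] in [t2] by
    construction. *)
Definition count_jump t1 t2 : R := \sum_(m1 < M) \sum_(m2 < M)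
  \sum_i \sum_(j | edge v i j) jump v i j (t1 + shift m1) *
    (height (v i) (v j) (t1 + shift m1) < t2 + shift m2)%R%:R.

Definition generic t := forall (m : 'I_M) k, t + shift m != (v k).1.

Lemma generic_off_seq : exists S : seq R, forall t, t \notin S -> generic t.
Proof.
exists [seq (v u.2).1 - shift u.1 | u : 'I_M * 'I_n] => t tS m k.
apply: contra tS => /eqP e; apply/mapP; exists (m, k); first by rewrite mem_enum.
by rewrite /= -e addrK.
Qed.

Lemma count_jumpE t1 : generic t1 ->
  exists S : seq R, forall t2, t2 \notin S -> count t1 t2 = count_jump t1 t2.
Proof.
move=> g1.
have /fin_all_exists[S HS] : forall m1 : 'I_M, exists S : seq R, forall y, y \notin S ->
    ((t1 + shift m1, y) \in hull v)%:R = \sum_i \sum_(j | edge v i j)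
    jump v i j (t1 + shift m1) * (height (v i) (v j) (t1 + shift m1) < y)%R%:R :> R.
  move=> m1; case: (slice cv (g1 m1)) => [[H0 H1]|[lo [hi [H0 lohi H1]]]].
    exists [::] => y _; rewrite (H0 (fun h => (h < y)%R%:R)) memNset//; exact: H1.
  exists [:: lo; hi] => y; rewrite !inE negb_or => /andP[ylo yhi].
  rewrite (H0 (fun h => (h < y)%R%:R)).
  have [yl|yl] := ltP lo y; last first.
    rewrite (memNset (_ : ~ hull v _)); last by rewrite H1 => /andP[ly _]; move: ylo; rewrite eq_le yl ly.
    by rewrite ltNge (le_trans yl)// subrr.
  have [yh|yh] := ltP hi y; last by rewrite mem_set ?subr0//; apply/H1; rewrite ltW.
  by rewrite memNset ?subrr// H1 => /andP[_]; rewrite leNgt yh.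
exists (flatten [seq [seq y - shift u.2 | y <- S u.1] | u : 'I_M * 'I_M]) => t2 t2S.
apply: eq_bigr => m1 _; apply: eq_bigr => m2 _; apply: HS.
apply: contra t2S => yS; apply/flattenP; exists [seq y - shift m2 | y <- S m1].
  by apply/mapP; exists (m1, m2) => //; rewrite mem_enum.
by apply/mapP; exists (t2 + shift m2) => //; rewrite addrK.
Qed.

Lemma pcf_count_jump t1 : pcf (count_jump t1).
Proof.
apply: pcf_sum => m1 _; apply: pcf_sum => m2 _; apply: pcf_sum => i _; apply: pcf_sum => j _.
apply: pcfZ.
exact: (pcf_shift (shift m2) (pcf_step (height (v i) (v j) (t1 + shift m1)))).
Qed.

(** The Fourier coefficient, in the vertical variable, of the section of the hull above [x]. *)
Definition slice_coef k d x : R :=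
  - \sum_i \sum_(j | edge v i j) jump v i j x * Phi k d (height (v i) (v j) x).

Lemma heightE (p q : R * R) x : height p q x =
  (q.2 - p.2) / (q.1 - p.1) * x + (p.2 - (q.2 - p.2) / (q.1 - p.1) * p.1).
Proof. by rewrite /height; ring. Qed.

Lemma continuous_Phi_height k d p q : continuous (fun x => Phi k d (height p q x)).
Proof.
rewrite (_ : (fun x => _) = Phi k d \o (fun x => (q.2 - p.2) / (q.1 - p.1) * x +
   (p.2 - (q.2 - p.2) / (q.1 - p.1) * p.1))); last by apply/funext => x; rewrite /= heightE.
move=> x; apply: continuous_comp; first exact: continuous_affine.
by apply: is_derive_continuous; exact: is_derive_Phi.
Qed.

Lemma pcf_slice_coef k d : pcf (slice_coef k d).
Proof.
apply: pcfN; apply: pcf_sum => i _; apply: pcf_sum => j _; apply: pcfM.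
  exact: pcf_jump.
exact/pcf_continuous/continuous_Phi_height.
Qed.

Lemma fcoef_count_jump t1 (A : R) (k : nat) d :
  fcoef (fun t2 => count_jump t1 t2 - A) k%:R d =
  \sum_(m < M) slice_coef k d (t1 + shift m) - A * (if k == 0%N then cos d else 0).
Proof.
rewrite /fcoef (eq_int (g := fun x => count_jump t1 x * cos (2 * pi * k%:R * x + d) -
   A * cos (2 * pi * k%:R * x + d))); last by move=> x _; ring.
rewrite intB; last 2 first.
- by apply: pcfM; [exact: pcf_count_jump|exact: pcf_cos].
- by apply: pcfZ; exact: pcf_cos.
rewrite intZ; last exact: pcf_cos.
congr (_ - A * _); last first.
  case: eqP => [->|/eqP k0].
    rewrite (eq_int (g := fun=> cos d)) ?int_cst; first by field.
      by lra.
    by move=> x _; rewrite mulr0 mul0r add0r.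
  rewrite int_cos ?pnatr_eq0//.
  by have := sin_natpi R k; move=> ->; rewrite !mul0r.
pose T (m1 m2 : nat) i j x : R := jump v i j (t1 + shift m1) *
   ((height (v i) (v j) (t1 + shift m1) < x + shift m2)%R%:R *
     cos (2 * pi * k%:R * (x + shift m2) + d)).
have pT m1 m2 i j : pcf (T m1 m2 i j).
  apply: pcfZ; apply: (pcf_shift (shift m2) (f := fun y =>
    (height (v i) (v j) (t1 + shift m1) < y)%R%:R * cos (2 * pi * k%:R * y + d))).
  by apply: pcfM; [exact: pcf_step|exact: pcf_cos].
rewrite (eq_int (g := fun x => \sum_(m1 < M) \sum_(m2 < M) \sum_i \sum_(j | edge v i j) T m1 m2 i j x)); last first.
  move=> x _; rewrite /count_jump mulr_suml; apply: eq_bigr => m1 _.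
  rewrite mulr_suml; apply: eq_bigr => m2 _.
  rewrite mulr_suml; apply: eq_bigr => i _.
  by rewrite mulr_suml; apply: eq_bigr => j _; rewrite /T cos_shift mulrA.
rewrite int_sum; last first.
  by move=> m1 _; apply: pcf_sum => m2 _; apply: pcf_sum => i _; apply: pcf_sum.
apply: eq_bigr => m1 _; rewrite int_sum; last first.
  by move=> m2 _; apply: pcf_sum => i _; apply: pcf_sum.
under eq_bigr => m2 _.
  rewrite int_sum; last by move=> i _; apply: pcf_sum.
  under eq_bigr => i _ do rewrite int_sum//.
  over.
rewrite exchange_big /= /slice_coef.
set x := t1 + shift m1.
(* Integrating each step function up to [L] leaves a boundary term at [L] which depends on the edge
   through its jump only; by [sum_jump] these terms cancel. *)
transitivity (- \sum_i \sum_(j | edge v i j) jump v i j x * Phi k d (height (v i) (v j) x) +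
  \sum_i \sum_(j | edge v i j) jump v i j x * Phi k d L); last by rewrite sum_jump addr0.
rewrite -sumrN -big_split /=.
apply: eq_bigr => i _; rewrite exchange_big /= -sumrN -big_split /=.
apply: eq_bigr => j _.
have [J0|J0] := eqVneq (jump v i j x) 0.
  rewrite J0 !mul0r oppr0 addr0 big1// => m2 _.
  rewrite (eq_int (g := fun=> 0)) ?int_cst ?mul0r//; first by lra.
  by move=> y _; rewrite /T -/x J0 mul0r.
rewrite (eq_bigr (fun m2 : 'I_M => jump v i j x * integ (- 2^-1) 2^-1 (fun y =>
   ((height (v i) (v j) x < y + shift m2)%R%:R *
     cos (2 * pi * k%:R * (y + shift m2) + d))))); last first.
  move=> m2 _; rewrite /T intZ//; apply: (pcf_shift (shift m2) (f := fun y =>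
    (height (v i) (v j) x < y)%R%:R * cos (2 * pi * k%:R * y + d))).
  by apply: pcfM; [exact: pcf_step|exact: pcf_cos].
rewrite -mulr_sumr (unfold_periodic (f := fun y => (height (v i) (v j) x < y)%R%:R * cos (2 * pi * k%:R * y + d))); last first.
  by apply: pcfM; [exact: pcf_step|exact: pcf_cos].
rewrite (int_step_mul _ (@continuous_cos_affine R (2 * pi * k%:R) d) (is_derive_Phi k d)).
  by ring.
by rewrite (le_trans (jump_height J0))// lerDl.
Qed.

End Coefficients.

(** * Green's formula: the Fourier transform of a polygon as a sum over its edges *)

Section PolygonFourier.
Variables (R : realType) (n : nat) (v : 'I_n -> R * R) (B : nat).
Implicit Types (a b c d x y : R).
Hypotheses (cv : convex_position v) (n1 : (1 < n)%N).
Hypothesis vB : forall k, `|(v k).1| <= B%:R /\ `|(v k).2| <= B%:R.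

Let L : R := B%:R + 2^-1.
Let dx i j : R := (v j).1 - (v i).1.
Let dy i j : R := (v j).2 - (v i).2.

(* The mean of [sin (2 pi (a X + b Y) + d)] along the edge from [v i] to [v j]. *)
Definition edge_mean a b d i j : R :=
  sin (pi * (a * ((v i).1 + (v j).1) + b * ((v i).2 + (v j).2)) + d) *
  sinc (pi * (a * dx i j + b * dy i j)).

(* The integral of [cos (2 pi (a X + b Y) + d)] over the hull of [v], for
   [(a, b)] different from [(0, 0)] (where it is 0). *)
Definition ftrans a b d : R := \sum_i \sum_(j | edge v i j)
  (a * dy i j - b * dx i j) / (2 * pi * (a ^+ 2 + b ^+ 2)) * edge_mean a b d i j.

Definition poly_area : R :=
  - \sum_i \sum_(j | edge v i j) dx i j * (((v i).2 + (v j).2) / 2).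

Lemma pi_neq0 : pi != 0 :> R.
Proof. by rewrite gt_eqF// pi_gt0. Qed.

(** The fundamental theorem of calculus along the edge. Stated with [sinc], it needs no division by
    the component of the frequency along the edge. *)
Lemma edge_mean_along a b d i j : (a * dx i j + b * dy i j) * edge_mean a b d i j =
  (2 * pi)^-1 * (cos (2 * pi * (a * (v i).1 + b * (v i).2) + d) -
                 cos (2 * pi * (a * (v j).1 + b * (v j).2) + d)).
Proof.
rewrite /edge_mean; set P := pi * _ + d; set Q := pi * (a * dx i j + b * dy i j).
have -> : (2 * pi * (a * (v j).1 + b * (v j).2) + d) = P + Q by rewrite /P /Q /dx /dy; ring.
have -> : (2 * pi * (a * (v i).1 + b * (v i).2) + d) = P - Q by rewrite /P /Q /dx /dy; ring.
transitivity (pi^-1 * sin P * (Q * sinc Q)).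
  have -> : a * dx i j + b * dy i j = pi^-1 * Q by rewrite /Q mulKf// pi_neq0.
  by rewrite -!mulrA; congr (_ * _); ring.
rewrite mul_sinc (cosB P Q) (cosD P Q).
by have := pi_neq0; move: (pi : R) (sin P) (cos P) (sin Q) (cos Q) => p sP cP sQ cQ p0; field.
Qed.

Lemma sum_edge_mean_along a b d :
  \sum_i \sum_(j | edge v i j) (a * dx i j + b * dy i j) * edge_mean a b d i j = 0.
Proof.
pose g k := - (2 * pi)^-1 * cos (2 * pi * (a * (v k).1 + b * (v k).2) + d).
have := sum_edges_telescope g cv n1 => S0; apply: etrans S0.
apply: eq_bigr => i _; apply: eq_bigr => j _; rewrite /g edge_mean_along.
by ring.
Qed.

Lemma int_jump_sin i j a b :
  integ (- L) L (fun x => jump v i j x * sin (a * x + b)) =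
  dx i j * (sin (a * (((v i).1 + (v j).1) / 2) + b) * sinc (a * (dx i j / 2))).
Proof.
have [->|a0] := eqVneq a 0.
  have dF x : is_derive x 1 (fun x => sin b * x + 0) (sin (0 * x + b)).
    by rewrite mul0r add0r; exact: is_derive_affine.
  rewrite (int_jump vB i j (@continuous_sin_affine R 0 b) dF) !mul0r add0r.
  by rewrite /sinc eqxx /dx; ring.
have dF x : is_derive x 1 (fun x => - a^-1 * cos (a * x + b)) (sin (a * x + b)).
  have := is_derive_scale (- a^-1) (is_derive_cos_affine a b x).
  by rewrite mulrN mulNr opprK mulKf.
rewrite (int_jump vB i j (@continuous_sin_affine R a b) dF).
set P := a * (_ / 2) + b; set Q := a * (dx i j / 2).
have -> : a * (v j).1 + b = P + Q by rewrite /P /Q /dx; field.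
have -> : a * (v i).1 + b = P - Q by rewrite /P /Q /dx; field.
have -> : dx i j = 2 / a * Q by rewrite /Q; field.
have -> : 2 / a * Q * (sin P * sinc Q) = 2 / a * sin P * (Q * sinc Q) by ring.
by rewrite mul_sinc cosD cosB; field.
Qed.

Lemma jump_vertical i j x : dx i j = 0 -> jump v i j x = 0.
Proof. by move=> /eqP; rewrite subr_eq0 => /eqP e; rewrite /jump e subrr. Qed.

Lemma int0 (f : R -> R) : (forall x, f x = 0) -> integ (- L) L f = 0.
Proof.
move=> f0; rewrite (eq_int (g := fun=> 0)) => [|x _]; last exact: f0.
by rewrite /integ Rintegral_cst// mul0r.
Qed.

Lemma int_jump_edge i j a b d :
  integ (- L) L (fun x => jump v i j x * sin (2 * pi * (a * x + b * height (v i) (v j) x) + d)) =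
  dx i j * edge_mean a b d i j.
Proof.
have [d0|d0] := eqVneq (dx i j) 0.
  by rewrite int0 ?d0 ?mul0r// => x; rewrite jump_vertical// mul0r.
pose s := dy i j / dx i j.
rewrite (eq_int (g := fun x => jump v i j x *
   sin (2 * pi * (a + b * s) * x + (2 * pi * b * ((v i).2 - s * (v i).1) + d)))); last first.
  by move=> x _; rewrite heightE -/(dx i j) -/(dy i j) -/s; congr (_ * sin _); ring.
rewrite int_jump_sin /edge_mean; congr (_ * (sin _ * sinc _)).
  by rewrite /s /dy /dx; field.
by rewrite /s; field.
Qed.

(** Integration in y alone yields a sum with [dx] and a factor 1 / b. Adding a multiple of the
    vanishing sum [sum_edge_mean_along] turns it into the normal form, which also makes sense for
    [b = 0]. *)
Lemma ftransE a b d : b != 0 ->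
  - (2 * pi * b)^-1 * (\sum_i \sum_(j | edge v i j) dx i j * edge_mean a b d i j) = ftrans a b d.
Proof.
move=> b0; rewrite /ftrans.
have q0 : a ^+ 2 + b ^+ 2 != 0.
  by rewrite paddr_eq0 ?sqr_ge0// !sqrf_eq0 (negbTE b0) andbF.
transitivity (- (2 * pi * b)^-1 * (\sum_i \sum_(j | edge v i j) dx i j * edge_mean a b d i j) +
  a / (2 * pi * b * (a ^+ 2 + b ^+ 2)) *
    (\sum_i \sum_(j | edge v i j) (a * dx i j + b * dy i j) * edge_mean a b d i j)).
  by rewrite sum_edge_mean_along mulr0 addr0.
rewrite !mulr_sumr -big_split /=; apply: eq_bigr => i _.
rewrite !mulr_sumr -big_split /=; apply: eq_bigr => j _.
by have := pi_neq0; move: (pi : R) => p p0; field; rewrite p0 b0 q0.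
Qed.

Lemma pcf_jump_sin i j a b d :
  pcf (fun x => jump v i j x * sin (2 * pi * (a * x + b * height (v i) (v j) x) + d)).
Proof.
apply: pcfM; first exact: pcf_jump.
apply: pcf_continuous.
rewrite (_ : (fun x => _) = fun x => sin (2 * pi * (a + b * (dy i j / dx i j)) * x +
  (2 * pi * b * ((v i).2 - dy i j / dx i j * (v i).1) + d))).
  exact: continuous_sin_affine.
by apply/funext => x; rewrite heightE -/(dx i j) -/(dy i j); congr sin; ring.
Qed.

(** A sine in y times a cosine in x splits into the frequencies (k1, k2) and (-k1, k2), hence the
    two signs in all later bounds. *)
Lemma int_slice_coef (k1 k2 : nat) d1 d2 : (0 < k2)%N ->
  integ (- L) L (fun x => slice_coef v k2 d2 x * cos (2 * pi * k1%:R * x + d1)) =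
  (ftrans k1%:R k2%:R (d2 + d1) + ftrans (- k1%:R) k2%:R (d2 - d1)) / 2.
Proof.
move=> k20; have k2r : k2%:R != 0 :> R by rewrite pnatr_eq0 -lt0n.
have p0 := pi_neq0.
pose T a d i j x := jump v i j x * sin (2 * pi * (a * x + k2%:R * height (v i) (v j) x) + d).
rewrite (eq_int (g := fun x => - ((2 * pi * k2%:R)^-1 / 2) *
  \sum_i \sum_(j | edge v i j) (T k1%:R (d2 + d1) i j x + T (- k1%:R) (d2 - d1) i j x))); last first.
  move=> x _; rewrite /slice_coef mulNr mulr_suml mulNr mulr_sumr; congr (- _).
  apply: eq_bigr => i _; rewrite mulr_suml mulr_sumr; apply: eq_bigr => j _.
  rewrite /T /Phi -[k2 == 0%N]negbK -lt0n k20 /=; set h := height _ _ x.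
  have -> : 2 * pi * (k1%:R * x + k2%:R * h) + (d2 + d1) =
    (2 * pi * k2%:R * h + d2) + (2 * pi * k1%:R * x + d1) by ring.
  have -> : 2 * pi * (- k1%:R * x + k2%:R * h) + (d2 - d1) =
    (2 * pi * k2%:R * h + d2) - (2 * pi * k1%:R * x + d1) by ring.
  set U := 2 * pi * k2%:R * h + d2; set V := 2 * pi * k1%:R * x + d1.
  by rewrite (sinD U V) (sinB U V); move: (2 * pi * k2%:R)^-1 => c; field.
have pT a d i j : pcf (T a d i j) by exact: pcf_jump_sin.
rewrite intZ; last by apply: pcf_sum => i _; apply: pcf_sum => j _; exact: pcfD.
rewrite int_sum; last by move=> i _; apply: pcf_sum => j _; exact: pcfD.
rewrite -!ftransE// -mulrDr -big_split /= [RHS]mulrAC -mulNr; congr (_ * _).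
apply: eq_bigr => i _; rewrite int_sum; last by move=> j _; exact: pcfD.
rewrite -big_split /=; apply: eq_bigr => j _.
by rewrite intD// !int_jump_edge.
Qed.

(** Here [ftransE] would divide by 0, so the integral of the height is computed by parts on every
    edge. *)
Lemma int_slice_coef_y0 (k1 : nat) d1 : (0 < k1)%N ->
  integ (- L) L (fun x => slice_coef v 0 0 x * cos (2 * pi * k1%:R * x + d1)) =
  ftrans k1%:R 0 d1.
Proof.
move=> k10; have k1r : k1%:R != 0 :> R by rewrite pnatr_eq0 -lt0n.
have p0 := pi_neq0.
pose w : R := 2 * pi * k1%:R.
have w0 : w != 0 by rewrite /w !mulf_neq0// pnatr_eq0.
pose T i j x : R := jump v i j x * (height (v i) (v j) x * cos (w * x + d1)).
have ch i j : continuous (fun x => height (v i) (v j) x * cos (w * x + d1)).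
  move=> x; apply: cvgM; last exact: continuous_cos_affine.
  rewrite (_ : height _ _ = fun x => dy i j / dx i j * x +
   ((v i).2 - dy i j / dx i j * (v i).1)); first exact: continuous_affine.
  by apply/funext => y; rewrite heightE.
have pT i j : pcf (T i j).
  by apply: pcfM; [exact: pcf_jump|exact: pcf_continuous].
rewrite (eq_int (g := fun x => - \sum_i \sum_(j | edge v i j) T i j x)); last first.
  move=> x _; rewrite /slice_coef mulNr mulr_suml; congr (- _).
  apply: eq_bigr => i _; rewrite mulr_suml; apply: eq_bigr => j _.
  by rewrite /T /Phi eqxx cos0 mul1r mulrA.
rewrite intN; last by apply: pcf_sum => i _; apply: pcf_sum => j _; exact: pT.
rewrite int_sum; last by move=> i _; apply: pcf_sum => j _; exact: pT.
(* The boundary terms of the integration by parts; they telescope around the polygon. *)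
pose g k := - w^-1 * ((v k).2 * sin (w * (v k).1 + d1)).
transitivity (- \sum_i \sum_(j | edge v i j) integ (- L) L (T i j) -
  \sum_i \sum_(j | edge v i j) (g j - g i)).
  rewrite (sum_edges_telescope _ cv n1) subr0; congr (- _); apply: eq_bigr => i _.
  by rewrite int_sum// => j _; exact: pT.
rewrite -opprD -big_split /= -sumrN /ftrans; apply: eq_bigr => i _.
rewrite -big_split /= -sumrN; apply: eq_bigr => j _.
have E : edge_mean k1%:R 0 d1 i j = sin (w * (((v i).1 + (v j).1) / 2) + d1) * sinc (w * (dx i j / 2)).
  rewrite /edge_mean /w; congr (sin _ * sinc _); first by field.
  by field.
have -> : (k1%:R * dy i j - 0 * dx i j) / (2 * pi * (k1%:R ^+ 2 + 0 ^+ 2)) = dy i j / w.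
  have W (p : R) : p != 0 -> (k1%:R * dy i j - 0 * dx i j) / (2 * p * (k1%:R ^+ 2 + 0 ^+ 2)) = dy i j / (2 * p * k1%:R).
    by move=> pp; field; rewrite ?k1r ?pp.
  exact: W.
rewrite E; have [d0|d0] := eqVneq (dx i j) 0.
  (* On a vertical edge the integral is 0 and the whole contribution comes from the difference of
     [g]. *)
  rewrite int0; last by move=> x; rewrite /T jump_vertical// mul0r.
  rewrite d0 mul0r mulr0 /sinc eqxx add0r /g.
  have e : (v j).1 = (v i).1 by apply/eqP; rewrite -subr_eq0 -/(dx i j) d0.
  rewrite e (_ : w * (((v i).1 + (v i).1) / 2) = w * (v i).1); last by field.
  by rewrite /dy; field.
pose s := dy i j / dx i j.
have hE x : height (v i) (v j) x = s * x + ((v i).2 - s * (v i).1) by rewrite heightE.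
pose Psi x : R := w^-1 * ((s * x + ((v i).2 - s * (v i).1)) * sin (w * x + d1)) +
   s / w ^+ 2 * cos (w * x + d1).
have dF x : is_derive x 1 Psi (height (v i) (v j) x * cos (w * x + d1)).
  have D1 := is_derive_affine s ((v i).2 - s * (v i).1) x.
  have D2 := is_derive_sin_affine w d1 x.
  have D3 := is_derive_scale (s / w ^+ 2) (is_derive_cos_affine w d1 x).
  have D4 := is_derive_scale w^-1 (is_deriveM D1 D2).
  apply: (is_derive_eq (is_deriveD D4 D3)).
  rewrite /GRing.scale /= hE; move: (cos _) (sin _) => c1 s1.
  by field.
rewrite (int_jump vB i j (ch i j) dF) /Psi /g.
set P := w * (_ / 2) + d1; set Q := w * (dx i j / 2).
have eQ : Q = w * (dx i j / 2) by [].
have -> : w * (v j).1 + d1 = P + Q by rewrite /P /Q /dx; field.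
have -> : w * (v i).1 + d1 = P - Q by rewrite /P /Q /dx; field.
clearbody P Q.
have -> : sinc Q = 2 / (w * dx i j) * sin Q.
  by rewrite -mul_sinc eQ; field; rewrite w0 d0.
rewrite !sinD !cosD sinN cosN.
have -> : (v j).2 = (v i).2 + s * dx i j by rewrite /s /dy; field.
have -> : dy i j = s * dx i j by rewrite /s; field.
have -> : (v j).1 = (v i).1 + dx i j by rewrite /dx; ring.
move: (sin P) (cos P) (sin Q) (cos Q) => sP cP sQ cQ.
by field; rewrite w0 d0.
Qed.

Lemma int_slice_area : integ (- L) L (slice_coef v 0 0) = poly_area.
Proof.
pose T i j x : R := jump v i j x * height (v i) (v j) x.
have ch i j : continuous (height (v i) (v j)).
  rewrite (_ : height _ _ = fun x => dy i j / dx i j * x +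
   ((v i).2 - dy i j / dx i j * (v i).1)); first exact: continuous_affine.
  by apply/funext => y; rewrite heightE.
have pT i j : pcf (T i j).
  by apply: pcfM; [exact: pcf_jump|exact: pcf_continuous].
rewrite (eq_int (g := fun x => - \sum_i \sum_(j | edge v i j) T i j x)); last first.
  move=> x _; rewrite /slice_coef; congr (- _).
  apply: eq_bigr => i _; apply: eq_bigr => j _.
  by rewrite /T /Phi eqxx cos0 mul1r.
rewrite intN; last by apply: pcf_sum => i _; apply: pcf_sum => j _; exact: pT.
rewrite int_sum; last by move=> i _; apply: pcf_sum => j _; exact: pT.
congr (- _); apply: eq_bigr => i _; rewrite int_sum; last by move=> j _; exact: pT.
apply: eq_bigr => j _; have [d0|d0] := eqVneq (dx i j) 0.
  by rewrite int0 ?d0 ?mul0r// => x; rewrite /T jump_vertical// mul0r.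
pose s := dy i j / dx i j.
have dF x : is_derive x 1 (fun x => 2^-1 * ((s * x + ((v i).2 - s * (v i).1)) * (x + 0)) + 
    (2^-1 * ((v i).2 - s * (v i).1)) * x) (height (v i) (v j) x).
  have D1 := is_derive_affine s ((v i).2 - s * (v i).1) x.
  have D2 := is_derive_affine 1 0 x.
  rewrite (_ : (fun x0 : R => 1 * x0 + 0) = (fun x : R => x + 0)) in D2; last first.
    by apply/funext => y; rewrite mul1r.
  have D3 := is_derive_affine (2^-1 * ((v i).2 - s * (v i).1)) 0 x.
  rewrite (_ : (fun x0 : R => _ * x0 + 0) = (fun x : R => (2^-1 * ((v i).2 - s * (v i).1)) * x)) in D3; last first.
    by apply/funext => y; rewrite addr0.
  apply: (is_derive_eq (is_deriveD (is_derive_scale 2^-1 (is_deriveM D1 D2)) D3)).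
  by rewrite /GRing.scale /= heightE -/(dx i j) -/(dy i j) -/s; field.
rewrite (int_jump vB i j (ch i j) dF).
have -> : (v j).2 = (v i).2 + s * dx i j by rewrite /s /dy; field.
have -> : (v j).1 = (v i).1 + dx i j by rewrite /dx; ring.
by field.
Qed.

Lemma slice_coef_y0_shifted x : slice_coef v 0 (- (pi / 2)) x = 0.
Proof.
rewrite /slice_coef big1 ?oppr0// => i _; rewrite big1// => j _.
by rewrite /Phi eqxx cosN cos_pihalf mul0r mulr0.
Qed.

(** Cavalieri: off the abscissae of the vertices [slice_coef v 0 0 x] is the length of the section.
    The absolute value keeps the integrand nonnegative at these abscissae too. *)
Lemma area_hull : area (hull v) = poly_area%:E.
Proof.
have [S HS] : exists S : seq R, forall x, x \notin S -> forall k, x != (v k).1.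
  exists [seq (v k).1 | k : 'I_n] => x xS k; apply: contra xS => /eqP ->.
  by apply/mapP; exists k; rewrite ?mem_enum.
have H x : x \notin S -> lebesgue_measure (xsection (hull v) x) = (slice_coef v 0 0 x)%:E /\
    0 <= slice_coef v 0 0 x /\ (slice_coef v 0 0 x != 0 -> `|x| <= L).
  move=> /HS gx.
  have E (f : R -> R) : (forall y, f y = y) -> slice_coef v 0 0 x =
      - \sum_i \sum_(j | edge v i j) jump v i j x * f (height (v i) (v j) x).
    move=> fE; congr (- _); apply: eq_bigr => i _; apply: eq_bigr => j _.
    by rewrite fE /Phi eqxx cos0 mul1r.
  case: (slice cv gx) => [[H0 H1]|[lo [hi [H0 lohi H1]]]].
    rewrite (E id)// (H0 id) oppr0 eqxx; split=> //.
    rewrite (_ : xsection _ _ = set0) ?measure0//.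
    by rewrite -subset0 => y; rewrite /xsection /= inE => /H1.
  rewrite (E id)// (H0 id) opprB; split; last split.
  - rewrite (_ : xsection _ _ = `[lo, hi]%classic).
      rewrite lebesgue_measure_itv /= lte_fin; move: lohi; rewrite le_eqVlt => /predU1P[->|->//].
      by rewrite ltxx subrr.
    by apply/seteqP; split=> y; rewrite /xsection /= inE in_itv /= => /H1.
  - by rewrite subr_ge0.
  - move=> _; have hx : hull v (x, lo) by apply/H1; rewrite lexx.
    have [i [j /andP[ix xj]]] := vertex_sides gx hx.
    have [/ler_normlP[a1 a2] _] := vB i; have [/ler_normlP[b1 b2] _] := vB j.
    by rewrite ler_norml /L; apply/andP; split; lra.
have psc : pcf (slice_coef v 0 0) by exact: pcf_slice_coef.
have -> : poly_area = integ (- L) L (fun x => `|slice_coef v 0 0 x|).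
  rewrite -int_slice_area; apply: (@eq_int_off_seq R _ _ S) => //; first exact: pcf_norm.
  by move=> x /H[_ [s0 _]]; rewrite ger0_norm.
rewrite -EFin_int; last exact: pcf_norm.
have mg : measurable_fun `[- L, L]%classic (fun x => `|slice_coef v 0 0 x|%:E).
  by apply/measurable_EFinP/measurable_funTS; case: (pcf_norm psc).
apply/eqP; rewrite eq_le; apply/andP; split.
- have := @le_integral_off_seq R setT setT S
    (fun x => lebesgue_measure (xsection (hull v) x))
    ((fun x => `|slice_coef v 0 0 x|%:E) \_ `[- L, L]).
  rewrite -integral_mkcond /area /product_measure1; apply.
  + by [].
  + by apply/(measurable_restrictT _ _).1.
  + by move=> x _; exact: measure_ge0.
  + by move=> x _; rewrite /patch; case: ifP => // _; rewrite lee_fin.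
  + move=> x _ xS; split=> //; have [-> [s0 sL]] := H x xS.
    rewrite /patch; case: ifPn => [_|]; first by rewrite lee_fin ger0_norm.
    rewrite notin_setE /= in_itv /= -ler_norml => xL.
    have [->//|/sL//] := eqVneq (slice_coef v 0 0 x) 0.
- rewrite /area /product_measure1.
  apply: (@ge_integral_off_seq R _ _ S) => //.
  + by move=> x xL xS; split=> //=; have [-> [s0 sL]] := H x xS; rewrite lee_fin ger0_norm.
Qed.

End PolygonFourier.

(** * Bessel and Parseval bounds for the count on the two-dimensional torus *)

Section L2Bounds.
Variables (R : realType) (n : nat) (v : 'I_n -> R * R) (B : nat).
Implicit Types (a b c d x y t : R).
Hypotheses (cv : convex_position v) (n1 : (1 < n)%N).
Hypothesis vB : forall k, `|(v k).1| <= B%:R /\ `|(v k).2| <= B%:R.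
Notation mu := (@lebesgue_measure R).

Definition torus : set R := [set t : R | - 2^-1 <= t < 2^-1].

Definition slice_fcoef (A : R) (k : nat) d t : R :=
  \sum_(m < (B + B).+1) slice_coef v k d (t + shift R B m) -
  A * (if k == 0%N then cos d else 0).

Lemma pcf_slice_fcoef A k d : pcf (slice_fcoef A k d).
Proof.
apply: pcfB; last exact: pcf_cst.
by apply: pcf_sum => m _; apply: pcf_shift; exact: pcf_slice_coef.
Qed.

Lemma fcoef_slice_fcoef A (k1 k2 : nat) d1 d2 :
  fcoef (slice_fcoef A k2 d2) k1%:R d1 =
  integ (- (B%:R + 2^-1)) (B%:R + 2^-1)
    (fun x => slice_coef v k2 d2 x * cos (2 * pi * k1%:R * x + d1)) -
  A * (if k2 == 0%N then cos d2 else 0) * (if k1 == 0%N then cos d1 else 0).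
Proof.
pose f x := slice_coef v k2 d2 x * cos (2 * pi * k1%:R * x + d1).
have pf : pcf f by apply: pcfM; [exact: pcf_slice_coef|exact: pcf_cos].
set K := A * (if k2 == 0%N then cos d2 else 0).
rewrite /fcoef (eq_int (g := fun x => \sum_(m < (B + B).+1) f (x + shift R B m) -
   K * cos (2 * pi * k1%:R * x + d1))); last first.
  move=> x _; rewrite /slice_fcoef mulrBl mulr_suml; congr (_ - _).
  by apply: eq_bigr => m _; rewrite /f cos_shift.
rewrite intB; last 2 first.
- by apply: pcf_sum => m _; exact: pcf_shift.
- by apply: pcfZ; exact: pcf_cos.
rewrite intZ; last exact: pcf_cos.
rewrite int_sum; last by move=> m _; exact: pcf_shift.
rewrite (unfold_periodic B pf); congr (_ - _ * _).
case: eqP => [->|/eqP k0].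
  rewrite (eq_int (g := fun=> cos d1)) ?int_cst; first by field.
    by lra.
  by move=> x _; rewrite mulr0 mul0r add0r.
by rewrite int_cos ?pnatr_eq0// sin_natpi !mul0r.
Qed.

Lemma generic_slice_fcoef A (k : nat) d t1 :
  fcoef (fun t2 => count_jump v B t1 t2 - A) k%:R d = slice_fcoef A k d t1.
Proof. exact: fcoef_count_jump. Qed.

Lemma pcf_sqr (f : R -> R) : pcf f -> pcf (fun x => f x ^+ 2).
Proof.
move=> pf; rewrite (_ : (fun x => _) = (fun x => f x * f x)); first exact: pcfM.
by apply/funext => x; rewrite expr2.
Qed.

(** Expand the integral of the square of [f - c * h], where [h] is the cosine, with integral of
    [h ^+ 2] at most 1. *)
Lemma fcoef_sqr_le (f : R -> R) (w d : R) : pcf f ->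
  fcoef f w d ^+ 2 <= integ (- 2^-1) 2^-1 (fun x => f x ^+ 2).
Proof.
move=> pf; set c := fcoef f w d.
pose h x := cos (2 * pi * w * x + d).
have ph : pcf h by exact: pcf_cos.
have pfh : pcf (fun x => f x * h x) by exact: pcfM.
have : 0 <= integ (- 2^-1) 2^-1 (fun x => (f x ^+ 2 - 2 * c * (f x * h x)) + c ^+ 2 * h x ^+ 2).
  by apply: int_ge0 => x _; rewrite (_ : _ + _ = (f x - c * h x) ^+ 2) ?sqr_ge0//; ring.
rewrite intD; last 2 first.
- by apply: pcfB; [exact: pcf_sqr|exact: pcfZ].
- by apply: pcfZ; exact: pcf_sqr.
rewrite intB; last 2 first.
- exact: pcf_sqr.
- exact: pcfZ.
rewrite !intZ//; last exact: pcf_sqr.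
have -> : integ (- 2^-1) 2^-1 (fun x => f x * h x) = c by [].
have : integ (- 2^-1) 2^-1 (fun x => h x ^+ 2) <= 1.
  rewrite (le_trans (int_le (g := fun=> 1) _ _ _))//.
  - exact: pcf_sqr.
  - exact: pcf_cst.
  - by move=> x _; rewrite -[leLHS]ger0_norm ?sqr_ge0// normrX expr_le1// cos_max.
  - by rewrite int_cst; lra.
have := sqr_ge0 c; rewrite !expr2; nra.
Qed.

Lemma torus_itv t : torus t -> `[- 2^-1, 2^-1]%classic t.
Proof. by rewrite /torus /= in_itv /= => /andP[-> /ltW ->]. Qed.

Lemma itv_torus t : `[- 2^-1, 2^-1]%classic t -> t != 2^-1 -> torus t.
Proof. by rewrite /torus /= in_itv /= => /andP[-> h] h'; rewrite lt_neqAle h' h. Qed.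

Lemma measurable_EFin_pcf (f : R -> R) (D : set R) : pcf f ->
  measurable_fun D (fun x => (f x)%:E).
Proof. by move=> [mf _ _]; exact/measurable_EFinP/measurable_funTS. Qed.

Lemma inner_le A t1 : generic v B t1 ->
  (\int[mu]_(t2 in torus) ((count v B t1 t2 - A) ^+ 2)%:E <=
   2%:E * \sum_(0 <= k <oo) (slice_fcoef A k 0 t1 ^+ 2 +
                              slice_fcoef A k (- (pi / 2)) t1 ^+ 2)%:E)%E.
Proof.
move=> g1; have [S HS] := count_jumpE cv g1.
pose f t2 := count_jump v B t1 t2 - A.
have pf : pcf f by apply: pcfB; [exact: pcf_count_jump|exact: pcf_cst].
apply: (@le_trans _ _ (\int[mu]_(t2 in `[(- 2^-1)%R, (2^-1)%R]) (f t2 ^+ 2)%:E)%E).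
  apply: (@le_integral_off_seq R _ _ S) => //.
  - by apply/measurable_EFinP/measurable_funTS; case: (pcf_sqr pf).
  - by move=> x _; rewrite lee_fin sqr_ge0.
  - by move=> x _; rewrite lee_fin sqr_ge0.
  - by move=> x xT xS; split; [exact: torus_itv|rewrite /f HS].
rewrite EFin_int; last exact: pcf_sqr.
apply: (le_trans (parseval_le pf)); rewrite lee_wpmul2l//.
apply: lee_nneseries => k _; first by rewrite lee_fin fcoef_sq_ge0.
by rewrite lee_fin /fcoef_sq !generic_slice_fcoef.
Qed.

(** Parseval in [t2] for each generic [t1], then in [t1] for each vertical frequency. *)
Lemma L2_count_le (b : nat -> nat -> R) :
  (forall k1 k2, 0 <= b k1 k2) ->
  (forall (k1 k2 : nat) d d', (0 < k1 + k2)%N ->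
     ftrans v k1%:R k2%:R d ^+ 2 + ftrans v (- k1%:R) k2%:R d' ^+ 2 <= b k1 k2) ->
  (\int[mu]_(t1 in torus) \int[mu]_(t2 in torus)
      ((count v B t1 t2 - poly_area v) ^+ 2)%:E <=
   8%:E * \sum_(0 <= k2 <oo) \sum_(0 <= k1 <oo) (b k1 k2)%:E)%E.
Proof.
move=> b0 hb; set A := poly_area v.
pose q (k : nat) t : R := slice_fcoef A k 0 t ^+ 2 + slice_fcoef A k (- (pi / 2)) t ^+ 2.
have pq k : pcf (q k) by apply: pcfD; apply: pcf_sqr; exact: pcf_slice_fcoef.
have q0 k t : 0 <= q k t by rewrite addr_ge0 ?sqr_ge0.
have [S HS] := generic_off_seq v B.
have mq k (D : set R) : measurable_fun D (fun t => (q k t)%:E) by exact: measurable_EFin_pcf.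
have msum (D : set R) : measurable_fun D (fun t => \sum_(0 <= k <oo) (q k t)%:E)%E.
  apply: (@ge0_emeasurable_sum _ _ R D (fun k t => (q k t)%:E) xpredT) => //.
  by move=> k t _ _; rewrite lee_fin.
have sum0 t : (0 <= \sum_(0 <= k <oo) (q k t)%:E)%E.
  by apply: nneseries_ge0 => k _ _; rewrite lee_fin.
apply: (@le_trans _ _ (\int[mu]_(t in `[(- 2^-1)%R, (2^-1)%R]) (2%:E * \sum_(0 <= k <oo) (q k t)%:E))%E).
  apply: (@le_integral_off_seq R _ _ S) => //.
  - by apply: emeasurable_funM => //; exact: measurable_cst.
  - by move=> t _; apply: integral_ge0 => x _; rewrite lee_fin sqr_ge0.
  - by move=> t _; rewrite mule_ge0.
  - by move=> t tT tS; split; [exact: torus_itv|exact/inner_le/HS].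
rewrite ge0_integralZl_EFin//.
have -> : (\int[mu]_(t in `[(- 2^-1)%R, (2^-1)%R]) (\sum_(0 <= k <oo) (q k t)%:E) =
    \sum_(0 <= k <oo) \int[mu]_(t in `[(- 2^-1)%R, (2^-1)%R]) (q k t)%:E)%E.
  apply: (@integral_nneseries _ _ R mu _ _ (fun k t => (q k t)%:E)) => //.
  - by move=> k; apply/measurable_EFinP/measurable_funTS; case: (pq k).
  - by move=> k t _; rewrite lee_fin.
have fb k1 k2 : fcoef_sq (slice_fcoef A k2 0) k1 +
    fcoef_sq (slice_fcoef A k2 (- (pi / 2))) k1 <= 2 * b k1 k2.
  have sq2 x y : ((x + y) / 2) ^+ 2 <= (x ^+ 2 + y ^+ 2) / 2.
    by rewrite -subr_ge0 (_ : _ - _ = ((x - y) / 2) ^+ 2) ?sqr_ge0//; field.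
  rewrite /fcoef_sq !fcoef_slice_fcoef.
  case: k2 => [|k2].
    rewrite eqxx (eq_int (f := fun x => slice_coef v 0 (- (pi / 2)) x * _) (g := fun=> 0)); last first.
      by move=> x _; rewrite slice_coef_y0_shifted mul0r.
    rewrite (eq_int (f := fun x => slice_coef v 0 (- (pi / 2)) x * _) (g := fun=> 0)); last first.
      by move=> x _; rewrite slice_coef_y0_shifted mul0r.
    rewrite cosN cos_pihalf cos0 mulr1 mulr0 !mul0r /integ !Rintegral_cst// !mul0r subr0.
    rewrite expr0n /= !addr0.
    case: k1 => [|k1].
      (* At frequency (0, 0) the mean of the count is the area, so the coefficient vanishes. *)
      rewrite eqxx -/(integ _ _ _) -/(integ _ _ _) (eq_int (g := slice_coef v 0 0)); last first.
        by move=> x _; rewrite mulr0 mul0r addr0 cos0 mulr1.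
      rewrite int_slice_area// mulr1 subrr.
      rewrite (eq_int (g := fun=> 0)); last first.
        by move=> x _; rewrite mulr0 mul0r add0r cosN cos_pihalf mulr0.
      rewrite /integ Rintegral_cst// mul0r mulr0 subr0 expr0n addr0.
      by rewrite mulr_ge0.
    rewrite /= !mulr0 !subr0 -!/(integ _ _ _) !int_slice_coef_y0//.
    have h1 := hb k1.+1 0%N 0 0 isT; have h2 := hb k1.+1 0%N (- (pi / 2)) 0 isT.
    rewrite mulr_natl mulr2n lerD//.
      by apply: le_trans h1; rewrite lerDl sqr_ge0.
    by apply: le_trans h2; rewrite lerDl sqr_ge0.
  rewrite /= !mulr0 !mul0r !subr0 !int_slice_coef//.
  have H d d' : ((ftrans v k1%:R k2.+1%:R d + ftrans v (- k1%:R) k2.+1%:R d') / 2) ^+ 2 <= b k1 k2.+1 / 2.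
    by rewrite (le_trans (sq2 _ _))// ler_pM2r// hb// addnS.
  have -> : 2 * b k1 k2.+1 = (b k1 k2.+1 / 2 + b k1 k2.+1 / 2) + (b k1 k2.+1 / 2 + b k1 k2.+1 / 2) by field.
  by rewrite !lerD ?H.
(* One factor 2 from Parseval in each variable and one from [fb]. *)
have -> : 8%:E = (2%:E * (2%:E * 2%:E))%E :> \bar R by rewrite -!EFinM; congr EFin; ring.
rewrite -muleA lee_wpmul2l// -nneseriesZl//; last first.
  by move=> k _; apply: nneseries_ge0 => k1 _ _; rewrite lee_fin.
apply: lee_nneseries => [k2 _ _|k2 _].
  by apply: integral_ge0 => t _; rewrite lee_fin.
rewrite EFin_int//.
rewrite intD; last 2 first.
- by apply: pcf_sqr; exact: pcf_slice_fcoef.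
- by apply: pcf_sqr; exact: pcf_slice_fcoef.
rewrite EFinD (le_trans (leeD (parseval_le (pcf_slice_fcoef _ _ _)) (parseval_le (pcf_slice_fcoef _ _ _))))//.
rewrite -muleDr//; last first.
  by apply: ge0_adde_def; rewrite inE nneseries_ge0// => k _ _; rewrite lee_fin fcoef_sq_ge0.
rewrite EFinM -muleA lee_wpmul2l// -nneseriesD; last 2 first.
- by move=> k _ _; rewrite lee_fin fcoef_sq_ge0.
- by move=> k _ _; rewrite lee_fin fcoef_sq_ge0.
rewrite -nneseriesZl//; last by move=> k _; rewrite lee_fin.
apply: lee_nneseries => [k1 _ _|k1 _].
  by rewrite -EFinD lee_fin addr_ge0// fcoef_sq_ge0.
by rewrite -EFinD -EFinM lee_fin.
apply: (@ge0_emeasurable_sum _ _ R _ (fun k t => (q k t)%:E) xpredT) => [k t _ _|k _].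
  by rewrite lee_fin.
by apply/measurable_EFinP/measurable_funTS; case: (pq k).
Qed.

(** Bessel's inequality for the single frequency (0, m), once in each variable. *)
Lemma L2_count_ge A (m : nat) d : (0 < m)%N ->
  ((ftrans v 0 m%:R d ^+ 2)%:E <=
   \int[mu]_(t1 in torus) \int[mu]_(t2 in torus) ((count v B t1 t2 - A) ^+ 2)%:E)%E.
Proof.
move=> m0; have [S HS] := generic_off_seq v B.
have pc := pcf_slice_fcoef A m d.
apply: (@le_trans _ _ (\int[mu]_(t in `[(- 2^-1)%R, (2^-1)%R]) (slice_fcoef A m d t ^+ 2)%:E)%E).
  rewrite EFin_int; last exact: pcf_sqr.
  rewrite lee_fin; apply: le_trans (fcoef_sqr_le 0%:R 0 pc).
  rewrite fcoef_slice_fcoef int_slice_coef// -[m == 0%N]negbK -lt0n m0 /= mulr0 mul0r subr0.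
  by rewrite oppr0 !addr0; set X := ftrans _ _ _ _; rewrite (_ : (X + X) / 2 = X)//; field.
apply: (@ge_integral_off_seq R _ _ (2^-1 :: S)) => //.
- by apply/measurable_EFinP/measurable_funTS; case: (pcf_sqr pc).
- by move=> t _; apply: integral_ge0 => x _; rewrite lee_fin sqr_ge0.
- by move=> t _; rewrite lee_fin sqr_ge0.
move=> t1 t1T; rewrite inE negb_or => /andP[t12 t1S]; split; first exact: itv_torus.
have [S2 HS2] := count_jumpE cv (HS _ t1S).
pose f t2 := count_jump v B t1 t2 - A.
have pf : pcf f by apply: pcfB; [exact: pcf_count_jump|exact: pcf_cst].
apply: (@le_trans _ _ (\int[mu]_(t2 in `[(- 2^-1)%R, (2^-1)%R]) (f t2 ^+ 2)%:E)%E).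
  rewrite EFin_int; last exact: pcf_sqr.
  by rewrite lee_fin -generic_slice_fcoef fcoef_sqr_le.
apply: (@ge_integral_off_seq R _ _ (2^-1 :: S2)) => //.
- by apply/measurable_EFinP/measurable_funTS; case: (pcf_sqr pf).
- by move=> x _; rewrite lee_fin sqr_ge0.
- by move=> x _; rewrite lee_fin sqr_ge0.
- move=> x xT; rewrite inE negb_or => /andP[x2 xS]; split; first exact: itv_torus.
  by rewrite /f HS2.
Qed.

End L2Bounds.

(** * Vertices and extreme points *)

Section Vertices.
Variable R : realType.
Implicit Types (P : set (R * R)) (x y p : R * R).

Definition irredundant n (v : 'I_n -> R * R) := forall k (w : 'I_n -> R),
  (forall i, 0 <= w i) -> \sum_i w i = 1 -> w k = 0 ->
  v k <> (\sum_i w i * (v i).1, \sum_i w i * (v i).2).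

Lemma hull_lift n (v : 'I_n.+1 -> R * R) k (w : 'I_n.+1 -> R) :
  (forall i, 0 <= w i) -> \sum_i w i = 1 -> w k = 0 ->
  v k = (\sum_i w i * (v i).1, \sum_i w i * (v i).2) ->
  hull v = hull (fun i => v (lift k i)).
Proof.
move=> w0 w1 wk e; have [e1 e2] : (v k).1 = \sum_i w i * (v i).1 /\
    (v k).2 = \sum_i w i * (v i).2 by rewrite [in LHS]e [in X in _ /\ X]e.
apply/seteqP; split => p [a [a0 [a1 ->]]].
  exists (fun i => a (lift k i) + a k * w (lift k i)); split.
    by move=> i; rewrite addr_ge0// mulr_ge0.
  have S (f : 'I_n.+1 -> R) : f k = \sum_i w i * f i ->
      \sum_(i < n) (a (lift k i) + a k * w (lift k i)) * f (lift k i) = \sum_i a i * f i.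
    move=> fk; rewrite [RHS](bigD1_ord k)//= fk [in RHS](bigD1_ord k)//= wk mul0r add0r.
    by rewrite mulr_sumr -big_split /=; apply: eq_bigr => i _; ring.
  split; last by congr pair; symmetry; apply: S.
  rewrite -[RHS]a1 -(eq_bigr _ (fun i _ => mulr1 _)) (S (fun=> 1)) ?(eq_bigr _ (fun i _ => mulr1 _))//.
pose b (i : 'I_n.+1) := if unlift k i is Some j then a j else 0.
have S (f : 'I_n.+1 -> R) : \sum_i b i * f i = \sum_(i < n) a i * f (lift k i).
  rewrite (bigD1_ord k)//= /b unlift_none mul0r add0r.
  by apply: eq_bigr => i _; rewrite liftK.
exists b; split; first by move=> i; rewrite /b; case: unliftP.
split; last by rewrite !S.
by rewrite -[RHS]a1 -(eq_bigr _ (fun i _ => mulr1 _)) (S (fun=> 1)) (eq_bigr _ (fun i _ => mulr1 _)).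
Qed.

(** A representation with the fewest points is irredundant, as [hull_lift] would drop a redundant
    point. *)
Lemma irredundant_hull n0 (v0 : 'I_n0 -> R * R) :
  exists n (v : 'I_n -> R * R), irredundant v /\ hull v = hull v0.
Proof.
have ex : exists n, `[< exists v : 'I_n -> R * R, hull v = hull v0 >].
  by exists n0; apply/asboolP; exists v0.
case: (ex_minnP ex) => n /asboolP[v hv] nmin; exists n, v; split=> // k w w0 w1 wk e.
case: n v hv nmin k w w0 w1 wk e => [|n] v hv nmin k w w0 w1 wk e; first by case: k wk e.
have := nmin n; rewrite ltnn => H; suff: false by []; apply: H; apply/asboolP.
by exists (fun i => v (lift k i)); rewrite -hv (hull_lift w0 w1 wk e).
Qed.

Variables (n : nat) (v : 'I_n -> R * R).
Hypothesis irr : irredundant v.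

Lemma sum_delta (k : 'I_n) (c : R) (f : 'I_n -> R) : \sum_i (c * (i == k)%:R) * f i = c * f k.
Proof.
rewrite (bigD1 k)//= eqxx mulr1 big1 ?addr0// => i /negbTE ->.
by rewrite mulr0 mul0r.
Qed.

Lemma irredundant3 l i j k (a b c : R) : i != l -> j != l -> k != l ->
  0 <= a -> 0 <= b -> 0 <= c -> a + b + c = 1 ->
  (v l).1 = a * (v i).1 + b * (v j).1 + c * (v k).1 ->
  (v l).2 = a * (v i).2 + b * (v j).2 + c * (v k).2 -> False.
Proof.
move=> il jl kl a0 b0 c0 abc e1 e2.
pose w (m : 'I_n) : R := a * (m == i)%:R + b * (m == j)%:R + c * (m == k)%:R.
have S (f : 'I_n -> R) : \sum_m w m * f m = a * f i + b * f j + c * f k.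
  rewrite -!sum_delta -!big_split /=; apply: eq_bigr => m _.
  by rewrite /w !mulrDl.
apply: (irr (k := l) (w := w)).
- by move=> m; rewrite /w !addr_ge0// mulr_ge0.
- by rewrite -(eq_bigr _ (fun i _ => mulr1 _)) (S (fun=> 1)) !mulr1.
- by rewrite /w ![l == _]eq_sym (negbTE il) (negbTE jl) (negbTE kl) !mulr0 !addr0.
- by rewrite !S -e1 -e2 -surjective_pairing.
Qed.

Lemma irredundant2 k i j (s : R) : i != k -> j != k -> 0 <= s <= 1 ->
  (v k).1 = (1 - s) * (v i).1 + s * (v j).1 ->
  (v k).2 = (1 - s) * (v i).2 + s * (v j).2 -> False.
Proof.
move=> ik jk /andP[s0 s1] e1 e2.
apply: (@irredundant3 k i j j (1 - s) s 0) => //; rewrite ?subr_ge0//.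
- by ring.
- by rewrite e1; ring.
- by rewrite e2; ring.
Qed.

Lemma irredundant_inj : injective v.
Proof.
move=> i j e; apply/eqP/negPn/negP => ij.
apply: (@irredundant2 i j j 0); rewrite 1?eq_sym ?lexx ?ler01// e; ring.
Qed.

Lemma irredundant_noncollinear : noncollinear v.
Proof.
move=> i j k ij jk ik; apply/eqP => o0.
have [s [s1 s2]] : exists s : R, (v k).1 - (v i).1 = s * ((v j).1 - (v i).1) /\
    (v k).2 - (v i).2 = s * ((v j).2 - (v i).2).
  move: o0; rewrite /orient /cross /vsub /= => o0.
  have [dx0|dx0] := eqVneq ((v j).1 - (v i).1) 0; last first.
    exists (((v k).1 - (v i).1) / ((v j).1 - (v i).1)); split; first by field.
    by apply: (mulfI dx0); rewrite -[LHS]subr0 -[X in _ - X]o0; field.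
  have [dy0|dy0] := eqVneq ((v j).2 - (v i).2) 0.
    move/eqP : ij; case; apply: irredundant_inj.
    move: dx0 dy0 => /eqP; rewrite subr_eq0 => /eqP e1 /eqP; rewrite subr_eq0 => /eqP e2.
    by rewrite (surjective_pairing (v i)) -e1 -e2 -surjective_pairing.
  exists (((v k).2 - (v i).2) / ((v j).2 - (v i).2)); split; last by field.
  move: o0; rewrite dx0 mul0r sub0r mulr0 => /eqP; rewrite oppr_eq0 mulf_eq0 (negbTE dy0) /=.
  by move/eqP.
have [ji kj ki] : [/\ j != i, k != j & k != i] by split; rewrite eq_sym.
(* Of three collinear points one lies between the others: [i] if [s < 0], [k] if [0 <= s <= 1], and
   [j] if [s > 1]. *)
have [sn|s0] := ltP s 0.
  have t0 : 0 < 1 - s by lra.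
  apply: (@irredundant2 i j k (1 - s)^-1) => //.
  - by rewrite invr_ge0 ltW//= invf_le1//; lra.
  - by apply: (mulfI (lt0r_neq0 t0)); rewrite mulrDr !mulrA mulrBr divff ?mulr1 ?gt_eqF//; lra.
  - by apply: (mulfI (lt0r_neq0 t0)); rewrite mulrDr !mulrA mulrBr divff ?mulr1 ?gt_eqF//; lra.
have [sl|sl] := leP s 1.
  apply: (@irredundant2 k i j s) => //; rewrite ?s0//; lra.
have s0' : s != 0 by rewrite gt_eqF// (lt_trans ltr01).
apply: (@irredundant2 j i k s^-1) => //.
- by rewrite invr_ge0 s0 invf_le1 ?ltW// (lt_trans ltr01).
- by apply: (mulfI s0'); rewrite mulrDr !mulrA mulrBr divff ?mulr1//; lra.
- by apply: (mulfI s0'); rewrite mulrDr !mulrA mulrBr divff ?mulr1//; lra.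
Qed.

Lemma irredundant_no_inner_vertex : no_inner_vertex v.
Proof.
move=> i j k l -[h1 h2 h3].
have neq (a b c : 'I_n) : 0 < orient (v a) (v b) (v c) -> b != a.
  by apply: contraTneq => ->; rewrite /orient /cross /vsub !subrr !mul0r subrr ltxx.
have il := neq _ _ _ h1; have jl := neq _ _ _ h2; have kl := neq _ _ _ h3.
(* The barycentric coordinates of the inner point are ratios of oriented areas to the area [D] of
   the triangle. *)
pose D := orient (v l) (v j) (v k) + orient (v l) (v k) (v i) + orient (v l) (v i) (v j).
have D0 : 0 < D by apply: addr_gt0 => //; apply: addr_gt0.
apply: (@irredundant3 l i j k (orient (v l) (v j) (v k) / D)
  (orient (v l) (v k) (v i) / D) (orient (v l) (v i) (v j) / D)) => //; rewrite ?divr_ge0 ?ltW//.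
- by rewrite -!mulrDl divff ?gt_eqF.
- apply: (mulIf (lt0r_neq0 D0)); rewrite ![_ / D * _]mulrAC -!mulrDl divfK ?gt_eqF//.
  by rewrite /D /orient /cross /vsub /=; ring.
- apply: (mulIf (lt0r_neq0 D0)); rewrite ![_ / D * _]mulrAC -!mulrDl divfK ?gt_eqF//.
  by rewrite /D /orient /cross /vsub /=; ring.
Qed.

Lemma irredundant_convex_position : convex_position v.
Proof.
split; [exact: irredundant_inj|exact: irredundant_noncollinear|exact: irredundant_no_inner_vertex].
Qed.

Lemma sum_weight_le1 (w : 'I_n -> R) k : (forall i, 0 <= w i) -> \sum_i w i = 1 -> w k <= 1.
Proof.
by move=> w0 <-; rewrite (bigD1 k)//= lerDl sumr_ge0.
Qed.

Lemma sum_weight_1 (w : 'I_n -> R) k (f : 'I_n -> R) : (forall i, 0 <= w i) ->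
  \sum_i w i = 1 -> w k = 1 -> \sum_i w i * f i = f k.
Proof.
move=> w0 w1 wk; move: w1; rewrite (bigD1 k)//= wk -[RHS]addr0 => /addrI /psumr_eq0P.
move=> H; rewrite (bigD1 k)//= wk mul1r big1 ?addr0// => i ik.
by rewrite H ?mul0r.
Qed.

Lemma weight_split (w : 'I_n -> R) k (f : 'I_n -> R) : w k != 1 ->
  \sum_i w i * f i = (1 - (1 - w k)) * f k +
    (1 - w k) * \sum_i (if i == k then 0 else w i / (1 - w k)) * f i.
Proof.
move=> wk; have d0 : 1 - w k != 0 by rewrite subr_eq0 eq_sym.
rewrite (_ : 1 - (1 - w k) = w k); last by ring.
rewrite (bigD1 k)//=; congr (_ + _).
rewrite mulr_sumr [RHS](bigD1 k)//= eqxx mul0r mulr0 add0r.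
apply: eq_bigr => i /negbTE ->; by field.
Qed.

Lemma weight_split_sum (w : 'I_n -> R) k : \sum_i w i = 1 -> w k != 1 ->
  \sum_i (if i == k then 0 else w i / (1 - w k)) = 1.
Proof.
move=> w1 wk; have d0 : 1 - w k != 0 by rewrite subr_eq0 eq_sym.
have := @weight_split w k (fun=> 1) wk; rewrite !(eq_bigr _ (fun i _ => mulr1 _)) w1.
set S := \sum_i _ => e; apply: (mulfI d0); lra.
Qed.

(** If some weight [w k] lies strictly between 0 and 1, [x] is strictly between [v k] and the
    normalized rest [z]. Extremality gives [v k = z], hence [x = v k]. *)
Lemma extreme_vertex x : extreme_point (hull v) x -> exists k, x = v k.
Proof.
move=> [[w [w0 [w1 xE]]] ext].
have [k wk] : exists k, w k != 0.
  apply: contrapT => /forallNP H; move: w1; rewrite big1 => [/eqP|i _].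
    by rewrite eq_sym oner_eq0.
  by apply/eqP/negPn/negP; exact: H.
exists k; have [wk1|wk1] := eqVneq (w k) 1.
  by rewrite xE !(sum_weight_1 _ w0 w1 wk1) -surjective_pairing.
have d0 : 0 < 1 - w k by rewrite subr_gt0 lt_neqAle wk1 sum_weight_le1.
pose w' i := if i == k then 0 else w i / (1 - w k).
pose z : R * R := (\sum_i w' i * (v i).1, \sum_i w' i * (v i).2).
have hz : hull v z.
  exists w'; split; last by split => //; exact: weight_split_sum.
  by move=> i; rewrite /w'; case: ifP => // _; rewrite divr_ge0// ltW.
have xz : x = ((1 - (1 - w k)) * (v k).1 + (1 - w k) * z.1, (1 - (1 - w k)) * (v k).2 + (1 - w k) * z.2).
  by rewrite xE /z /= -!weight_split.
have wk0 : 0 < w k by rewrite lt_neqAle eq_sym wk w0.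
have vz := ext (v k) z (1 - w k) (hull_vertex v k) hz; rewrite xz -vz; last 2 first.
- by rewrite d0 /=; lra.
- exact: xz.
by rewrite [RHS](surjective_pairing (v k)); congr pair; ring.
Qed.

(** On a segment through [v k] the combined weight of [k] must be 1, otherwise the normalized rest
    would express [v k] by the other points. Then both ends have weight 1 at [k]. *)
Lemma vertex_extreme k : extreme_point (hull v) (v k).
Proof.
split=> [|y z s [a [a0 [a1 ->]]] [b [b0 [b1 ->]]] /andP[s0 s1] /= e]; first exact: hull_vertex.
pose c i := (1 - s) * a i + s * b i.
have c0 i : 0 <= c i by rewrite addr_ge0// mulr_ge0// ?subr_ge0 ltW.
have C (f : 'I_n -> R) : \sum_i c i * f i = (1 - s) * (\sum_i a i * f i) + s * (\sum_i b i * f i).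
  by rewrite !mulr_sumr -big_split /=; apply: eq_bigr => i _; rewrite /c; ring.
have c1 : \sum_i c i = 1.
  rewrite -(eq_bigr _ (fun i _ => mulr1 _)) (C (fun=> 1)) !(eq_bigr _ (fun i _ => mulr1 _)) a1 b1.
  by ring.
have ck : c k = 1.
  apply/eqP/negPn/negP => ck1.
  have d0 : 0 < 1 - c k by rewrite subr_gt0 lt_neqAle ck1 sum_weight_le1.
  pose w' i := if i == k then 0 else c i / (1 - c k).
  have V (f : 'I_n -> R) : f k = \sum_i c i * f i -> f k = \sum_i w' i * f i.
    rewrite (weight_split _ ck1) => E; apply: (mulfI (lt0r_neq0 d0)).
    rewrite -/w' in E; move: E; set Z := \sum_i _ => E; lra.
  apply: (irr (k := k) (w := w')).
  - by move=> i; rewrite /w'; case: ifP => // _; rewrite divr_ge0// ltW.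
  - exact: weight_split_sum.
  - by rewrite /w' eqxx.
  - rewrite (surjective_pairing (v k)); congr pair.
      by apply: (V (fun i => (v i).1)); rewrite C [in LHS]e.
    by apply: (V (fun i => (v i).2)); rewrite C [in LHS]e.
have ak := sum_weight_le1 k a0 a1; have bk := sum_weight_le1 k b0 b1.
have ak1 : a k = 1 by apply/eqP; rewrite eq_le ak /=; move: ck; rewrite /c; nra.
have bk1 : b k = 1 by apply/eqP; rewrite eq_le bk /=; move: ck; rewrite /c; nra.
by rewrite !(sum_weight_1 _ a0 a1 ak1) !(sum_weight_1 _ b0 b1 bk1).
Qed.

(** At most two points span a subset of a line, whereas a disc contains three affinely independent
    points. *)
Lemma interior_three_vertices (c : R * R) (r : R) : 0 < r ->
  (forall x, (x.1 - c.1) ^+ 2 + (x.2 - c.2) ^+ 2 < r ^+ 2 -> hull v x) -> (2 < n)%N.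
Proof.
move=> r0 H; rewrite ltnNge; apply/negP => n2.
have h0 : hull v c by apply: H; rewrite !subrr !expr0n addr0 exprn_gt0.
have r2 : (r / 2) ^+ 2 < r ^+ 2 by rewrite !expr2; nra.
have h1 : hull v (c.1 + r / 2, c.2).
  by apply: H; rewrite /= (_ : _ + _ = (r / 2) ^+ 2)//; ring.
have h2 : hull v (c.1, c.2 + r / 2).
  by apply: H; rewrite /= (_ : _ + _ = (r / 2) ^+ 2)//; ring.
have [i [j ij]] : exists i j : 'I_n, forall k, k = i \/ k = j.
  case: (n) n2 v h0 => [|[|[|//]]] _ v' h0.
  - by case: h0 => w [_ [+ _]]; rewrite big_ord0 => /eqP; rewrite eq_sym oner_eq0.
  - by exists ord0, ord0 => k; left; rewrite ord1.
  - exists ord0, (lift ord0 ord0) => k; case: (unliftP ord0 k) => [m ->|->]; last by left.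
    by right; rewrite ord1.
have line (a b d : R) : (forall k, a * (v k).1 + b * (v k).2 + d = 0) -> a = 0 /\ b = 0.
  move=> E; have Z p : hull v p -> a * p.1 + b * p.2 + d = 0.
    move=> hp; apply/eqP; rewrite eq_le; apply/andP; split.
      have : 0 <= - a * p.1 + - b * p.2 + - d by apply: (hull_affine_ge0 hp) => k; have := E k; lra.
      lra.
    by apply: (hull_affine_ge0 hp) => k; rewrite E.
  have := Z _ h0; have := Z _ h1; have := Z _ h2; rewrite /= => e2 e1 e0.
  by split; apply: (mulIf (lt0r_neq0 (divr_gt0 r0 (ltr0Sn R 1)))); rewrite mul0r; lra.
have [dx dy] := line (- ((v j).2 - (v i).2)) ((v j).1 - (v i).1)
  (((v j).2 - (v i).2) * (v i).1 - ((v j).1 - (v i).1) * (v i).2) (fun k => match ij k with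
    | or_introl e => ltac:(rewrite e; ring) | or_intror e => ltac:(rewrite e; ring) end).
have e : v i = v j.
  by rewrite (surjective_pairing (v i)) (surjective_pairing (v j)); congr pair; lra.
have [] := line 1 0 (- (v i).1); last by move/eqP; rewrite oner_eq0.
by move=> k; case: (ij k) => ->; rewrite -?e; ring.
Qed.

End Vertices.

(** * Rotated and dilated polygons, and the discrepancy as a count *)

Section Placement.
Variable R : realType.
Implicit Types (rho th x y t d : R) (p q : R * R).
Notation mu := (@lebesgue_measure R).

(* [k] lies in [rho * rot th C + t] if and only if [t - k] lies in [place rho th @` C]. *)
Definition place rho th p : R * R := (- (rho * (Defs.rot th p).1), - (rho * (Defs.rot th p).2)).

Lemma hull_place n (v : 'I_n -> R * R) rho th q :
  hull (fun k => place rho th (v k)) q <-> exists p, hull v p /\ q = place rho th p.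
Proof.
have S (w : 'I_n -> R) : place rho th (\sum_(i < n) w i * (v i).1, \sum_(i < n) w i * (v i).2) =
    (\sum_(i < n) w i * (place rho th (v i)).1, \sum_(i < n) w i * (place rho th (v i)).2).
  rewrite /place /Defs.rot /=; congr pair.
    rewrite mulrBr opprB !mulr_sumr -sumrB; apply: eq_bigr => i _; ring.
  rewrite mulrDr opprD !mulr_sumr -!sumrN -big_split; apply: eq_bigr => i _ /=; ring.
split=> [[w [w0 [w1 ->]]]|[p [[w [w0 [w1 ->]]] ->]]].
  exists (\sum_(i < n) w i * (v i).1, \sum_(i < n) w i * (v i).2); split; last by rewrite S.
  by exists w.
by exists w; split => //; split => //; rewrite S.
Qed.

Lemma orient_place rho th p q r :
  orient (place rho th p) (place rho th q) (place rho th r) = rho ^+ 2 * orient p q r.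
Proof.
transitivity ((cos th ^+ 2 + sin th ^+ 2) * rho ^+ 2 * orient p q r).
  by rewrite /orient /cross /vsub /place /Defs.rot /=; ring.
by rewrite cos2Dsin2 mul1r.
Qed.

Lemma edge_place n (v : 'I_n -> R * R) rho th i j : 0 < rho ->
  edge (fun k => place rho th (v k)) i j = edge v i j.
Proof.
move=> r0; apply/edgeP/edgeP => -[ij H]; split => // k ki kj.
  by have := H k ki kj; rewrite orient_place pmulr_rgt0// exprn_gt0.
by rewrite orient_place pmulr_rgt0 ?H// exprn_gt0.
Qed.

Lemma place_inj rho th : 0 < rho -> injective (place rho th).
Proof.
move=> r0 p q [/eqP]; rewrite eqr_opp (inj_eq (mulfI (lt0r_neq0 r0))) => /eqP e1.
move=> /eqP; rewrite eqr_opp (inj_eq (mulfI (lt0r_neq0 r0))) => /eqP e2.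
have C := cos2Dsin2 th.
have R1 (z : R * R) : z.1 = cos th * (cos th * z.1 - sin th * z.2) + sin th * (sin th * z.1 + cos th * z.2).
  by rewrite -[LHS]mul1r -C; ring.
have R2 (z : R * R) : z.2 = cos th * (sin th * z.1 + cos th * z.2) - sin th * (cos th * z.1 - sin th * z.2).
  by rewrite -[LHS]mul1r -C; ring.
rewrite (surjective_pairing p) (surjective_pairing q); congr pair.
  by rewrite (R1 p) (R1 q) e1 e2.
by rewrite (R2 p) (R2 q) e1 e2.
Qed.

Lemma convex_position_place n (v : 'I_n -> R * R) rho th : 0 < rho ->
  convex_position v -> convex_position (fun k => place rho th (v k)).
Proof.
move=> r0 [vi vn vt]; have r2 : 0 < rho ^+ 2 by rewrite exprn_gt0.
split.
- by move=> i j /(place_inj r0) /vi.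
- by move=> i j k ij jk ik; rewrite orient_place mulf_neq0 ?(gt_eqF r2)// vn.
- move=> i j k l; rewrite !orient_place !pmulr_rgt0//; exact: vt.
Qed.

(** The shoelace form shows the behaviour under rotation and dilation, which the trapezoid form
    defining [poly_area] hides. *)
Lemma poly_area_cross n (v : 'I_n -> R * R) : convex_position v -> (1 < n)%N ->
  poly_area v = 2^-1 * \sum_i \sum_(j | edge v i j) cross (v i) (v j).
Proof.
move=> cv n1; rewrite /poly_area.
transitivity (- \sum_i \sum_(j | edge v i j) ((v j).1 - (v i).1) * (((v i).2 + (v j).2) / 2) +
   \sum_i \sum_(j | edge v i j) ((v j).1 * (v j).2 / 2 - (v i).1 * (v i).2 / 2)).
  by rewrite (sum_edges_telescope (fun k => (v k).1 * (v k).2 / 2) cv n1) addr0.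
rewrite -sumrN -big_split mulr_sumr /=; apply: eq_bigr => i _.
rewrite -sumrN -big_split mulr_sumr /=; apply: eq_bigr => j _.
by rewrite /cross; field.
Qed.

Lemma poly_area_place n (v : 'I_n -> R * R) rho th : 0 < rho -> convex_position v -> (1 < n)%N ->
  poly_area (fun k => place rho th (v k)) = rho ^+ 2 * poly_area v.
Proof.
move=> r0 cv n1; rewrite !poly_area_cross//; last exact: convex_position_place.
rewrite mulrCA; congr (_ * _); rewrite mulr_sumr; apply: eq_bigr => i _.
rewrite mulr_sumr; apply: eq_big => [j|j _]; first by rewrite edge_place.
transitivity ((cos th ^+ 2 + sin th ^+ 2) * rho ^+ 2 * cross (v i) (v j)).
  by rewrite /cross /place /Defs.rot /=; ring.
by rewrite cos2Dsin2 mul1r.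
Qed.

(** The bound is uniform in [th], so that one tiling serves the whole angular integral. *)
Lemma placed_bound n (v : 'I_n -> R * R) rho : exists B : nat, forall th k,
  `|(place rho th (v k)).1| <= B%:R /\ `|(place rho th (v k)).2| <= B%:R.
Proof.
pose C := \sum_k `|rho| * (`|(v k).1| + `|(v k).2|).
have [B HB] : exists B : nat, C <= B%:R.
  by exists (Num.Def.archi_bound C); rewrite ltW// archi_boundP// sumr_ge0// => k _; rewrite mulr_ge0// addr_ge0.
exists B => th k.
have kC : `|rho| * (`|(v k).1| + `|(v k).2|) <= B%:R.
  apply: le_trans HB; rewrite /C (bigD1 k)//= lerDl sumr_ge0// => i _.
have cs (a b x y : R) : `|a| <= 1 -> `|b| <= 1 -> `|a * x + b * y| <= `|x| + `|y|.
  move=> a1 b1; rewrite (le_trans (ler_normD _ _))// !normrM.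
  by rewrite lerD// ler_piMl.
have c1 := cos_max th; have s1 := sin_max th.
rewrite /place /Defs.rot /= !normrN !normrM; split; apply: le_trans kC; rewrite ler_wpM2l//.
  by rewrite -mulNr cs// normrN.
exact: cs.
Qed.

Lemma lattice_countE n (v : 'I_n -> R * R) rho th (B : nat) t1 t2 :
  (forall k, `|(place rho th (v k)).1| <= B%:R /\ `|(place rho th (v k)).2| <= B%:R) ->
  torus t1 -> torus t2 ->
  lattice_count (dil_rot_trans rho th (t1, t2) (hull v)) =
  (count (fun k => place rho th (v k)) B t1 t2)%:E.
Proof.
set w := fun k => place rho th (v k) => wB T1 T2.
set M := (B + B).+1.
(* [t + shift m] is [t - k] for the lattice point [k = B - m]. Since [|t| <= 1/2], every lattice
   point that counts has this form. *)
pose K (m : 'I_M * 'I_M) : int * int := (B%:Z - (m.1 : nat)%:Z, B%:Z - (m.2 : nat)%:Z).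
pose Q := [set m : 'I_M * 'I_M | hull w (t1 + shift R B m.1, t2 + shift R B m.2)].
have hullB (q : R * R) : hull w q -> `|q.1| <= B%:R /\ `|q.2| <= B%:R.
  move=> hq; rewrite !ler_norml.
  have L1 := @hull_affine_ge0 _ _ w 1 0 B%:R q hq; have L2 := @hull_affine_ge0 _ _ w (-1) 0 B%:R q hq.
  have L3 := @hull_affine_ge0 _ _ w 0 1 B%:R q hq; have L4 := @hull_affine_ge0 _ _ w 0 (-1) B%:R q hq.
  have b k : (- B%:R <= (w k).1 <= B%:R) /\ (- B%:R <= (w k).2 <= B%:R).
    by have := wB k; rewrite !ler_norml.
  split; apply/andP; split.
  - by have := L1 (fun k => ltac:(have [/andP[? ?] _] := b k; lra)); lra.
  - by have := L2 (fun k => ltac:(have [/andP[? ?] _] := b k; lra)); lra.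
  - by have := L3 (fun k => ltac:(have [_ /andP[? ?]] := b k; lra)); lra.
  - by have := L4 (fun k => ltac:(have [_ /andP[? ?]] := b k; lra)); lra.
have intB (z : int) t : torus t -> `|t - z%:~R| <= B%:R -> exists m : 'I_M, z = B%:Z - (m : nat)%:Z.
  move=> /andP[ta tb]; rewrite ler_norml => /andP[za zb].
  have z1 : z%:~R < (B%:Z + 1)%:~R :> R by rewrite intrD; lra.
  have z2 : (- (B%:Z) - 1)%:~R < z%:~R :> R by rewrite intrD intrN; lra.
  move: z1 z2; rewrite !ltr_int => z1 z2.
  have mM : (`|B%:Z - z| < M)%N by rewrite /M; lia.
  by exists (Ordinal mM) => /=; lia.
have E : [set k : int * int | dil_rot_trans rho th (t1, t2) (hull v) ((k.1)%:~R, (k.2)%:~R)] = K @` Q.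
  apply/seteqP; split => [[z1 z2]|_ [[m1 m2] /= /hull_place[p [hp [e1 e2]]] <-]] /=.
    move=> [p hp [e1 e2]].
    have hq : hull w (t1 - z1%:~R, t2 - z2%:~R).
      by apply/hull_place; exists p; split => //; rewrite /place -e1 -e2 /=; congr pair; ring.
    have [b1 b2] := hullB _ hq.
    have [m1 em1] := intB _ _ T1 b1; have [m2 em2] := intB _ _ T2 b2.
    exists (m1, m2); last by rewrite /K /= -em1 -em2.
    rewrite /Q /=; suff -> : (t1 + shift R B m1, t2 + shift R B m2) = (t1 - z1%:~R, t2 - z2%:~R) by [].
    by rewrite em1 em2 /shift !intrB /=; congr pair; rewrite -!pmulrn; ring.
  exists p => //=; rewrite !intrB -!pmulrn; move: e1 e2; rewrite /shift => e1 e2.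
  by congr pair; lra.
rewrite /lattice_count E esum_image; last first.
  move=> [a1 a2] [b1 b2] _ _ [e1 e2]; congr pair; apply/val_inj => /=; lia.
rewrite esum_mkcond esum_fset; [|exact: finite_finset|by move=> m _; case: ifP].
rewrite (_ : [set: 'I_M * 'I_M] = [set` index_enum ('I_M * 'I_M)%type]); last first.
  by apply/seteqP; split => x //= _; rewrite mem_index_enum.
rewrite -fsbig_seq ?index_enum_uniq//=.
rewrite (eq_bigr (fun m : 'I_M * 'I_M =>
   (((t1 + shift R B m.1, t2 + shift R B m.2) \in hull w)%:R : R)%:E)); last first.
  move=> m _; case: ifPn => [/set_mem h|h]; first by rewrite mem_set.
  by rewrite memNset// => h'; move/negP : h; apply; apply/mem_set.
by rewrite sumEFin /count pair_big.
Qed.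

Lemma discrepancyE n (v : 'I_n -> R * R) rho th (B : nat) t1 t2 :
  convex_position v -> (1 < n)%N -> 0 < rho ->
  (forall k, `|(place rho th (v k)).1| <= B%:R /\ `|(place rho th (v k)).2| <= B%:R) ->
  torus t1 -> torus t2 ->
  discrepancy (hull v) rho th (t1, t2) =
  (count (fun k => place rho th (v k)) B t1 t2 - poly_area (fun k => place rho th (v k)))%:E.
Proof.
move=> cv n1 r0 wB T1 T2; rewrite /discrepancy (lattice_countE wB)//.
have [B0 HB0] := placed_bound v 1.
have -> : area (hull v) = (poly_area v)%:E.
  have [B1 HB1] : exists B1 : nat, forall k, `|(v k).1| <= B1%:R /\ `|(v k).2| <= B1%:R.
    exists B0 => k; have := HB0 0 k; rewrite /place /Defs.rot /= cos0 sin0 !normrN !mul1r !mul0r.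
    by rewrite subr0 add0r.
  exact: (area_hull cv HB1).
by rewrite poly_area_place// EFinB EFinM.
Qed.

Lemma L2sq_discrepancyE n (v : 'I_n -> R * R) rho (B : nat) :
  convex_position v -> (1 < n)%N -> 0 < rho ->
  (forall th k, `|(place rho th (v k)).1| <= B%:R /\ `|(place rho th (v k)).2| <= B%:R) ->
  L2sq_discrepancy (hull v) rho = (((2 * pi)^-1)%:E *
   \int[mu]_(th in [set th : R | (0 <= th < 2 * pi)%R])
    \int[mu]_(t1 in @torus R) \int[mu]_(t2 in @torus R)
      ((count (fun k => place rho th (v k)) B t1 t2 -
        poly_area (fun k => place rho th (v k))) ^+ 2)%:E)%E.
Proof.
move=> cv n1 r0 wB; rewrite /L2sq_discrepancy.
apply: (congr1 (fun z => ((2 * pi)^-1)%:E * z)%E).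
apply: eq_integral => th _; apply: eq_integral => t1 T1; apply: eq_integral => t2 T2.
rewrite (@discrepancyE _ v rho th B)//; [|exact/set_mem|exact/set_mem].
by rewrite abse_EFin -EFinM -normrM -expr2 ger0_norm ?sqr_ge0.
Qed.

End Placement.

(** * Lower bound from an unpaired edge *)

Section TrigBounds.
Variable R : realType.
Implicit Types x y : R.

Lemma cos_lipschitz x y : `|cos x - cos y| <= `|x - y|.
Proof.
set p := (x + y) / 2; set q := (x - y) / 2.
have -> : x = p + q by rewrite /p /q; field.
have -> : y = p - q by rewrite /p /q; field.
have -> : cos (p + q) - cos (p - q) = - (2 * sin p * sin q) by rewrite cosD cosB; ring.
have -> : p + q - (p - q) = 2 * q by ring.
clearbody p q; rewrite normrN !normrM -mulrA ler_wpM2l// -[leRHS]mul1r.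
by rewrite ler_pM// ?sin_max ?ler_sin_self.
Qed.

Lemma one_sub_cos_le x : 0 <= 1 - cos x <= x ^+ 2.
Proof.
rewrite subr_ge0 cos_le1 /=.
set q := x / 2; have -> : x = q + q by rewrite /q; field.
have -> : 1 - cos (q + q) = 2 * sin q ^+ 2 by rewrite cosD -!expr2 cos2sin2; ring.
have h := ler_sin_self q.
have : sin q ^+ 2 <= q ^+ 2.
  by rewrite -(real_normK (num_real (sin _))) -[leRHS](real_normK (num_real _)) ler_sqr ?nnegrE.
by have := sqr_ge0 q; rewrite !expr2; lra.
Qed.

Lemma sin_gt0_small x : 0 < x -> x <= 4^-1 -> 0 < sin x.
Proof. by move=> x0 x4; rewrite sin2_gt0// x0 /=; lra. Qed.

Lemma cos_ge_small x : 0 < x -> x <= 4^-1 -> 3 / 4 <= cos x.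
Proof.
move=> x0 x4; have /andP[_ h] := one_sub_cos_le x.
have : x ^+ 2 <= 4^-1 by rewrite expr2; nra.
by lra.
Qed.

Lemma rotD th phi (p : R * R) : Defs.rot (th + phi) p = Defs.rot phi (Defs.rot th p).
Proof. by rewrite /Defs.rot cosD sinD /=; congr pair; ring. Qed.

End TrigBounds.

Section LowerBound.
Variables (R : realType) (n : nat) (v u : 'I_n -> R * R) (i0 j0 star : 'I_n) (th0 : R).
Implicit Types (x y rho phi s W : R) (k l : 'I_n).
Notation mu := (@lebesgue_measure R).

Hypothesis uE : forall k, u k = Defs.rot th0 (v k).
Definition tau k : R := (u k).1 - (u star).1.
Definition elev k : R := (u k).2 - (u star).2.
(** The cosine of the phase of vertex [k] relative to [star], with [cos phi] replaced by 1 in the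
    term of [elev]. Multiplied by [cos phi], it then has an elementary antiderivative. *)
Definition wave s k phi : R := cos (s * tau k * sin phi + s * elev k).
Definition flat k l : bool := (u k).2 == (u l).2.
Definition run k l : R := (u l).1 - (u k).1.
Definition rise k l : R := (u l).2 - (u k).2.

Hypotheses (cv : convex_position v) (n1 : (1 < n)%N).
Hypotheses (e0 : edge v i0 j0) (flat0 : flat i0 j0).
Hypothesis starP : star = i0 \/ star = j0.
Hypothesis good : forall k l, edge v k l -> flat k l -> (k, l) != (i0, j0) ->
  tau k != 0 /\ tau l != 0.

Let sigma : R := if star == i0 then 1 else -1.

(** Error constants: [K] for slanted edges, [H] for replacing [cos phi] by 1 in the phases, [G] for
    the oscillating waves. Terms with a zero denominator are 0 by convention. *)
Let K : R := \sum_k \sum_(l | edge v k l) 4 * (`|run k l| + `|rise k l|) / `|rise k l|.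
Let H : R := \sum_k \sum_(l | edge v k l) (`|elev k| + `|elev l|).
Let G : R := \sum_k \sum_(l | edge v k l) (`|tau k|^-1 + `|tau l|^-1).

Lemma sum_edges_ge0 (f : 'I_n -> 'I_n -> R) : (forall k l, 0 <= f k l) ->
  0 <= \sum_k \sum_(l | edge v k l) f k l.
Proof. by move=> f0; apply: sumr_ge0 => k _; apply: sumr_ge0. Qed.

Lemma flat_run_neq0 k l : edge v k l -> flat k l -> run k l != 0.
Proof.
have [vi _ _] := cv; move=> e /eqP f; apply/eqP => /eqP; rewrite subr_eq0 => /eqP f1.
have ukl : u k = u l by rewrite (surjective_pairing (u k)) (surjective_pairing (u l)) f1 f.
have : place 1 th0 (v k) = place 1 th0 (v l) by rewrite /place -!uE ukl.
by move/(place_inj ltr01)/vi => kl; case/edgeP: e; rewrite kl eqxx.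
Qed.

Section Window.
Variables (rho s phi W d : R) (m : nat) (w : 'I_n -> R * R).
Hypotheses (m0 : (0 < m)%N) (r0 : 0 < rho) (phi_gt0 : 0 < phi) (phiW : phi <= W).
Hypotheses (W4 : W <= 4^-1)
  (Wslope : forall k l, edge v k l -> ~~ flat k l -> W * `|run k l| <= `|rise k l| / 4).
Hypotheses (sE : s = 2 * pi * m%:R * rho)
  (wE : forall k, w k = place rho (th0 + phi) (v k))
  (dE : d = - (2 * pi * m%:R * (w star).2)).

(** The phase [d] is normalized at [star], where [c] equals 1. *)
Let c k : R := cos (2 * pi * m%:R * (w k).2 + d).

Lemma wE1 k : (w k).1 = - (rho * (cos phi * (u k).1 - sin phi * (u k).2)).
Proof. by rewrite wE /place rotD -uE. Qed.

Lemma wE2 k : (w k).2 = - (rho * (sin phi * (u k).1 + cos phi * (u k).2)).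
Proof. by rewrite wE /place rotD -uE. Qed.

Lemma s_gt0 : 0 < s.
Proof. by rewrite sE !mulr_gt0 ?pi_gt0 ?ltr0n. Qed.

Lemma sin_phi_gt0 : 0 < sin phi.
Proof. exact: sin_gt0_small phi_gt0 (le_trans phiW W4). Qed.

Lemma sin_phi_le : sin phi <= W.
Proof.
have := ler_sin_self phi; rewrite (gtr0_norm phi_gt0) => h.
exact: le_trans (ler_norm _) (le_trans h phiW).
Qed.

Lemma cE k : c k = cos (s * tau k * sin phi + s * elev k * cos phi).
Proof.
rewrite /c dE !wE2 -[RHS]cosN; congr cos.
by rewrite sE /tau /elev; ring.
Qed.

Lemma wave_close k : `|cos phi * c k - cos phi * wave s k phi| <= s * `|elev k| * W ^+ 2.
Proof.
rewrite -mulrBr normrM cE /wave.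
apply: (@le_trans _ _ (1 * `|s * elev k * (cos phi - 1)|)).
  rewrite ler_pM ?normr_ge0 ?cos_max// (le_trans (cos_lipschitz _ _))//.
  by rewrite le_eqVlt; apply/orP; left; apply/eqP; congr `|_|; ring.
rewrite mul1r normrM normrM (gtr0_norm s_gt0).
apply: ler_wpM2l; first by rewrite mulr_ge0// ltW// s_gt0.
rewrite distrC; have /andP[h1 h2] := one_sub_cos_le phi.
rewrite ger0_norm// (le_trans h2)// ler_sqr ?nnegrE ?(ltW phi_gt0)//.
exact: le_trans (ltW phi_gt0) phiW.
Qed.

Lemma edge_term k l : (w l).2 - (w k).2 != 0 ->
  2 * pi * m%:R * (((w l).1 - (w k).1) * edge_mean w 0 m%:R d k l) =
  ((w l).1 - (w k).1) / ((w l).2 - (w k).2) * (c k - c l).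
Proof.
move=> dy0; have e : m%:R * ((w l).2 - (w k).2) * edge_mean w 0 m%:R d k l =
    (2 * pi)^-1 * (c k - c l).
  have := edge_mean_along w 0 m%:R d k l; set E := edge_mean _ _ _ _ _ _.
  by rewrite mul0r add0r => ->; rewrite /c; congr (_ * (cos _ - cos _)); ring.
have -> : c k - c l = 2 * pi * (m%:R * ((w l).2 - (w k).2) * edge_mean w 0 m%:R d k l).
  by rewrite e mulrA mulfV ?mul1r// mulf_neq0 ?pi_neq0.
by move: (edge_mean _ _ _ _ _ _) (pi : R) => E p; field; rewrite dy0.
Qed.

(** All flat edges share the ratio [cos phi / sin phi] of horizontal to vertical extent. Multiplying
    by [sin phi] clears the singularity and leaves a difference of end point waves. *)
Lemma edge_term_flat k l : edge v k l -> flat k l ->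
  2 * pi * m%:R * (((w l).1 - (w k).1) * edge_mean w 0 m%:R d k l) * sin phi =
  cos phi * (c k - c l).
Proof.
move=> e f; have a0 := flat_run_neq0 e f; move/eqP: f => f.
have s0 := sin_phi_gt0.
have dyE : (w l).2 - (w k).2 = - (rho * sin phi * run k l).
  by rewrite !wE2 f /run; ring.
have dxE : (w l).1 - (w k).1 = - (rho * cos phi * run k l).
  by rewrite !wE1 f /run; ring.
rewrite edge_term; last by rewrite dyE oppr_eq0 !mulf_neq0// gt_eqF.
rewrite dxE dyE; move: (run k l) a0 (cos phi) (sin phi) s0 => r rn cp sp s0.
by field; rewrite rn !gt_eqF.
Qed.

(** Here that ratio stays bounded on the window, so the factor [sin phi <= W] makes the term
    O(W). *)
Lemma edge_term_slanted k l : edge v k l -> ~~ flat k l ->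
  `|2 * pi * m%:R * (((w l).1 - (w k).1) * edge_mean w 0 m%:R d k l) * sin phi| <=
  W * (4 * (`|run k l| + `|rise k l|) / `|rise k l|).
Proof.
move=> e f; have Wab := Wslope e f.
have b0 : rise k l != 0 by rewrite /rise subr_eq0 eq_sym.
have b0' : 0 < `|rise k l| by rewrite normr_gt0.
have s0 := sin_phi_gt0; have sle := sin_phi_le.
have /andP[c0 c1] := one_sub_cos_le phi.
have dxE : (w l).1 - (w k).1 = - (rho * (cos phi * run k l - sin phi * rise k l)).
  by rewrite !wE1 /run /rise; ring.
have dyE : (w l).2 - (w k).2 = - (rho * (sin phi * run k l + cos phi * rise k l)).
  by rewrite !wE2 /run /rise; ring.
have dx_le : `|(w l).1 - (w k).1| <= rho * (`|run k l| + `|rise k l|).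
  rewrite dxE normrN normrM (gtr0_norm r0) ler_wpM2l ?(ltW r0)//.
  rewrite (le_trans (ler_normB _ _))// !normrM lerD// ler_piMl// ?cos_max ?sin_max//.
have dy_ge : rho * (`|rise k l| / 2) <= `|(w l).2 - (w k).2|.
  rewrite dyE normrN normrM (gtr0_norm r0) ler_wpM2l ?(ltW r0)//.
  have h1 : `|sin phi * run k l| <= `|rise k l| / 4.
    by rewrite normrM (gtr0_norm s0) (le_trans _ Wab)// ler_wpM2r.
  have h2 : `|rise k l| * (3 / 4) <= `|cos phi * rise k l|.
    rewrite normrM mulrC ler_wpM2r//.
    exact: le_trans (cos_ge_small phi_gt0 (le_trans phiW W4)) (ler_norm _).
  have := lerB_normD (cos phi * rise k l) (sin phi * run k l).
  rewrite [_ + sin phi * run k l]addrC; lra.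
have dy0 : 0 < `|(w l).2 - (w k).2|.
  by apply: lt_le_trans dy_ge; rewrite mulr_gt0// divr_gt0.
rewrite edge_term -?normr_gt0// !normrM normfV (gtr0_norm s0).
have c2 : `|c k - c l| <= 2.
  by rewrite (le_trans (ler_normB _ _))// -[2]/(1 + 1) lerD// cos_max.
have q : `|(w l).1 - (w k).1| / `|(w l).2 - (w k).2| <= 2 * (`|run k l| + `|rise k l|) / `|rise k l|.
  rewrite ler_pdivrMr// (le_trans dx_le)//.
  rewrite (_ : rho * _ = 2 * (`|run k l| + `|rise k l|) / `|rise k l| * (rho * (`|rise k l| / 2))).
    by rewrite ler_wpM2l// divr_ge0// mulr_ge0// addr_ge0.
  by field; rewrite gt_eqF.
have -> : W * (4 * (`|run k l| + `|rise k l|) / `|rise k l|) =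
   (2 * (`|run k l| + `|rise k l|) / `|rise k l|) * 2 * W by ring.
apply: ler_pM; rewrite ?mulr_ge0 ?invr_ge0 ?(ltW s0)//.
by apply: ler_pM; rewrite ?mulr_ge0 ?invr_ge0.
Qed.

Lemma ftrans_lower : sigma * \sum_k \sum_(l | edge v k l)
    (flat k l)%:R * (cos phi * wave s k phi - cos phi * wave s l phi) - (W * K + s * W ^+ 2 * H) <=
  - (sigma * (2 * pi * m%:R) ^+ 2 * ftrans w 0 m%:R d * sin phi).
Proof.
have W_ge0 : 0 <= W by exact: le_trans (ltW phi_gt0) phiW.
have ew k l : edge w k l = edge v k l.
  by rewrite (_ : w = fun k => place rho (th0 + phi) (v k)) ?edge_place//; apply/funext.
have cw : convex_position w.
  by rewrite (_ : w = fun k => place rho (th0 + phi) (v k)); [exact: convex_position_place|apply/funext].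
pose T k l := 2 * pi * m%:R * (((w l).1 - (w k).1) * edge_mean w 0 m%:R d k l) * sin phi.
pose F k l : R := (flat k l)%:R * (cos phi * wave s k phi - cos phi * wave s l phi).
have -> : - (sigma * (2 * pi * m%:R) ^+ 2 * ftrans w 0 m%:R d * sin phi) =
    sigma * \sum_k \sum_(l | edge v k l) T k l.
  rewrite -(@ftransE _ _ w cw n1 0 m%:R d) ?pnatr_eq0 -?lt0n//.
  transitivity (sigma * (2 * pi * m%:R * sin phi * \sum_k \sum_(l | edge w k l)
    ((w l).1 - (w k).1) * edge_mean w 0 m%:R d k l)).
    have : 2 * pi * m%:R != 0 :> R by rewrite !mulf_neq0 ?pi_neq0 ?pnatr_eq0 -?lt0n.
    by move: (2 * pi * m%:R) (\sum_k _) => z S z0; field.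
  congr (_ * _); rewrite mulr_sumr; apply: eq_bigr => k _.
  rewrite mulr_sumr; apply: eq_big => [l|l _]; first exact: ew.
  by rewrite /T; ring.
have TF k l : edge v k l -> `|T k l - F k l| <=
    W * (4 * (`|run k l| + `|rise k l|) / `|rise k l|) + s * W ^+ 2 * (`|elev k| + `|elev l|).
  move=> e; rewrite /F; have [f|f] := boolP (flat k l).
    rewrite /T edge_term_flat// mul1r -[leLHS]add0r lerD//.
      by rewrite mulr_ge0// divr_ge0// mulr_ge0// addr_ge0.
    have := wave_close k; have := wave_close l => h2 h1.
    have -> : cos phi * (c k - c l) - (cos phi * wave s k phi - cos phi * wave s l phi) =
      (cos phi * c k - cos phi * wave s k phi) - (cos phi * c l - cos phi * wave s l phi) by ring.
    by rewrite (le_trans (ler_normB _ _))//; lra.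
  rewrite mul0r subr0 -[leLHS]addr0 lerD ?edge_term_slanted//.
  by rewrite mulr_ge0 ?addr_ge0// mulr_ge0 ?sqr_ge0// ltW// s_gt0.
have D : `|\sum_k \sum_(l | edge v k l) T k l - \sum_k \sum_(l | edge v k l) F k l| <= W * K + s * W ^+ 2 * H.
  rewrite -sumrB (le_trans (ler_norm_sum _ _ _))// /K /H !mulr_sumr -big_split /=.
  apply: ler_sum => k _; rewrite -sumrB (le_trans (ler_norm_sum _ _ _))//.
  by rewrite !mulr_sumr -big_split /=; apply: ler_sum => l; exact: TF.
move: D; rewrite ler_norml => /andP[D1 D2].
by rewrite /sigma; case: ifP => _; rewrite ?mul1r ?mulN1r; lra.
Qed.

End Window.

Lemma continuous_wave s k : continuous (fun phi => cos phi * wave s k phi).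
Proof.
move=> x; apply: cvgM; first exact: continuous_cos.
apply: (continuous_comp (f := sin) (g := fun y => cos (s * tau k * y + s * elev k))).
  exact: continuous_sin.
exact: continuous_cos_affine.
Qed.

Lemma integ_wave_star s W : 0 <= W -> integ 0 W (fun phi => cos phi * wave s star phi) = sin W.
Proof.
move=> W0; rewrite (eq_int (g := fun x => cos (1 * x + 0))); last first.
  by move=> x _; rewrite /wave /tau /elev !subrr !mulr0 mul0r addr0 cos0 mulr1 mul1r addr0.
have dF x : is_derive x 1 (fun x => sin (1 * x + 0)) (cos (1 * x + 0)).
  by have := is_derive_sin_affine 1 0 x; rewrite mul1r.
rewrite (int_ftc W0 _ dF); last exact: continuous_cos_affine.
by rewrite !addr0 !mul1r sin0 subr0.
Qed.

Lemma integ_wave_le s W k : 0 < s -> 0 <= W -> tau k != 0 ->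
  `|integ 0 W (fun phi => cos phi * wave s k phi)| <= 2 / s * `|tau k|^-1.
Proof.
move=> s0 W0 t0; have st0 : s * tau k != 0 by rewrite mulf_neq0// gt_eqF.
pose F x : R := (s * tau k)^-1 * sin (s * tau k * sin x + s * elev k).
have dF x : is_derive x 1 F (cos x * wave s k x).
  have D1 := @is_derive1_comp R (fun y => sin (s * tau k * y + s * elev k)) sin x _ _
    (is_derive_sin_affine (s * tau k) (s * elev k) (sin x)) (is_derive_sin x).
  apply: (is_derive_eq (is_derive_scale (s * tau k)^-1 D1)).
  by rewrite /wave; field; rewrite t0 gt_eqF.
rewrite (int_ftc W0 (@continuous_wave s k) dF) /F -mulrBr normrM normfV normrM (gtr0_norm s0).
rewrite (_ : 2 / s / `|tau k| = (s * `|tau k|)^-1 * 2); last by rewrite invfM; ring.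
rewrite ler_wpM2l ?invr_ge0 ?mulr_ge0 ?(ltW s0)//.
by rewrite (le_trans (ler_normB _ _))// -[2]/(1 + 1) lerD// sin_max.
Qed.

(** The wave at [star] is constantly 1 and contributes [sin W], with the right sign thanks to
    [sigma]. All other waves on flat edges have nonzero [tau] and integrate to O(1 / s). *)
Lemma integ_waves_ge s W : 0 < s -> 0 <= W ->
  sin W - 2 / s * G <= integ 0 W (fun phi => sigma * \sum_k \sum_(l | edge v k l)
    (flat k l)%:R * (cos phi * wave s k phi - cos phi * wave s l phi)).
Proof.
move=> s0 W0.
pose val k := integ 0 W (fun phi => cos phi * wave s k phi).
have pw k : pcf (fun phi => cos phi * wave s k phi) by exact/pcf_continuous/continuous_wave.
have pwB k l : pcf (fun phi => (flat k l)%:R * (cos phi * wave s k phi - cos phi * wave s l phi)).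
  by apply: pcfZ; exact: pcfB.
rewrite intZ; last by apply: pcf_sum => k _; apply: pcf_sum.
rewrite int_sum; last by move=> k _; apply: pcf_sum.
have -> : \sum_k integ 0 W (fun phi => \sum_(l | edge v k l)
    (flat k l)%:R * (cos phi * wave s k phi - cos phi * wave s l phi)) =
  \sum_k \sum_(l | edge v k l) (flat k l)%:R * (val k - val l).
  apply: eq_bigr => k _; rewrite int_sum//; apply: eq_bigr => l _.
  by rewrite intZ ?intB//; exact: pcfB.
have tv k : tau k != 0 -> `|val k| <= 2 / s * `|tau k|^-1 by exact: integ_wave_le.
have s1 : `|sigma| = 1 by rewrite /sigma; case: ifP; rewrite ?normrN normr1.
have other k l : edge v k l -> (k, l) != (i0, j0) ->
    - (2 / s * (`|tau k|^-1 + `|tau l|^-1)) <= sigma * ((flat k l)%:R * (val k - val l)).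
  move=> e ne; have [f|f] := boolP (flat k l); last first.
    by rewrite mul0r mulr0 oppr_le0 mulr_ge0 ?divr_ge0 ?(ltW s0)// addr_ge0.
  have [tk tl] := good e f ne.
  rewrite mul1r lerNl -[leRHS]mul1r (le_trans (ler_norm _))// normrN normrM s1 !mul1r.
  by rewrite (le_trans (ler_normB _ _))// mulrDr lerD ?tv.
have main : sin W - 2 / s * (`|tau i0|^-1 + `|tau j0|^-1) <=
    sigma * ((flat i0 j0)%:R * (val i0 - val j0)).
  rewrite flat0 mul1r /sigma; have r0 := flat_run_neq0 e0 flat0.
  have vs : val star = sin W by exact: integ_wave_star.
  (* With [0^-1 = 0], [star] itself contributes nothing to the error term of this edge. *)
  have ts : tau star = 0 by rewrite /tau subrr.
  case: starP => st.
    rewrite -st eqxx mul1r vs ts normr0 invr0 add0r lerD2l lerN2.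
    have tj : tau j0 != 0 by rewrite /tau st.
    exact: le_trans (ler_norm _) (tv _ tj).
  have ij : (star == i0) = false by case/edgeP: e0 => ij _; rewrite st eq_sym (negbTE ij).
  rewrite ij -st mulN1r opprB vs ts normr0 invr0 addr0 lerD2l lerN2.
  have ti : tau i0 != 0 by rewrite /tau st -oppr_eq0 opprB.
  exact: le_trans (ler_norm _) (tv _ ti).
have -> : G = (`|tau i0|^-1 + `|tau j0|^-1) +
    \sum_(l | edge v i0 l && (l != j0)) (`|tau i0|^-1 + `|tau l|^-1) +
    \sum_(k | k != i0) \sum_(l | edge v k l) (`|tau k|^-1 + `|tau l|^-1).
  by rewrite /G (bigD1 i0)//= (bigD1 j0)//=.
have -> : sigma * \sum_k \sum_(l | edge v k l) (flat k l)%:R * (val k - val l) =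
    sigma * ((flat i0 j0)%:R * (val i0 - val j0)) +
    sigma * \sum_(l | edge v i0 l && (l != j0)) (flat i0 l)%:R * (val i0 - val l) +
    \sum_(k | k != i0) sigma * \sum_(l | edge v k l) (flat k l)%:R * (val k - val l).
  rewrite [LHS]mulr_sumr [LHS](bigD1 i0)//= -mulrDr; congr (_ * _ + _).
  by rewrite [LHS](bigD1 j0).
have t1 : - (2 / s * \sum_(l | edge v i0 l && (l != j0)) (`|tau i0|^-1 + `|tau l|^-1)) <=
    sigma * \sum_(l | edge v i0 l && (l != j0)) (flat i0 l)%:R * (val i0 - val l).
  rewrite !mulr_sumr -sumrN; apply: ler_sum => l /andP[e lj]; apply: other => //.
  by apply: contra lj => /eqP[->].
have t2 : - (2 / s * \sum_(k | k != i0) \sum_(l | edge v k l) (`|tau k|^-1 + `|tau l|^-1)) <=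
    \sum_(k | k != i0) sigma * \sum_(l | edge v k l) (flat k l)%:R * (val k - val l).
  rewrite !mulr_sumr -sumrN; apply: ler_sum => k ki; rewrite !mulr_sumr -sumrN.
  apply: ler_sum => l e; apply: other => //.
  by apply: contra ki => /eqP[->].
rewrite [2 / s * (_ + _ + _)]mulrDr [2 / s * (_ + _ + \sum_(l | _) _)]mulrDr; move: main t1 t2; set X1 := \sum_(l | _) _; set X2 := \sum_(k | _) _.
set X3 := \sum_(l | _) _; set X4 := \sum_(k | _) _; lra.
Qed.

End LowerBound.

Section Regular.
Variables (R : realType) (n : nat) (v u : 'I_n -> R * R) (i0 j0 star : 'I_n) (th0 : R).
Notation mu := (@lebesgue_measure R).

Lemma sin_ge_half (x : R) : 0 <= x -> x <= 4^-1 -> x / 2 <= sin x.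
Proof.
move=> x0 x4; have dF (y : R) : is_derive y 1 (fun x => sin (1 * x + 0)) (cos (1 * y + 0)).
  by have := is_derive_sin_affine 1 0 y; rewrite mul1r.
have -> : sin x = integ 0 x (fun y => cos (1 * y + 0)).
  rewrite (int_ftc x0 _ dF); last exact: continuous_cos_affine.
  by rewrite !addr0 !mul1r sin0 subr0.
have -> : x / 2 = integ 0 x (fun=> 2^-1) by rewrite int_cst// subr0 mulrC.
apply: int_le; [exact: pcf_cst|exact: pcf_cos|move=> y /andP[y0 yx]].
rewrite mul1r addr0; have [->|yn] := eqVneq y 0; first by rewrite cos0; lra.
have yp : 0 < y by rewrite lt_neqAle eq_sym yn.
by have := cos_ge_small yp (le_trans yx x4); lra.
Qed.

Hypotheses (cv : convex_position v) (n1 : (1 < n)%N).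
Hypothesis th0_pi : 0 <= th0 <= pi.
Hypothesis uE : forall k, u k = Defs.rot th0 (v k).
Hypotheses (e0 : edge v i0 j0) (flat0 : flat u i0 j0).
Hypothesis starP : star = i0 \/ star = j0.
Hypothesis good : forall k l, edge v k l -> flat u k l -> (k, l) != (i0, j0) ->
  tau u star k != 0 /\ tau u star l != 0.

Lemma L2_regular_of_edge : L2_regular (hull v).
Proof.
have pos_part_le (x y : R) : x <= y -> 0 <= y -> (x + `|x|) / 2 <= y.
  by case: (ger0P x); lra.
pose K : R := \sum_k \sum_(l | edge v k l) 4 * (`|run u k l| + `|rise u k l|) / `|rise u k l|.
pose H : R := \sum_k \sum_(l | edge v k l) (`|elev u star k| + `|elev u star l|).
pose G : R := \sum_k \sum_(l | edge v k l) (`|tau u star k|^-1 + `|tau u star l|^-1).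
pose S : R := \sum_k \sum_(l | edge v k l) `|run u k l| / `|rise u k l|.
have K0 : 0 <= K by apply: sum_edges_ge0 => k l; rewrite divr_ge0// mulr_ge0// addr_ge0.
have H0 : 0 <= H by apply: sum_edges_ge0 => k l; rewrite addr_ge0.
have G0 : 0 <= G by apply: sum_edges_ge0 => k l; rewrite addr_ge0// invr_ge0.
have S0 : 0 <= S by apply: sum_edges_ge0 => k l; rewrite divr_ge0.
(* With this [Z] the oscillating waves, at most [2 / s * G], cost no more than [W / 4]. *)
pose Z := 8 * G + 1; have Z0 : 0 < Z by rewrite /Z; lra.
(* Once [s >= M0], the first summand gives [C1 * W <= W / 8] and the second gives [W4] and [Wslope].
   Taking [m] from [M0] ensures this for every [rho >= 1]. *)
pose M0 := 8 * (K * Z + H * Z ^+ 2) + 4 * Z * (1 + S) + 1.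
have M01 : 1 <= M0.
  by rewrite /M0 lerDr addr_ge0// !(mulr_ge0, addr_ge0)// ?sqr_ge0// ltW.
have pi1 : 1 <= 2 * pi :> R by have := pi_ge2 R; lra.
pose m := Num.Def.archi_bound M0.
have mM0 : M0 <= m%:R by rewrite ltW// archi_boundP// (le_trans ler01).
have m0 : (0 < m)%N by rewrite -(ltr_nat R) (lt_le_trans ltr01)// (le_trans M01).
have pm : M0 <= 2 * pi * m%:R by rewrite (le_trans mM0)// ler_peMl.
pose q : R := 2 * pi * m%:R; have q0 : 0 < q by rewrite (lt_le_trans ltr01)// (le_trans M01).
pose c0 : R := (2 * pi)^-1 * (q ^+ 4)^-1 * (q / (64 * Z)).
have c0p : 0 < c0 by rewrite !mulr_gt0 ?invr_gt0 ?exprn_gt0 ?mulr_gt0 ?pi_gt0.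
exists (c0 `^ 2^-1); split; first by rewrite powR_gt0.
move=> rho rho1; have rho0 : 0 < rho by rewrite (lt_le_trans ltr01).
pose s := 2 * pi * m%:R * rho.
have sM : M0 <= s by rewrite (le_trans pm)// /s ler_peMr// ltW.
have s0 : 0 < s by rewrite (lt_le_trans ltr01)// (le_trans M01).
pose W := Z / s; have W0 : 0 < W by rewrite divr_gt0.
have WS : W * (4 * (1 + S)) <= 1.
  rewrite /W mulrAC ler_pdivrMr// mul1r (le_trans _ sM)// /M0.
  have : 0 <= 8 * (K * Z + H * Z ^+ 2) by rewrite !(mulr_ge0, addr_ge0)// ?sqr_ge0// ltW.
  by move: (8 * (K * Z + _)) => z z0; lra.
have W4 : W <= 4^-1.
  have : 0 <= W * S by rewrite mulr_ge0// ltW.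
  by move: WS; lra.
have Wslope k l : edge v k l -> ~~ flat u k l -> W * `|run u k l| <= `|rise u k l| / 4.
  move=> e f; have r0 : 0 < `|rise u k l| by rewrite normr_gt0 /rise subr_eq0 eq_sym.
  have : `|run u k l| / `|rise u k l| <= S.
    rewrite /S (bigD1 k)//= (bigD1 l)//= -addrA lerDl addr_ge0//.
      by apply: sumr_ge0 => i _; rewrite divr_ge0.
    by apply: sumr_ge0 => i _; apply: sumr_ge0 => j _; rewrite divr_ge0.
  rewrite ler_pdivrMr// => h; rewrite (le_trans (ler_wpM2l (ltW W0) h))//.
  rewrite mulrA mulrC ler_wpM2l ?(ltW r0)//; lra.
pose sigma : R := if star == i0 then 1 else -1.
pose Q (phi : R) : R := sigma * \sum_k \sum_(l | edge v k l) (flat u k l)%:R *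
  (cos phi * wave u star s k phi - cos phi * wave u star s l phi).
have pQ : pcf Q.
  apply: pcfZ; apply: pcf_sum => k _; apply: pcf_sum => l _; apply: pcfZ.
  by apply: pcfB; apply/pcf_continuous; exact: continuous_wave.
pose C1 := W * K + s * W ^+ 2 * H.
(* Cauchy-Schwarz in linearized form: [y ^+ 2 >= 2 * La * (y * sin phi) - La ^+ 2 * sin phi ^+ 2]
   for any [La]. This [La] maximizes [2 * La * (W / 8) - La ^+ 2 * W ^+ 3], with maximum 1 / (64 W)
   = s / (64 Z). *)
pose La := (8 * W ^+ 2)^-1.
pose g phi := 2 * La * (Q phi - C1) - La ^+ 2 * W ^+ 2.
have pg : pcf g.
  by apply: pcfB; [apply: pcfZ; apply: pcfB => //|]; exact: pcf_cst.
have La0 : 0 < La by rewrite invr_gt0 mulr_gt0// exprn_gt0.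
(* The main term retains W/2 - W/4 - W/8 = W/8. *)
have intg : s / (64 * Z) <= integ 0 W g.
  rewrite /g intB; [|by apply: pcfZ; apply: pcfB => //; exact: pcf_cst|exact: pcf_cst].
  rewrite intZ; last by apply: pcfB => //; exact: pcf_cst.
  rewrite intB//; last exact: pcf_cst.
  rewrite !int_cst ?(ltW W0)// subr0.
  have := integ_waves_ge uE cv e0 flat0 starP good s0 (ltW W0).
  rewrite -/sigma -/Q -/G => hQ.
  have hs := sin_ge_half (ltW W0) W4.
  have hG : 2 / s * G <= W / 4.
    rewrite /W (_ : Z / s / 4 = 2 / s * (Z / 8)); last by field; rewrite gt_eqF.
    by rewrite ler_wpM2l ?divr_ge0 ?(ltW s0)// /Z; lra.
  have hC : C1 * W <= W / 8.
    rewrite /C1 mulrC ler_wpM2l ?(ltW W0)//.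
    rewrite (_ : W * K + s * W ^+ 2 * H = (K * Z + H * Z ^+ 2) / s); last first.
      by rewrite /W; field; rewrite gt_eqF.
    rewrite ler_pdivrMr//; move: sM; rewrite /M0.
    have : 0 <= 4 * Z * (1 + S) by rewrite !(mulr_ge0, addr_ge0)// ltW.
    by move: (4 * Z * _) (K * Z + _) => a b; lra.
  have -> : s / (64 * Z) = 2 * La * (W / 8) - La ^+ 2 * W ^+ 2 * W.
    rewrite /La (_ : s = Z / W); last by rewrite /W; field; rewrite !gt_eqF.
    have alg (x y : R) : x != 0 -> y != 0 -> y / x / (64 * y) =
        2 * (8 * x ^+ 2)^-1 * (x / 8) - (8 * x ^+ 2)^-1 ^+ 2 * x ^+ 2 * x.
      by move=> x0 y0; field; rewrite ?x0 ?y0.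
    by apply: alg; rewrite gt_eqF.
  rewrite lerD2r ler_wpM2l ?mulr_ge0 ?(ltW La0)//; lra.
have [B HB] := placed_bound v rho.
have key : ((c0 * rho)%:E <= L2sq_discrepancy (hull v) rho)%E.
  rewrite (L2sq_discrepancyE cv n1 rho0 HB).
  (* The positive part, because the minorant in [ge_integral_off_seq] must be nonnegative; the
     factor undoes the square of [q ^+ 2] in [ftrans_lower]. *)
  pose gp (th : R) := (q ^+ 4)^-1 * ((g (th + - th0) + `|g (th + - th0)|) / 2).
  have pgs : pcf (fun th => g (th + - th0)) by exact: pcf_shift.
  have pgp : pcf gp.
    apply: pcfZ; rewrite (_ : (fun th => _) = fun th => 2^-1 * (g (th + - th0) + `|g (th + - th0)|)).
      by apply: pcfZ; apply: pcfD => //; exact: pcf_norm.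
    by apply/funext => th; rewrite mulrC.
  have gp0 th : 0 <= gp th.
    rewrite /gp mulr_ge0 ?invr_ge0 ?exprn_ge0 ?(ltW q0)// divr_ge0//.
    by have := ler_norm (- g (th + - th0)); rewrite normrN; lra.
  apply: (@le_trans _ _ (((2 * pi)^-1)%:E * (integ th0 (th0 + W) gp)%:E)%E).
    rewrite -EFinM lee_fin /c0 -!mulrA ler_wpM2l ?invr_ge0 ?mulr_ge0 ?pi_ge0//.
    apply: (@le_trans _ _ ((q ^+ 4)^-1 * integ th0 (th0 + W) (fun th => g (th + - th0)))).
      rewrite (int_shift th0 (th0 + W) (- th0) pg) subrr addrAC subrr add0r.
      rewrite ler_wpM2l ?invr_ge0 ?exprn_ge0 ?(ltW q0)// (le_trans _ intg)//.
      by rewrite le_eqVlt; apply/orP; left; apply/eqP; rewrite /s; ring.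
    rewrite -intZ//; apply: int_le => //; first exact: pcfZ.
    move=> th _; rewrite /gp ler_wpM2l ?invr_ge0 ?exprn_ge0 ?(ltW q0)//.
    by have := ler_norm (g (th + - th0)); lra.
  rewrite lee_wpmul2l ?lee_fin ?invr_ge0 ?mulr_ge0 ?pi_ge0//.
  rewrite -EFin_int//.
  apply: (@ge_integral_off_seq R _ _ [:: th0]) => //.
  - by apply/measurable_EFinP/measurable_funTS; case: pgp.
  - move=> th _; apply: integral_ge0 => t1 _; apply: integral_ge0 => t2 _.
    by rewrite lee_fin sqr_ge0.
  - by move=> th _; rewrite lee_fin.
  move=> th /=; rewrite in_itv /= inE => /andP[th1 th2] thn.
  have /andP[p0 p1] := th0_pi.
  split.
    (* [th0 <= pi] and [W <= 4^-1] keep the window inside [[0, 2 pi)]. *)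
    by rewrite (le_trans p0 th1) /= (le_lt_trans th2)//; have := pi_ge2 R; lra.
  pose phi := th + - th0.
  have phi0 : 0 < phi by rewrite subr_gt0 lt_neqAle eq_sym thn.
  have phiW : phi <= W by rewrite lerBlDl.
  pose w k := place rho th (v k).
  have cw : convex_position w by exact: convex_position_place.
  pose d : R := - (2 * pi * m%:R * (w star).2).
  have := L2_count_ge cw n1 (HB th) (poly_area w) d m0; apply: le_trans.
  rewrite lee_fin.
  have wE k : w k = place rho (th0 + phi) (v k) by rewrite /w /phi addrC subrK.
  have := ftrans_lower i0 uE cv n1 m0 rho0 phi0 phiW W4 Wslope (erefl s) wE (erefl d).
  rewrite -/sigma -/(Q phi) -/K -/H -/C1 -/q.
  set F := ftrans w 0 m%:R d => hF.
  rewrite /gp -/phi ler_pdivrMl ?exprn_gt0//.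
  have X0 : 0 <= q ^+ 4 * F ^+ 2 by apply: mulr_ge0; [exact/exprn_ge0/ltW|exact: sqr_ge0].
  have sg2 : sigma ^+ 2 = 1 by rewrite /sigma; case: ifP => _; rewrite ?expr1n// sqrrN expr1n.
  have gX : g phi <= q ^+ 4 * F ^+ 2.
    set y := - (sigma * q ^+ 2 * F).
    have -> : q ^+ 4 * F ^+ 2 = y ^+ 2.
      rewrite -[q ^+ 4]mul1r -sg2 /y; clearbody q sigma; ring.
    have hF' : Q phi - C1 <= y * sin phi by rewrite /y mulNr.
    have sp0 := sin_gt0_small phi0 (le_trans phiW W4).
    have spW : sin phi <= W.
      apply: le_trans phiW; apply: le_trans (ler_norm _) _.
      by rewrite (le_trans (ler_sin_self _))// gtr0_norm.
    have h1 : 2 * La * (Q phi - C1) <= 2 * La * (y * sin phi).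
      by rewrite ler_wpM2l// mulr_ge0// ltW.
    have h2 : La ^+ 2 * sin phi ^+ 2 <= La ^+ 2 * W ^+ 2.
      by rewrite ler_wpM2l ?sqr_ge0// ler_sqr ?nnegrE ?(ltW sp0) ?(ltW W0).
    have h3 : 0 <= (y - La * sin phi) ^+ 2 by rewrite sqr_ge0.
    rewrite /g; move: h1 h2 h3; rewrite sqrrB exprMn; lra.
  exact: pos_part_le.
rewrite /L2norm_discrepancy.
rewrite -powRM ?(ltW c0p) ?(ltW rho0)// -poweR_EFin.
apply: gt0_ler_poweR => //.
- by rewrite in_itv /= leey lee_fin mulr_ge0 ?ltW.
- rewrite in_itv /= leey andbT; apply: le_trans key.
  by rewrite lee_fin mulr_ge0 ?ltW.
Qed.

End Regular.

(** * Polygons all of whose edges are paired *)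

Section Rectangles.
Variables (R : realType) (n : nat) (v : 'I_n -> R * R).
Implicit Types i j k l p : 'I_n.
Hypotheses (cv : convex_position v) (n2 : (2 < n)%N).

Let n1 : (1 < n)%N := ltnW n2.

Definition dot (p q : R * R) : R := p.1 * q.1 + p.2 * q.2.
Definition side i j : R * R := vsub (v j) (v i).

Lemma orient_side i j k : orient (v i) (v j) (v k) = cross (side i j) (vsub (v k) (v j)).
Proof. by rewrite /orient /cross /side /vsub /=; ring. Qed.

Lemma dot_side_ge0 i j : 0 <= dot (side i j) (side i j).
Proof. by rewrite /dot addr_ge0// -expr2 sqr_ge0. Qed.

Lemma dot_side_gt0 i j : injective v -> i != j -> 0 < dot (side i j) (side i j).
Proof.
move=> vi ij; rewrite lt_neqAle dot_side_ge0 andbT eq_sym /dot -!expr2 paddr_eq0 ?sqr_ge0//.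
rewrite !sqrf_eq0 /side /vsub /= !subr_eq0; apply: contra ij => /andP[/eqP e1 /eqP e2].
by apply/eqP/vi; rewrite (surjective_pairing (v i)) -e1 -e2 -surjective_pairing.
Qed.

Lemma dot_edge_gt0 i j : edge v i j -> 0 < dot (side i j) (side i j).
Proof. by have [vi _ _] := cv => /edgeP[ij _]; exact: dot_side_gt0. Qed.

Lemma edge_asym i j : edge v i j -> edge v j i -> False.
Proof.
move=> /edgeP[ij H1] /edgeP[_ H2].
have [k ki kj] : exists2 k, k != i & k != j.
  have : (0 < #|~: [set i; j]|)%N.
    by have := cardsC [set i; j]; rewrite card_ord cards2 ij; lia.
  by move=> /card_gt0P[k]; rewrite !inE negb_or => /andP[]; exists k.
have h1 := H1 _ ki kj; have := H2 _ kj ki.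
by rewrite orientC oppr_gt0 => /(lt_trans h1); rewrite ltxx.
Qed.

Lemma turn_gt0 i j k : edge v i j -> edge v j k -> 0 < cross (side i j) (side j k).
Proof.
move=> e1 e2; rewrite -orient_side; case/edgeP: (e1) => ij H.
apply: H; last by case/edgeP: e2; rewrite eq_sym.
by apply: contraPneq e2 => ->; exact: edge_asym.
Qed.

Lemma edge_cross_ge0 i j p : edge v i j -> 0 <= cross (side i j) (vsub (v p) (v j)).
Proof. by move=> /(edge_ge0 p); rewrite orient_side. Qed.

Lemma edge_cross_start_ge0 i j p : edge v i j -> 0 <= cross (side i j) (vsub (v p) (v i)).
Proof. by move=> /(edge_ge0 p). Qed.

Lemma edge_cross_eq0 i j p : edge v i j -> cross (side i j) (vsub (v p) (v j)) = 0 ->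
  p = i \/ p = j.
Proof. by move=> e h; apply: (edge_eq0 e); rewrite orient_side. Qed.

(** Each of two equally directed edges lies to the left of the other, so their lines coincide, and a
    line carries only one edge in a given direction. *)
Lemma parallel_edges_eq i j k l : edge v i j -> edge v k l ->
  cross (side i j) (side k l) = 0 -> 0 < dot (side i j) (side k l) -> i = k /\ j = l.
Proof.
move=> e1 e2 c0 d0.
have D1 : 0 < dot (side i j) (side i j) by apply: dot_edge_gt0 e1.
have h1 := edge_cross_start_ge0 k e1; have h2 := edge_cross_start_ge0 i e2.
have key : dot (side i j) (side i j) * cross (side k l) (vsub (v i) (v k)) =
    - dot (side i j) (side k l) * cross (side i j) (vsub (v k) (v i)) -
    cross (side i j) (side k l) * dot (side i j) (vsub (v i) (v k)).
  by rewrite /dot /cross /side /vsub /=; ring.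
have z : cross (side i j) (vsub (v k) (v i)) = 0.
  apply/eqP; rewrite eq_le h1 andbT -(pmulr_rle0 _ d0).
  move: key; rewrite c0 mul0r subr0 mulNr => key.
  by rewrite -oppr_ge0 -key mulr_ge0// ltW.
have [ki|kj] := edge_eq0 e1 z.
  by rewrite ki in e2 *; split => //; exact: edge_next_uniq e1 e2.
rewrite kj in e2 c0 d0; have [li|lj] := edge_eq0 (k := l) e1 (etrans (orient_side _ _ _) c0).
  by rewrite li in e2; case: (edge_asym e1 e2).
by case/edgeP: e2; rewrite lj eqxx.
Qed.

(** If the direction of [a b] lay strictly between those of two consecutive edges, its normal form
    would be a positive combination of theirs. It would then be minimal at [j] only, forcing
    [a = b = j]. *)
Lemma edge_not_between i j k a b : edge v i j -> edge v j k -> edge v a b ->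
  0 < cross (side i j) (side a b) -> 0 < cross (side a b) (side j k) -> False.
Proof.
move=> e1 e2 e3 c1 c2; have t := turn_gt0 e1 e2.
have cramer p : cross (side i j) (side j k) * cross (side a b) (vsub (v p) (v j)) =
    cross (side a b) (side j k) * cross (side i j) (vsub (v p) (v j)) +
    cross (side i j) (side a b) * cross (side j k) (vsub (v p) (v j)).
  by rewrite /cross /side /vsub /=; ring.
have atj p : cross (side a b) (vsub (v p) (v j)) <= 0 -> p = j.
  move=> h; have h1 := edge_cross_ge0 p e1; have h2 := edge_cross_start_ge0 p e2.
  have : cross (side a b) (side j k) * cross (side i j) (vsub (v p) (v j)) +
      cross (side i j) (side a b) * cross (side j k) (vsub (v p) (v j)) == 0.
    by rewrite eq_le addr_ge0 ?mulr_ge0 ?(ltW c1) ?(ltW c2)// andbT -cramer pmulr_rle0.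
  rewrite paddr_eq0 ?mulr_ge0 ?(ltW c1) ?(ltW c2)// !mulf_eq0 (gt_eqF c1) (gt_eqF c2) /=.
  move=> /andP[/eqP z1 /eqP z2].
  have [pi_|//] := edge_cross_eq0 e1 z1; have [//|pk] := edge_eq0 e2 z2.
  by case: (edge_asym e1); rewrite -pi_ pk.
have h3 := edge_cross_start_ge0 j e3.
have aj : a = j.
  apply: atj; move: h3; rewrite /cross /side /vsub /=; lra.
have bj : b = j.
  apply: atj; move: h3; rewrite /cross /side /vsub /=; lra.
by case/edgeP: e3; rewrite aj bj eqxx.
Qed.

(** The polygon lies in the cone at [v j] spanned by the two neighbours; the two cross products are
    the coordinates in that cone. *)
Lemma local_max_global i j k (a b : R) : edge v i j -> edge v j k ->
  a * (v i).1 + b * (v i).2 <= a * (v j).1 + b * (v j).2 ->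
  a * (v k).1 + b * (v k).2 <= a * (v j).1 + b * (v j).2 ->
  forall p, a * (v p).1 + b * (v p).2 <= a * (v j).1 + b * (v j).2.
Proof.
move=> e1 e2 hi hk p; have t := turn_gt0 e1 e2.
have h1 := edge_cross_ge0 p e1; have h2 := edge_cross_start_ge0 p e2.
rewrite -subr_ge0 -(pmulr_rge0 _ t).
have -> : cross (side i j) (side j k) * (a * (v j).1 + b * (v j).2 - (a * (v p).1 + b * (v p).2)) =
    cross (side j k) (vsub (v p) (v j)) * (a * (v j).1 + b * (v j).2 - (a * (v i).1 + b * (v i).2)) +
    cross (side i j) (vsub (v p) (v j)) * (a * (v j).1 + b * (v j).2 - (a * (v k).1 + b * (v k).2)).
  by rewrite /cross /side /vsub /=; ring.
by rewrite addr_ge0// mulr_ge0// subr_ge0.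
Qed.

(* Every vertex other than a maximum of a linear form has a neighbour on which
   the form is larger; hence two edge-closed classes would share a maximal face. *)
Lemma edges_connected (T : eqType) (f : 'I_n -> T) :
  (forall i j, edge v i j -> f i = f j) -> forall i j, f i = f j.
Proof.
move=> fe i0 j0; apply/eqP/negPn/negP => ne.
pose ht k := 0 * (v k).1 + 1 * (v k).2.
have top (c : T) k0 : f k0 = c -> exists2 a, f a = c & forall p, ht p <= ht a.
  move=> fk0; have fk0' : [pred k | f k == c] k0 by rewrite /= fk0.
  case: (@arg_maxP _ _ _ k0 [pred k | f k == c] ht fk0') => a /= /eqP fa amax.
  exists a => //; have [i ia] := edge_prev_ex a cv n1; have [k ak] := edge_next_ex a cv n1.
  apply: (local_max_global ia ak); apply: amax; first by rewrite (fe _ _ ia) fa.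
  by rewrite -(fe _ _ ak) fa.
have [a fa amax] := top _ i0 erefl; have [b fb bmax] := top _ j0 erefl.
have ab : a != b by apply: contraNneq ne => ab; rewrite -fa -fb ab.
have hab : ht a = ht b by apply/eqP; rewrite eq_le amax bmax.
have below p : p != a -> p != b -> ht p < ht a.
  move=> pa pb; rewrite lt_neqAle amax andbT; apply/eqP => hp.
  have [_ vn _] := cv; have := vn a b p ab; rewrite eq_sym pb eq_sym pa => /(_ isT isT) /eqP; apply.
  move: hp hab; rewrite /ht !mul0r !add0r !mul1r => hp hab.
  by rewrite /orient /cross /vsub /= -hab hp; ring.
have mk x y : ht x = ht y -> (v y).1 < (v x).1 -> x != y ->
    (forall p, p != x -> p != y -> ht p < ht x) -> edge v x y.
  rewrite /ht !mul0r !add0r !mul1r => hxy lt xy bel; apply/edgeP; split => // p px py.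
  have := bel p px py; rewrite /orient /cross /vsub /= !mul0r !add0r !mul1r -hxy => hp.
  by rewrite subrr mul0r subr0 -mulrNN mulr_gt0// opprB subr_gt0.
have [lt|gt|/eqP eq] := ltgtP (v a).1 (v b).1.
- move/eqP: ne; apply; rewrite -fa -fb; apply/esym/fe/mk => //; first by rewrite eq_sym.
  by move=> p pb pa; rewrite -hab below.
- by move/eqP: ne; apply; rewrite -fa -fb; apply/fe/mk.
- have [vi _ _] := cv; move/eqP: ab; apply; apply: vi.
  rewrite (surjective_pairing (v a)) (surjective_pairing (v b)) (eqP eq); congr pair.
  by move: hab; rewrite /ht !mul0r !add0r !mul1r.
Qed.

Hypothesis shadow : forall i j s, edge v i j -> s = i \/ s = j ->
  exists k l, [/\ edge v k l, (k, l) != (i, j), cross (side i j) (side k l) = 0 &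
    dot (side i j) (vsub (v k) (v s)) = 0 \/ dot (side i j) (vsub (v l) (v s)) = 0].

Lemma lagrange (p q : R * R) : dot p q ^+ 2 + cross p q ^+ 2 = dot p p * dot q q.
Proof. by rewrite /dot /cross; ring. Qed.

Lemma antiparallel i j k l : edge v i j -> edge v k l -> (k, l) != (i, j) ->
  cross (side i j) (side k l) = 0 -> dot (side i j) (side k l) < 0.
Proof.
move=> e1 e2 ne c0.
have D1 : 0 < dot (side i j) (side i j) by apply: dot_edge_gt0 e1.
have D2 : 0 < dot (side k l) (side k l) by apply: dot_edge_gt0 e2.
have [//|d0|d0] := ltgtP (dot (side i j) (side k l)) 0.
  by have [ik jl] := parallel_edges_eq e1 e2 c0 d0; move: ne; rewrite ik jl eqxx.
have := lagrange (side i j) (side k l); rewrite d0 c0 !expr0n addr0 => /esym/eqP.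
by rewrite mulf_eq0 !gt_eqF.
Qed.

(** The vertices [i], [j], [k], [l] are, in this order, the corners of a rectangle, so [l] is
    diagonally opposite to [j]. *)
Definition opposite i j k l := [/\ edge v k l, (side k l).1 = - (side i j).1,
  (side k l).2 = - (side i j).2 & dot (side i j) (vsub (v l) (v i)) = 0].

(** The partners found from both ends of the edge are antiparallel to it, hence the same edge
    [k l]. *)
Lemma opposite_ex i j : edge v i j -> exists k l, opposite i j k l.
Proof.
move=> e; have D : 0 < dot (side i j) (side i j) by apply: dot_edge_gt0 e.
have [k [l [e1 ne1 c1 t1]]] := shadow e (or_introl erefl).
have [k' [l' [e2 ne2 c2 t2]]] := shadow e (or_intror erefl).
have a1 := antiparallel e e1 ne1 c1; have a2 := antiparallel e e2 ne2 c2.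
have [kk ll] : k = k' /\ l = l'.
  apply: parallel_edges_eq => //.
    apply: (mulfI (lt0r_neq0 D)).
    have -> : dot (side i j) (side i j) * cross (side k l) (side k' l') =
      dot (side i j) (side k l) * cross (side i j) (side k' l') -
      dot (side i j) (side k' l') * cross (side i j) (side k l).
      by rewrite /dot /cross; ring.
    by rewrite c1 c2 !mulr0 subrr.
  rewrite -(pmulr_rgt0 _ D).
  have -> : dot (side i j) (side i j) * dot (side k l) (side k' l') =
      dot (side i j) (side k l) * dot (side i j) (side k' l') +
      cross (side i j) (side k l) * cross (side i j) (side k' l').
    by rewrite /dot /cross; ring.
  by rewrite c1 mul0r addr0 nmulr_rgt0.
rewrite -kk -ll in t2.
have dkl : dot (side i j) (side k l) = dot (side i j) (vsub (v l) (v i)) - dot (side i j) (vsub (v k) (v i)).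
  by rewrite /dot /side /vsub /=; ring.
have dj p : dot (side i j) (vsub (v p) (v j)) = dot (side i j) (vsub (v p) (v i)) - dot (side i j) (side i j).
  by rewrite /dot /side /vsub /=; ring.
(* Since [k l] runs backwards, [l] must face [i] and [k] must face [j]; the other combinations
   contradict [a1] or the positive length of [i j]. *)
have [tl tk] : dot (side i j) (vsub (v l) (v i)) = 0 /\ dot (side i j) (vsub (v k) (v j)) = 0.
  by move: t1 t2; rewrite !dj => -[t1|t1] [t2|t2]; split; lra.
have dE : dot (side i j) (side k l) = - dot (side i j) (side i j) by move: (dj k); lra.
exists k, l; split => //.
- apply: (mulfI (lt0r_neq0 D)).
  have -> : dot (side i j) (side i j) * (side k l).1 =
    dot (side i j) (side k l) * (side i j).1 - cross (side i j) (side k l) * (side i j).2.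
    by rewrite /dot /cross; ring.
  by rewrite dE c1; ring.
- apply: (mulfI (lt0r_neq0 D)).
  have -> : dot (side i j) (side i j) * (side k l).2 =
    dot (side i j) (side k l) * (side i j).2 + cross (side i j) (side k l) * (side i j).1.
    by rewrite /dot /cross; ring.
  by rewrite dE c1; ring.
Qed.

(** Compare the edge after [k l] with the opposite of the edge after [i j]. If they differed in
    direction, [edge_not_between] would be violated at one of the two places. *)
Lemma opposite_adjacent i j j' k l l' m : edge v i j -> edge v j j' ->
  opposite i j k l -> opposite j j' l' m -> l = l'.
Proof.
move=> e1 e2 [e3 x3 y3 _] [e4 x4 y4 _].
have [x ex] := edge_next_ex l cv n1; have [y [z [e5 x5 y5 _]]] := opposite_ex ex.
have t1 := turn_gt0 e1 e2; have t2 := turn_gt0 e3 ex.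
have c1 : 0 < cross (side i j) (side y z).
  by move: t2; rewrite /cross x5 y5 x3 y3; lra.
have [c|c|c] := ltgtP (cross (side y z) (side j j')) 0.
- case: (@edge_not_between k l x l' m e3 ex e4).
    by move: t1; rewrite /cross x3 y3 x4 y4; lra.
  by move: c; rewrite /cross x4 y4 x5 y5; lra.
- by case: (edge_not_between e1 e2 e5).
have [] // := @parallel_edges_eq l x l' m ex e4.
  by move: c; rewrite /cross x4 y4 x5 y5; lra.
have D : 0 < dot (side j j') (side j j') by apply: dot_edge_gt0 e2.
have -> : dot (side l x) (side l' m) = dot (side y z) (side j j').
  by rewrite /dot x4 y4 x5 y5; ring.
rewrite -(pmulr_rgt0 _ t1).
have -> : cross (side i j) (side j j') * dot (side y z) (side j j') =
    cross (side i j) (side y z) * dot (side j j') (side j j') +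
    cross (side y z) (side j j') * dot (side i j) (side j j').
  by rewrite /dot /cross; ring.
by rewrite c mul0r addr0 mulr_gt0.
Qed.

(** By [opposite_adjacent] the rectangles of the two edges at a vertex name the same diagonal
    partner, so partners form a map on vertices. *)
Lemma antipode_ex : exists ant : 'I_n -> 'I_n, forall i j, edge v i j ->
  opposite i j (ant i) (ant j).
Proof.
have /fin_all_exists[ant Hant] : forall j, exists l, forall i, edge v i j ->
    exists k, opposite i j k l.
  move=> j; have [i ij] := edge_prev_ex j cv n1; have [k [l o]] := opposite_ex ij.
  by exists l => i' ij'; rewrite (edge_prev_uniq ij' ij); exists k.
exists ant => i j ij; have [k o] := Hant j i ij.
have [h hi] := edge_prev_ex i cv n1; have [k' o'] := Hant i h hi.
by rewrite (opposite_adjacent hi ij o' o).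
Qed.

Lemma inscribed_of_shadows : inscribed_centrally_symmetric (hull v).
Proof.
have [ant Hant] := antipode_ex.
(* Twice the centre and the squared length of the diagonal at [i]. Both agree at the ends of an
   edge, since the diagonals of a rectangle bisect each other and are equally long. *)
pose f i : R * R * R := ((v i).1 + (v (ant i)).1, (v i).2 + (v (ant i)).2,
   ((v i).1 - (v (ant i)).1) ^+ 2 + ((v i).2 - (v (ant i)).2) ^+ 2).
have fE : forall i j, f i = f j.
  apply: edges_connected => i j e; have [_ x1 y1 d0] := Hant i j e.
  move: x1 y1 d0; rewrite /f /side /dot /vsub /= => x1 y1 d0.
  have vl1 : (v (ant j)).1 = (v (ant i)).1 - (v j).1 + (v i).1 by lra.
  have vl2 : (v (ant j)).2 = (v (ant i)).2 - (v j).2 + (v i).2 by lra.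
  rewrite vl1 vl2 in d0 *; congr (_, _, _); [by ring|by ring|].
  (* The two squared diagonals differ by four times the scalar product that vanishes in [d0]. *)
  rewrite -[LHS]subr0 -[X in _ - X](mulr0 4) -{1}d0; ring.
pose o := Ordinal (ltnW n1).
pose c : R * R := (((v o).1 + (v (ant o)).1) / 2, ((v o).2 + (v (ant o)).2) / 2).
pose D := ((v o).1 - (v (ant o)).1) ^+ 2 + ((v o).2 - (v (ant o)).2) ^+ 2.
have cE i : 2 * c.1 = (v i).1 + (v (ant i)).1 /\ 2 * c.2 = (v i).2 + (v (ant i)).2.
  by case: (fE i o) => -> -> _; rewrite /c /=; split; field.
have DE i : ((v i).1 - (v (ant i)).1) ^+ 2 + ((v i).2 - (v (ant i)).2) ^+ 2 = D.
  by case: (fE i o).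
have dist i : ((v i).1 - c.1) ^+ 2 + ((v i).2 - c.2) ^+ 2 = D / 4.
  have [c1 c2] := cE i.
  have -> : c.1 = ((v i).1 + (v (ant i)).1) / 2 by rewrite -c1; field.
  have -> : c.2 = ((v i).2 + (v (ant i)).2) / 2 by rewrite -c2; field.
  by rewrite -(DE i); field.
have D0 : 0 < D.
  have [_ _] := cv; have [vi _ _] := cv; move=> _.
  rewrite lt_neqAle addr_ge0 ?sqr_ge0// andbT eq_sym; apply/eqP => D0.
  have [j oj] := edge_next_ex o cv n1.
  have at_c i : v i = c.
    have := dist i; rewrite D0 mul0r => /eqP; rewrite paddr_eq0 ?sqr_ge0// !sqrf_eq0 !subr_eq0.
    move=> /andP[/eqP e1 /eqP e2]; by rewrite (surjective_pairing (v i)) e1 e2 -surjective_pairing.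
  by case/edgeP: oj => /eqP + _; apply; apply: vi; rewrite !at_c.
exists c, (Num.sqrt (D / 4)); split; first by rewrite sqrtr_gt0 divr_gt0.
split.
  move=> x hx; have [k ->] := extreme_vertex hx.
  by rewrite dist sqr_sqrtr// divr_ge0// ltW.
move=> x [w [w0 [w1 ->]]] /=.
(* The reflected point carries the weights pushed forward along [ant]. *)
exists (fun m => \sum_(i | ant i == m) w i).
have S (g : 'I_n -> R) : \sum_m (\sum_(i | ant i == m) w i) * g m = \sum_i w i * g (ant i).
  rewrite [RHS](partition_big ant xpredT)//=; apply: eq_bigr => m _.
  by rewrite mulr_suml; apply: eq_bigr => i /eqP ->.
split; first by move=> m; apply: sumr_ge0.
split.
  rewrite -[RHS]w1 -(eq_bigr _ (fun i _ => mulr1 _)) (S (fun=> 1)).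
  by rewrite (eq_bigr _ (fun i _ => mulr1 _)).
rewrite (S (fun m => (v m).1)) (S (fun m => (v m).2)); congr pair.
  have -> : 2 * c.1 = \sum_i w i * (2 * c.1) by rewrite -mulr_suml w1 mul1r.
  by rewrite -sumrB; apply: eq_bigr => i _; have [-> _] := cE i; ring.
have -> : 2 * c.2 = \sum_i w i * (2 * c.2) by rewrite -mulr_suml w1 mul1r.
by rewrite -sumrB; apply: eq_bigr => i _; have [_ ->] := cE i; ring.
Qed.

End Rectangles.

(** * The dichotomy: regular, or inscribed and symmetric *)

Section RegularUnlessInscribed.
Variables (R : realType) (n : nat) (v : 'I_n -> R * R).
Hypotheses (cv : convex_position v) (n2 : (2 < n)%N).

(** Intermediate values: the expression takes opposite values at 0 and pi. *)
Lemma horizontal_angle (p : R * R) : exists2 th : R, 0 <= th <= pi &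
  sin th * p.1 + cos th * p.2 = 0.
Proof.
have pi0 := pi_ge0 R.
have [] := @IVT R (fun th => sin (1 * th + 0) * p.1 + cos (1 * th + 0) * p.2) 0 pi 0 pi0.
- apply: continuous_subspaceT => x; apply: cvgD.
    by apply: cvgM; [exact: continuous_sin_affine|exact: cvg_cst].
  by apply: cvgM; [exact: continuous_cos_affine|exact: cvg_cst].
- rewrite !mul1r !addr0 sin0 cos0 sinpi cospi !mul0r !add0r mul1r mulN1r.
  by rewrite ge_min le_max; case: (leP 0 p.2) => h; rewrite ?oppr_le0 ?oppr_ge0 ?h ?(ltW h) ?orbT.
- move=> th; rewrite in_itv /= mul1r addr0 => thpi e; exists th => //.
Qed.

Lemma L2_regular_or_inscribed :
  L2_regular (hull v) \/ inscribed_centrally_symmetric (hull v).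
Proof.
have [reg|irr] := pselect (L2_regular (hull v)); [by left|right].
apply: inscribed_of_shadows => // i j s e si; apply: contrapT => no.
apply: irr; have [th thpi flat_th] := horizontal_angle (side v i j).
pose u k := Defs.rot th (v k).
have C := cos2Dsin2 th.
have runE : run u i j != 0.
  have : flat u i j by rewrite /flat /u /= -subr_eq0 -oppr_eq0 -flat_th /side /vsub /=; apply/eqP; ring.
  by apply: (flat_run_neq0 (th0 := th)).
(* In the rotated frame, being parallel to [i j] means zero rise, and facing [s] orthogonally means
   zero [tau]; so a missing partner is exactly the hypothesis of [L2_regular_of_edge]. *)
have crossE k l : cross (side v i j) (side v k l) = run u i j * rise u k l.
  transitivity ((cos th ^+ 2 + sin th ^+ 2) * cross (side v i j) (side v k l)).
    by rewrite C mul1r.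
  transitivity (run u i j * rise u k l - (sin th * (side v i j).1 + cos th * (side v i j).2) * run u k l).
    by rewrite /run /rise /cross /u /side /vsub /Defs.rot /=; ring.
  by rewrite flat_th mul0r subr0.
have dotE k : dot (side v i j) (vsub (v k) (v s)) = run u i j * tau u s k.
  transitivity ((cos th ^+ 2 + sin th ^+ 2) * dot (side v i j) (vsub (v k) (v s))).
    by rewrite C mul1r.
  transitivity (run u i j * tau u s k + (sin th * (side v i j).1 + cos th * (side v i j).2) * elev u s k).
    by rewrite /run /tau /elev /dot /u /side /vsub /Defs.rot /=; ring.
  by rewrite flat_th mul0r addr0.
apply: (@L2_regular_of_edge R n v u i j s th) => //.
- exact: ltnW.
- by rewrite /flat -subr_eq0 -oppr_eq0 -flat_th /u /side /vsub /=; apply/eqP; ring.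
- move=> k l e' f ne; have rise0 : rise u k l = 0 by rewrite /rise (eqP f) subrr.
  split; apply/eqP => t0; apply: no; exists k, l; split => //; rewrite ?crossE ?rise0 ?mulr0//.
    by left; rewrite dotE t0 mulr0.
  by right; rewrite dotE t0 mulr0.
Qed.

End RegularUnlessInscribed.

(** * Upper bound for inscribed symmetric polygons *)

Section AngularIntegrals.
Variable R : realType.
Implicit Types (A B K z r x th : R).

Lemma continuous_trig A B : continuous (fun th : R => A * cos th + B * sin th).
Proof.
move=> x; apply: cvgD; apply: cvgM; try exact: cvg_cst.
  exact: continuous_cos.
exact: continuous_sin.
Qed.

Lemma pcf_bump (f g : R -> R) z r : 0 < z -> continuous f -> continuous g ->
  pcf (fun th => `|f th| / (z ^+ 2 + (r * g th) ^+ 2)).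
Proof.
move=> z0 cf cg; apply/pcf_continuous => x; apply: cvgM.
  by apply: cvg_norm; exact: cf.
apply: cvgV; first by rewrite gt_eqF// ltr_wpDr ?sqr_ge0// exprn_gt0.
apply: cvgD; first exact: cvg_cst.
under eq_fun do rewrite expr2.
by rewrite expr2; apply: cvgM; apply: cvgM; [exact: cvg_cst|exact: cg|exact: cvg_cst|exact: cg].
Qed.

(** The numerator is, up to sign, the derivative of the term squared in the denominator, so the
    integrand has an arctangent as antiderivative. *)
Lemma int_sin_bump K z r : 0 <= K -> 0 < z -> 0 < r ->
  integ 0 pi (fun x => `|K * sin x| / (z ^+ 2 + (r * (K * cos x)) ^+ 2)) <= pi / (z * r).
Proof.
move=> K0 z0 r0; have pi0 := pi_ge0 R.
have den x : z ^+ 2 + (r * (K * cos x)) ^+ 2 != 0.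
  by rewrite gt_eqF// ltr_wpDr ?sqr_ge0// exprn_gt0.
rewrite (eq_int (g := fun x => K * sin x / (z ^+ 2 + (r * (K * cos x)) ^+ 2))); last first.
  move=> x /andP[x0 xpi]; rewrite ger0_norm// mulr_ge0//.
  by apply: sin_ge0_pi; rewrite x0.
pose F x := (- (z * r)^-1) * atan ((r * K / z) * cos x + 0).
have dF x : is_derive x 1 F (K * sin x / (z ^+ 2 + (r * (K * cos x)) ^+ 2)).
  have D0 : is_derive x 1 (fun y : R => (r * K / z) * cos y) (r * K / z * - sin x).
    by apply: is_derive_scale; exact: is_derive_cos.
  have D1 := @is_derive1_comp R (fun y => atan y) (fun y => (r * K / z) * cos y) x _ _
    (is_derive1_atan _) D0.
  have -> : F = fun y => (- (z * r)^-1) * (atan \o (fun y => (r * K / z) * cos y)) y.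
    by apply/funext => y; rewrite /F /= addr0.
  apply: (is_derive_eq (is_derive_scale (- (z * r)^-1) D1)).
  move: (den x); move: (cos x) (sin x) => c s d.
  have d' : 1 + (r * K / z * c) ^+ 2 != 0.
    by rewrite gt_eqF// ltr_wpDr ?sqr_ge0.
  field; rewrite ?gt_eqF//= ?andbT.
  by rewrite ltr_wpDr ?sqr_ge0// exprn_gt0.
have cf : continuous (fun x => K * sin x / (z ^+ 2 + (r * (K * cos x)) ^+ 2)).
  move=> x; apply: cvgM.
    by apply: cvgM; [exact: cvg_cst|exact: continuous_sin].
  apply: cvgV => //.
  apply: cvgD; first exact: cvg_cst.
  under eq_fun do rewrite expr2.
  by rewrite expr2; apply: cvgM; apply: cvgM; try exact: cvg_cst;
    (apply: cvgM; [exact: cvg_cst|exact: continuous_cos]).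
rewrite (int_ftc pi0 cf dF) /F cos0 cospi !addr0 mulrN1 mulr1.
have := atan_ltpi2 (r * K / z); have := atan_gtNpi2 (- (r * K / z)).
have : 0 < (z * r)^-1 by rewrite invr_gt0 mulr_gt0.
move: (atan _) (atan _) ((z * r)^-1) (pi : R) => a b c p c0 ha hb; nra.
Qed.

(** Translating by [t] reduces to [int_sin_bump]. The translated interval lies in [[- pi, 2 pi]],
    three periods of length pi, whence the factor 3. *)
Lemma int_wave_bump A B z r : 0 < z -> 0 < r ->
  integ 0 (2 * pi) (fun th => `|B * cos th - A * sin th| /
     (z ^+ 2 + (r * (A * cos th + B * sin th)) ^+ 2)) <= 3 * pi / (z * r).
Proof.
move=> z0 r0; have pi0 := pi_ge0 R.
have [t /andP[t0 tpi] ft] := horizontal_angle (- A, B).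
rewrite /= in ft.
have [i1 i2 i3] : [/\ - pi <= - t, - t <= 2 * pi & - t <= 2 * pi - t] by split; lra.
have [i4 i5 i6] : [/\ 2 * pi - t <= 2 * pi, - pi <= 0 :> R & 0 <= 2 * pi :> R] by split; lra.
have i7 : pi <= 2 * pi :> R by lra.
pose K := A * cos t + B * sin t; pose h x := `|K * sin x| / (z ^+ 2 + (r * (K * cos x)) ^+ 2).
have ph : pcf h.
  apply: pcf_bump => // x; first by apply: cvgM; [exact: cvg_cst|exact: continuous_sin].
  by apply: cvgM; [exact: cvg_cst|exact: continuous_cos].
have hE th : `|B * cos th - A * sin th| / (z ^+ 2 + (r * (A * cos th + B * sin th)) ^+ 2) = h (th + - t).
  rewrite /h; set x := th + - t; have -> : th = t + x by rewrite /x addrC subrK.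
  clearbody x; rewrite cosD sinD.
  have -> : B * (cos t * cos x - sin t * sin x) - A * (sin t * cos x + cos t * sin x) =
     (sin t * - A + cos t * B) * cos x - K * sin x by rewrite /K; ring.
  have -> : A * (cos t * cos x - sin t * sin x) + B * (sin t * cos x + cos t * sin x) =
     (sin t * - A + cos t * B) * sin x + K * cos x by rewrite /K; ring.
  by rewrite ft !mul0r !add0r normrN.
rewrite (eq_int (fun th _ => hE th)) (int_shift _ _ _ ph) add0r.
have hper x : h (x + pi) = h x by rewrite /h sinDpi cosDpi !mulrN !sqrrN normrN.
have base : integ 0 pi h <= pi / (z * r).
  have := int_sin_bump (normr_ge0 K) z0 r0; apply: le_trans.
  rewrite le_eqVlt; apply/orP; left; apply/eqP/eq_int => x _.
  by rewrite /h !normrM normr_id !exprMn real_normK ?num_real.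
have next a b : integ (a + pi) (b + pi) h = integ a b h.
  by rewrite -(int_shift _ _ _ ph); apply: eq_int => x _; exact: hper.
have e1 : integ (- pi) 0 h = integ 0 pi h by rewrite -(next (- pi)) addNr add0r.
have e2 : integ pi (2 * pi) h = integ 0 pi h by rewrite -(next 0) add0r -mulr2n mulr_natl.
have h0 a b : 0 <= integ a b h.
  by apply: int_ge0 => x _; rewrite /h divr_ge0// addr_ge0 ?sqr_ge0.
have c1 := int_chasles ph i1 i2.
have c2 := int_chasles ph i3 i4.
have c3 := int_chasles ph i5 i6.
have c4 := int_chasles ph pi0 i7.
have -> : 3 * pi / (z * r) = pi / (z * r) + pi / (z * r) + pi / (z * r) by ring.
move: (pi / (z * r)) base (h0 (- pi) (- t)) (h0 (2 * pi - t) (2 * pi)) c1 c2 c3 c4 e1 e2; clear; move=> P; lra.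
Qed.

End AngularIntegrals.

(** * Dirichlet's theorem on simultaneous approximation *)

Section SimultaneousApproximation.
Variable R : realType.

Lemma simultaneous_sin (I : finType) (al : I -> R) (rho0 eps : R) : 0 < rho0 -> 0 < eps ->
  exists2 rho, rho0 <= rho & forall i, `|sin (pi * (rho * al i))| <= eps.
Proof.
move=> r0 e0.
pose Q := (Num.Def.archi_bound (pi / eps)).
have QE : pi / eps <= Q.+1%:R.
  have : pi / eps < Q%:R by apply: archi_boundP; rewrite divr_ge0 ?pi_ge0 ?(ltW e0).
  by move=> /ltW/le_trans; apply; rewrite ler_nat.
pose fr (x : R) := x - (Num.floor x)%:~R.
have fr0 x : 0 <= fr x by rewrite subr_ge0 ge_floor.
have fr1 x : fr x < 1 by rewrite ltrBlDl; have := lt_succ_floor x; rewrite intrD.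
pose box x : 'I_Q.+1 := inord (Num.trunc (Q.+1%:R * fr x)).
have boxE x : (box x)%:R <= Q.+1%:R * fr x < (box x)%:R + 1.
  have y0 : 0 <= Q.+1%:R * fr x by rewrite mulr_ge0.
  have lt : (Num.trunc (Q.+1%:R * fr x))%:R < Q.+1%:R :> R.
    by apply: (@le_lt_trans _ _ (Q.+1%:R * fr x)); [have /andP[] := truncn_itv y0|rewrite gtr_pMr].
  by rewrite ltr_nat in lt; rewrite /box inordK// natr1; exact: truncn_itv.
(* Pigeonhole: [N] boxes of fractional parts receive [N.+1] multiples. Two multiples in one box
   differ from integers by at most [Q.+1%:R^-1 <= eps / pi] in every coordinate. *)
pose N := #|{ffun I -> 'I_Q.+1}|.
pose f (q : 'I_N.+1) : {ffun I -> 'I_Q.+1} := [ffun i => box (q%:R * (rho0 * al i))].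
have : ~ injective f.
  move=> /leq_card; rewrite card_ord -/N ltnn; exact: notF.
move=> ninj.
have [p [q [pq fpq]]] : exists p q : 'I_N.+1, (p < q)%N /\ f p = f q.
  apply: contrapT => no; apply: ninj => p q e; apply/val_inj/eqP/negPn/negP.
  rewrite neq_ltn => /orP[h|h]; apply: no; first by exists p, q.
  by exists q, p.
exists ((q - p)%:R * rho0).
  by rewrite ler_peMl ?(ltW r0)// ler1n subn_gt0.
move=> i; have /ffunP/(_ i) := fpq; rewrite !ffunE => bE.
have := boxE (p%:R * (rho0 * al i)); have := boxE (q%:R * (rho0 * al i)); rewrite bE.
set x := p%:R * _; set y := q%:R * _; set b := (box y)%:R => hy hx.
have yx : (q - p)%:R * rho0 * al i = y - x by rewrite natrB ?(ltnW pq)// /x /y; ring.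
rewrite yx; pose z := Num.floor y - Num.floor x.
have fz : y - x = fr y - fr x + z%:~R by rewrite /fr /z intrB; ring.
have small : `|fr y - fr x| <= Q.+1%:R^-1.
  have Q0 : 0 < Q.+1%:R :> R by [].
  rewrite -(ler_pM2l Q0) mulfV ?gt_eqF// -{1}(gtr0_norm Q0) -normrM mulrBr ler_norml.
  by move: hx hy; clear; move=> /andP[? ?] /andP[? ?]; apply/andP; split; lra.
have per (m : nat) t : `|sin (pi * (t + m%:R))| = `|sin (pi * t) : R|.
  elim: m => [|m IH]; first by rewrite addr0.
  by rewrite -natr1 addrA mulrDr mulr1 sinDpi normrN.
have perz (m : int) t : `|sin (pi * (t + m%:~R))| = `|sin (pi * t) : R|.
  case: m => m; first exact: per.
  by rewrite NegzE -(per m.+1) mulrNz addrNK.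
rewrite fz perz (le_trans (ler_sin_self _))// normrM (ger0_norm (pi_ge0 _)).
rewrite (le_trans (ler_wpM2l (pi_ge0 _) small))//.
by rewrite ler_pdivrMr// mulrC -ler_pdivrMr.
Qed.

End SimultaneousApproximation.

(** * Convergence of the frequency sum *)

Section Decay.
Variable R : realType.

Definition root1 (j : nat) : R := Num.sqrt j.+1%:R.
(** This is (j + 1)^(-3/2). By [inv_cube_le] a product of two such factors dominates |k|^-3, so the
    planar sum separates into one-dimensional ones; the shift by 1 keeps index 0 finite. *)
Definition decay (j : nat) : R := (root1 j ^+ 3)^-1.

Lemma root1_gt0 j : 0 < root1 j. Proof. by rewrite sqrtr_gt0. Qed.

Lemma root1_sq j : root1 j ^+ 2 = j.+1%:R. Proof. by rewrite sqr_sqrtr. Qed.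

Lemma decay_gt0 j : 0 < decay j. Proof. by rewrite invr_gt0 exprn_gt0// root1_gt0. Qed.

(** For x and y with y^2 - x^2 = 1, the difference 1/x - 1/y equals 1 / (x y (x + y)), at least 1 /
    (2 y^3) as x <= y. *)
Lemma decay_telescope j : decay j.+1 <= 2 * ((root1 j)^-1 - (root1 j.+1)^-1).
Proof.
have x0 := root1_gt0 j; have y0 := root1_gt0 j.+1.
have yx : root1 j.+1 ^+ 2 - root1 j ^+ 2 = 1 by rewrite !root1_sq -[j.+2%:R]natr1 addrAC subrr add0r.
have xy : root1 j <= root1 j.+1 by rewrite ler_sqrt ?ler_nat.
rewrite /decay; move: (root1 j) (root1 j.+1) x0 y0 yx xy => x y x0 y0 yx xy.
have -> : 2 * (x^-1 - y^-1) = 2 * (y ^+ 2 - x ^+ 2) / (x * y * (y + x)).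
  by field; rewrite ?gt_eqF// addr_gt0.
rewrite yx mulr1 ler_pdivlMr ?mulr_gt0 ?addr_gt0// mulrC ler_pdivrMr ?exprn_gt0//.
have : x * y <= y * y by rewrite ler_wpM2r// ltW.
rewrite !exprS expr0 mulr1; nra.
Qed.

Lemma sum_decay_tail K N : \sum_(0 <= j < N) (K < j)%N%:R * decay j <= 2 / root1 K.
Proof.
suff : \sum_(0 <= j < N) (K < j)%N%:R * decay j <= 2 * ((root1 K)^-1 - (root1 (maxn K N.-1))^-1).
  by move/le_trans; apply; rewrite ler_wpM2l// gerBl invr_ge0 ltW// root1_gt0.
elim: N => [|N IH]; first by rewrite big_geq// maxn0 subrr mulr0.
rewrite big_nat_recr//=; case: ltnP => KN; last first.
  by rewrite mul0r addr0 (le_trans IH)// (maxn_idPl _)// (leq_trans (leq_pred _)).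
move: IH; case: N KN => // N KN IH; rewrite mul1r (le_trans (lerD IH (decay_telescope N)))//.
rewrite /= (maxn_idPr (KN : (K <= N)%N)).
by lra.
Qed.

Lemma sum_decay N : \sum_(0 <= j < N) decay j <= 3.
Proof.
case: N => [|N]; first by rewrite big_geq.
have := sum_decay_tail 0 N.+1; rewrite !big_nat_recl//= mul0r add0r => h.
have r1 : root1 0 = 1 by rewrite /root1 sqrtr1.
rewrite {1}/decay r1 expr1n invr1; move: h; rewrite r1 invr1 mulr1 => h.
have -> : 3 = 1 + 2 :> R by ring.
rewrite lerD2l (le_trans _ h)//; apply: ler_sum => i _; by rewrite mul1r.
Qed.

Lemma inv_cube_le (k1 k2 : nat) (q : R) : (0 < k1 + k2)%N -> 0 < q ->
  q ^+ 2 = k1%:R ^+ 2 + k2%:R ^+ 2 -> (q ^+ 3)^-1 <= 8 * (decay k1 * decay k2).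
Proof.
move=> k0 q0 qE.
(* Squared, this is (k1 + 1)(k2 + 1) <= 4 (k1^2 + k2^2), valid for integers not both 0. *)
have h : root1 k1 * root1 k2 <= 2 * q.
  have a0 : 0 <= root1 k1 * root1 k2 by rewrite mulr_ge0// ltW// root1_gt0.
  rewrite -ler_sqr; [|by rewrite nnegrE|by rewrite nnegrE mulr_ge0// ltW].
  rewrite !exprMn !root1_sq qE.
  rewrite -!natrX -natrD -!natrM ler_nat; nia.
rewrite /decay -invfM -exprMn.
have p0 : 0 < root1 k1 * root1 k2 by rewrite mulr_gt0// root1_gt0.
rewrite -[8]invrK -invfM lef_pV2 ?posrE ?exprn_gt0 ?mulr_gt0 ?invr_gt0 ?exprn_gt0 ?root1_gt0//.
have -> : 8^-1 = 2^-1 ^+ 3 :> R by field.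
rewrite -exprMn ler_pXn2r//; [by rewrite ler_pdivrMl|rewrite nnegrE mulr_ge0//; lra|by rewrite nnegrE ltW].
Qed.

End Decay.

(** * Pointwise bounds for one edge term *)

Section EdgeTerm.
Variable R : realType.
Implicit Types X Y : R.

Lemma sinc_sq_le x : sinc x ^+ 2 * (1 + x ^+ 2) <= 2 :> R.
Proof.
have h1 : sinc x ^+ 2 <= 1.
  by rewrite -[leLHS]ger0_norm ?sqr_ge0// normrX expr_le1// sinc_max.
have h2 : sin x ^+ 2 <= 1.
  by rewrite -[leLHS]ger0_norm ?sqr_ge0// normrX expr_le1// sin_max.
by have := mul_sinc x => h; rewrite mulrDr mulr1 -exprMn mulrC h; lra.
Qed.

(* The phase depends on [Y = +- sqrt (L ^ 2 - X ^ 2)], which is stationary at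
   the maximum [L] of the edge term. *)
Lemma sin_phase_le (g X Y L : R) : 0 < L -> X ^+ 2 + Y ^+ 2 = L ^+ 2 ->
  `|sin (g * Y)| <= `|sin (g * L)| + `|g| * X ^+ 2 / L.
Proof.
move=> L0 XYL.
have -> : `|sin (g * Y)| = `|sin (g * `|Y|)|.
  by have [y0|y0] := leP 0 Y; [rewrite (ger0_norm y0)|rewrite (ltr0_norm y0) mulrN sinN normrN].
have sinlip x y : `|sin x - sin y : R| <= `|x - y|.
  have S t : sin t = cos (t - pi / 2) :> R by rewrite cosB cos_pihalf sin_pihalf mulr0 add0r mulr1.
  rewrite !S (le_trans (cos_lipschitz _ _))// le_eqVlt; apply/orP; left; apply/eqP.
  by congr `|_|; ring.
have YL : `|Y| <= L.
  by rewrite -ler_sqr ?nnegrE ?(ltW L0)// real_normK ?num_real// -XYL lerDr sqr_ge0.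
have gap : L - `|Y| <= X ^+ 2 / L.
  rewrite ler_pdivlMr//.
  have -> : X ^+ 2 = L ^+ 2 - `|Y| ^+ 2 by rewrite real_normK ?num_real// -XYL addrK.
  have := normr_ge0 Y; move: `|Y| YL => y yL y0; rewrite !expr2; nra.
have := sinlip (g * `|Y|) (g * L); rewrite -mulrBr normrM => h.
have h2 : `|g| * `| `|Y| - L | <= `|g| * X ^+ 2 / L.
  by rewrite -mulrA ler_wpM2l// distrC ger0_norm ?subr_ge0.
have := lerB_dist (sin (g * `|Y|)) (sin (g * L)).
lra.
Qed.

(** One factor [|Y|] is bounded by [L], the other is kept: it is what makes the angular integral an
    arctangent. *)
Lemma edge_term_le (rho X Y L g : R) : 0 < rho -> 0 < L -> X ^+ 2 + Y ^+ 2 = L ^+ 2 ->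
  (rho * Y * sinc (pi * (rho * X)) * sin (g * Y)) ^+ 2 <=
  2 * rho ^+ 2 * L * (`|Y| * (sin (g * Y) ^+ 2 / (1 ^+ 2 + (rho * X) ^+ 2))).
Proof.
move=> r0 L0 XYL.
have YL : `|Y| <= L.
  by rewrite -ler_sqr ?nnegrE ?(ltW L0)// real_normK ?num_real// -XYL lerDr sqr_ge0.
set t := rho * X; set s := sinc _; set S := sin _; rewrite expr1n.
have t1 : 0 < 1 + t ^+ 2 by rewrite ltr_wpDr ?sqr_ge0.
have s2 : s ^+ 2 <= 2 / (1 + t ^+ 2).
  rewrite ler_pdivlMr// (le_trans _ (sinc_sq_le (pi * t)))// -/s ler_wpM2l ?sqr_ge0//.
  rewrite lerD2l (exprMn 2 pi) ler_peMl ?sqr_ge0// expr_ge1// ?pi_ge0// (le_trans _ (pi_ge2 R))//; lra.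
have -> : 2 * rho ^+ 2 * L * (`|Y| * (S ^+ 2 / (1 + t ^+ 2))) =
  (rho ^+ 2 * S ^+ 2) * ((L * `|Y|) * (2 / (1 + t ^+ 2))) by ring.
have -> : (rho * Y * s * S) ^+ 2 = (rho ^+ 2 * S ^+ 2) * ((`|Y| * `|Y|) * s ^+ 2).
  by rewrite -expr2 real_normK ?num_real//; ring.
apply: ler_wpM2l; first by rewrite mulr_ge0 ?sqr_ge0.
by apply: ler_pM => //; (exact: sqr_ge0 || exact: ler_wpM2r).
Qed.

Lemma edge_term_crude (rho X Y L g : R) : 0 < rho -> 0 < L -> X ^+ 2 + Y ^+ 2 = L ^+ 2 ->
  (rho * Y * sinc (pi * (rho * X)) * sin (g * Y)) ^+ 2 <=
  2 * rho ^+ 2 * L * (`|Y| / (1 ^+ 2 + (rho * X) ^+ 2)).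
Proof.
move=> r0 L0 XYL; rewrite (le_trans (edge_term_le g r0 L0 XYL))//.
have c0 : 0 <= 2 * rho ^+ 2 * L by apply: mulr_ge0 (ltW L0); rewrite mulr_ge0 ?sqr_ge0.
apply: ler_wpM2l => //; apply: ler_wpM2l => //.
apply: ler_piMl; first by rewrite invr_ge0 addr_ge0 ?sqr_ge0.
by rewrite -[leLHS]ger0_norm ?sqr_ge0// normrX expr_le1// sin_max.
Qed.

(** For [rho * |X| >= Z] the sine is bounded by 1 and the width 1 is traded for [Z] at the price of
    a factor 2. Otherwise the deviation from the stationary phase, divided by the decay, is at most
    1 / Z^2 by the assumption on [g] and [Z]. *)
Lemma edge_term_fine (rho X Y L g Z eps : R) : 0 < rho -> 0 < L -> X ^+ 2 + Y ^+ 2 = L ^+ 2 ->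
  0 < Z -> 2 * g ^+ 2 * Z ^+ 4 <= (L * rho ^+ 2) ^+ 2 -> `|sin (g * L)| <= eps ->
  (rho * Y * sinc (pi * (rho * X)) * sin (g * Y)) ^+ 2 <=
  2 * rho ^+ 2 * L * (2 * eps ^+ 2 * (`|Y| / (1 ^+ 2 + (rho * X) ^+ 2)) +
    2 * (`|Y| / (Z ^+ 2 + (rho * X) ^+ 2))).
Proof.
move=> r0 L0 XYL Z0 gZ sL; rewrite (le_trans (edge_term_le g r0 L0 XYL))//.
have c0 : 0 <= 2 * rho ^+ 2 * L by apply: mulr_ge0 (ltW L0); rewrite mulr_ge0 ?sqr_ge0.
rewrite (ler_wpM2l c0)//.
have h1 := sin_phase_le g L0 XYL.
have h2 : sin (g * Y) ^+ 2 <= 1.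
  by rewrite -[leLHS]ger0_norm ?sqr_ge0// normrX expr_le1// sin_max.
set S := sin _ in h1 h2 *.
have h3 : S ^+ 2 <= 2 * eps ^+ 2 + 2 * (`|g| * X ^+ 2 / L) ^+ 2.
  have d0 : 0 <= `|g| * X ^+ 2 / L by rewrite divr_ge0 ?(ltW L0)// mulr_ge0 ?sqr_ge0.
  have : `|S| <= eps + `|g| * X ^+ 2 / L by rewrite (le_trans h1)// lerD2r.
  have := normr_ge0 S; rewrite -(real_normK (num_real S)); move: `|S| (_ / L) d0 => y d d0 y0 yd.
  have : y ^+ 2 <= (eps + d) ^+ 2 by rewrite ler_sqr ?nnegrE// (le_trans y0).
  by have := sqr_ge0 (eps - d); rewrite !expr2; lra.
have -> : 2 * eps ^+ 2 * (`|Y| / (1 ^+ 2 + (rho * X) ^+ 2)) + 2 * (`|Y| / (Z ^+ 2 + (rho * X) ^+ 2)) =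
   `|Y| * (2 * eps ^+ 2 / (1 ^+ 2 + (rho * X) ^+ 2) + 2 / (Z ^+ 2 + (rho * X) ^+ 2)) by ring.
rewrite ler_wpM2l// expr1n; set t := rho * X.
have t1 : 0 < 1 + t ^+ 2 by rewrite ltr_wpDr ?sqr_ge0.
have tZ : 0 < Z ^+ 2 + t ^+ 2 by rewrite ltr_wpDr ?sqr_ge0// exprn_gt0.
have e0 : 0 <= 2 * eps ^+ 2 / (1 + t ^+ 2) by rewrite divr_ge0 ?(ltW t1)// mulr_ge0 ?sqr_ge0.
have [Zt|tZ'] := leP (Z ^+ 2) (t ^+ 2).
  rewrite -[leLHS]add0r lerD// (@le_trans _ _ (1 / (1 + t ^+ 2)))//.
    by rewrite ler_wpM2r// invr_ge0 ltW.
  by rewrite ler_pdivrMr// mulrAC ler_pdivlMr// mul1r; lra.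
apply: (@le_trans _ _ ((2 * eps ^+ 2 + 2 * (`|g| * X ^+ 2 / L) ^+ 2) / (1 + t ^+ 2))).
  by rewrite ler_wpM2r// invr_ge0 ltW.
rewrite mulrDl lerD2l.
apply: (@le_trans _ _ (Z ^+ 2)^-1); last first.
  rewrite -[leLHS]mul1r ler_pdivlMr// mulrAC ler_pdivrMr ?exprn_gt0//; lra.
rewrite ler_pdivrMr// -[leRHS]mulrC ler_pdivlMr ?exprn_gt0//.
have XE : X ^+ 2 = t ^+ 2 / rho ^+ 2 by rewrite /t; field; rewrite gt_eqF.
have -> : 2 * (`|g| * X ^+ 2 / L) ^+ 2 * Z ^+ 2 =
    (2 * g ^+ 2 * (t ^+ 2 * Z ^+ 2) / (L * rho ^+ 2) ^+ 2) * t ^+ 2.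
  by rewrite XE !exprMn real_normK ?num_real//; field; rewrite !gt_eqF.
apply: (@le_trans _ _ (1 * t ^+ 2)); last by rewrite mul1r lerDr.
rewrite ler_wpM2r ?sqr_ge0// ler_pdivrMr ?exprn_gt0 ?mulr_gt0 ?exprn_gt0// mul1r (le_trans _ gZ)//.
apply: ler_wpM2l; first by rewrite mulr_ge0 ?sqr_ge0.
have -> : Z ^+ 4 = Z ^+ 2 * Z ^+ 2 by rewrite -exprD.
by rewrite ler_wpM2r ?sqr_ge0// ltW.
Qed.

End EdgeTerm.

(** * Antipodal edges and the edge sum of an inscribed polygon *)

Section AntipodalPolygon.
Variables (R : realType) (n : nat) (v : 'I_n -> R * R) (ant : 'I_n -> 'I_n) (c : R * R).
Hypothesis vi : injective v.
Hypothesis antE : forall k, v (ant k) = (2 * c.1 - (v k).1, 2 * c.2 - (v k).2).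

Lemma antK : involutive ant.
Proof.
move=> k; apply: vi; rewrite !antE /= [RHS]surjective_pairing; congr pair; ring.
Qed.

Lemma edge_ant_imp i j : edge v i j -> edge v (ant i) (ant j).
Proof.
move=> /edgeP[ij H]; apply/edgeP; split; first by rewrite (can_eq antK).
move=> k ki kj; have := H (ant k); rewrite -!(can_eq antK k) !antK in ki kj *.
move/(_ ki kj).
by rewrite !antE /orient /cross /vsub /=; congr (0 < _); ring.
Qed.

Lemma edge_ant i j : edge v (ant i) (ant j) = edge v i j.
Proof. by apply/idP/idP => [/edge_ant_imp|/edge_ant_imp//]; rewrite !antK. Qed.

(* Pairing each edge with its antipode factors the phase of the centre out. *)
Lemma ftrans_antipodal a b d : ftrans v a b d = \sum_i \sum_(j | edge v i j)
  (a * ((v j).2 - (v i).2) - b * ((v j).1 - (v i).1)) / (2 * pi * (a ^+ 2 + b ^+ 2)) *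
  (cos (2 * pi * (a * c.1 + b * c.2) + d) *
   sin (2 * pi * (a * (((v i).1 + (v j).1) / 2 - c.1) + b * (((v i).2 + (v j).2) / 2 - c.2))) *
   sinc (pi * (a * ((v j).1 - (v i).1) + b * ((v j).2 - (v i).2)))).
Proof.
pose T i j := (a * ((v j).2 - (v i).2) - b * ((v j).1 - (v i).1)) /
  (2 * pi * (a ^+ 2 + b ^+ 2)) * edge_mean v a b d i j.
have S : ftrans v a b d = \sum_i \sum_(j | edge v i j) T (ant i) (ant j).
  rewrite /ftrans (reindex_inj (can_inj antK)); apply: eq_bigr => i _.
  rewrite (reindex_inj (can_inj antK)); apply: eq_bigl => j; exact: edge_ant.
have -> : ftrans v a b d = 2^-1 * (ftrans v a b d + ftrans v a b d) by field.
rewrite {2}S /ftrans -big_split mulr_sumr; apply: eq_bigr => i _.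
rewrite -big_split mulr_sumr; apply: eq_bigr => j _ /=.
rewrite /T /edge_mean !antE /=; move: (v i) (v j) c => [x1 y1] [x2 y2] [c1 c2] /=.
set ph := 2 * pi * (a * c1 + b * c2) + d.
set m := 2 * pi * (a * ((x1 + x2) / 2 - c1) + b * ((y1 + y2) / 2 - c2)).
set z := pi * (a * (x2 - x1) + b * (y2 - y1)).
have -> : pi * (a * (x1 + x2) + b * (y1 + y2)) + d = ph + m by rewrite /ph /m; field.
have -> : pi * (a * (2 * c1 - x1 + (2 * c1 - x2)) + b * (2 * c2 - y1 + (2 * c2 - y2))) + d = ph - m.
  by rewrite /ph /m; field.
have -> : pi * (a * (2 * c1 - x2 - (2 * c1 - x1)) + b * (2 * c2 - y2 - (2 * c2 - y1))) = - z.
  by rewrite /z; ring.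
have -> : sinc (- z) = sinc z by rewrite /sinc oppr_eq0 sinN mulNr invrN mulrN opprK.
rewrite sinD sinB; clearbody ph m z; move: ((2 * pi * _)^-1) (cos ph) (sin ph) => q C S'.
by field.
Qed.

End AntipodalPolygon.

Section InscribedPolygon.
Variables (R : realType) (n : nat) (v : 'I_n -> R * R) (ant : 'I_n -> 'I_n) (c : R * R) (r : R).
Hypothesis vi : injective v.
Hypothesis antE : forall k, v (ant k) = (2 * c.1 - (v k).1, 2 * c.2 - (v k).2).
Hypothesis circ : forall k, ((v k).1 - c.1) ^+ 2 + ((v k).2 - c.2) ^+ 2 = r ^+ 2.
Implicit Types (i j k : 'I_n) (a b d th rho : R).

Lemma sqr_sum_le (I : finType) (x : I -> R) : (\sum_i x i) ^+ 2 <= #|I|%:R * \sum_i x i ^+ 2.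
Proof.
have : 0 <= \sum_i \sum_j (x i - x j) ^+ 2 by apply: sumr_ge0 => i _; apply: sumr_ge0 => j _; exact: sqr_ge0.
have -> : \sum_i \sum_j (x i - x j) ^+ 2 =
    (#|I|%:R * \sum_i x i ^+ 2 - (\sum_i x i) ^+ 2) * 2.
  transitivity (\sum_i (#|I|%:R * x i ^+ 2 - 2 * x i * \sum_j x j + \sum_j x j ^+ 2)).
    apply: eq_bigr => i _; rewrite mulr_natl -sumr_const mulr_sumr -sumrB -big_split /=.
    by apply: eq_bigr => j _; ring.
  rewrite big_split sumrB /= -mulr_sumr -mulr_suml -mulr_sumr sumr_const -mulr_natl.
  by ring.
by rewrite pmulr_lge0// subr_ge0.
Qed.

Definition len i j : R := Num.sqrt (dot (side v i j) (side v i j)).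

(* The midpoint of an edge [e] differs from the centre by [apothem] times [e] turned by a right angle. *)
Definition apothem i j : R :=
  ((side v i j).1 * (((v i).2 + (v j).2) / 2 - c.2) -
   (side v i j).2 * (((v i).1 + (v j).1) / 2 - c.1)) / dot (side v i j) (side v i j).

(** Components of the frequency (a, b) along and across the edge rotated by [th], scaled by its
    length. [across] is the derivative of [along] in [th]. *)
Definition along i j a b th : R := (a * (side v i j).1 + b * (side v i j).2) * cos th +
  (b * (side v i j).1 - a * (side v i j).2) * sin th.
Definition across i j a b th : R := (b * (side v i j).1 - a * (side v i j).2) * cos th -
  (a * (side v i j).1 + b * (side v i j).2) * sin th.

Lemma len_sq i j : len i j ^+ 2 = dot (side v i j) (side v i j).
Proof. by rewrite sqr_sqrtr// dot_side_ge0. Qed.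

Lemma along_across i j a b q th : q ^+ 2 = a ^+ 2 + b ^+ 2 ->
  along i j a b th ^+ 2 + across i j a b th ^+ 2 = (q * len i j) ^+ 2.
Proof.
move=> qE; rewrite exprMn qE len_sq /along /across /dot.
transitivity ((cos th ^+ 2 + sin th ^+ 2) * ((a ^+ 2 + b ^+ 2) *
  ((side v i j).1 ^+ 2 + (side v i j).2 ^+ 2))); first by ring.
by rewrite cos2Dsin2; ring.
Qed.

(** Both ends lie on one circle, so the line from the centre to the midpoint of the chord is
    orthogonal to it. *)
Lemma apothemE i j : i != j ->
  ((v i).1 + (v j).1) / 2 - c.1 = - (apothem i j * (side v i j).2) /\
  ((v i).2 + (v j).2) / 2 - c.2 = apothem i j * (side v i j).1.
Proof.
move=> ij; have D := dot_side_gt0 vi ij.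
have perp : (side v i j).1 * (((v i).1 + (v j).1) / 2 - c.1) +
    (side v i j).2 * (((v i).2 + (v j).2) / 2 - c.2) = 0.
  have e : ((v j).1 - c.1) ^+ 2 + ((v j).2 - c.2) ^+ 2 -
     (((v i).1 - c.1) ^+ 2 + ((v i).2 - c.2) ^+ 2) = 0 by rewrite !circ subrr.
  by rewrite -[RHS](mulr0 2^-1) -{}e /side /vsub /=; field.
move: D perp; rewrite /apothem; move: (side v i j) => [e1 e2]; rewrite /dot /=.
move: (_ - c.1) (_ - c.2) => m1 m2 D perp.
have D' : e1 * e1 + e2 * e2 != 0 by rewrite gt_eqF.
split.
  transitivity ((e1 * (e1 * m1 + e2 * m2) - e2 * (e1 * m2 - e2 * m1)) / (e1 * e1 + e2 * e2)).
    by field.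
  by rewrite perp; field.
transitivity ((e2 * (e1 * m1 + e2 * m2) + e1 * (e1 * m2 - e2 * m1)) / (e1 * e1 + e2 * e2)).
  by field.
by rewrite perp; field.
Qed.

(** By [apothemE] the phase of an antipodal pair is proportional to [across] alone. The factor
    [n%:R ^+ 2] is Cauchy-Schwarz over ordered pairs of vertices. *)
Lemma ftrans_place_le a b d th rho : 0 < rho ->
  ftrans (fun k => place rho th (v k)) a b d ^+ 2 <= n%:R ^+ 2 *
  \sum_i \sum_(j | edge v i j) ((2 * pi * (a ^+ 2 + b ^+ 2))^-1) ^+ 2 *
    (rho * across i j a b th * sinc (pi * (rho * along i j a b th)) *
     sin (2 * pi * rho * apothem i j * across i j a b th)) ^+ 2.
Proof.
move=> r0; set w := fun k => place rho th (v k).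
have wi : injective w by move=> i j /(place_inj r0) /vi.
have wE k : w (ant k) = (2 * (place rho th c).1 - (w k).1, 2 * (place rho th c).2 - (w k).2).
  by rewrite /w antE /place /Defs.rot /=; congr pair; ring.
rewrite (ftrans_antipodal wi wE).
set ph := cos _.
pose x (p : 'I_n * 'I_n) := if edge v p.1 p.2 then (2 * pi * (a ^+ 2 + b ^+ 2))^-1 * ph *
  (rho * across p.1 p.2 a b th * sinc (pi * (rho * along p.1 p.2 a b th)) *
     sin (2 * pi * rho * apothem p.1 p.2 * across p.1 p.2 a b th)) else 0.
have -> : \sum_i \sum_(j | edge w i j)
    (a * ((w j).2 - (w i).2) - b * ((w j).1 - (w i).1)) / (2 * pi * (a ^+ 2 + b ^+ 2)) *
    (ph * sin (2 * pi * (a * (((w i).1 + (w j).1) / 2 - (place rho th c).1) +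
       b * (((w i).2 + (w j).2) / 2 - (place rho th c).2))) *
     sinc (pi * (a * ((w j).1 - (w i).1) + b * ((w j).2 - (w i).2)))) = - \sum_p x p.
  rewrite -(pair_bigA _ (fun i j => x (i, j))) -sumrN; apply: eq_bigr => i _.
  rewrite -sumrN big_mkcond; apply: eq_bigr => j _ /=.
  rewrite /x /= edge_place//; case: ifPn => e; last by rewrite oppr0.
  have ij : i != j by case/edgeP: e.
  have [m1 m2] := apothemE ij.
  have -> : a * ((w j).2 - (w i).2) - b * ((w j).1 - (w i).1) = rho * across i j a b th.
    by rewrite /w /across /place /Defs.rot /side /vsub /=; ring.
  have -> : a * ((w j).1 - (w i).1) + b * ((w j).2 - (w i).2) = - (rho * along i j a b th).
    by rewrite /w /along /place /Defs.rot /side /vsub /=; ring.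
  have -> : a * (((w i).1 + (w j).1) / 2 - (place rho th c).1) +
       b * (((w i).2 + (w j).2) / 2 - (place rho th c).2) =
      - (rho * (a * (cos th * (((v i).1 + (v j).1) / 2 - c.1) - sin th * (((v i).2 + (v j).2) / 2 - c.2)) +
       b * (sin th * (((v i).1 + (v j).1) / 2 - c.1) + cos th * (((v i).2 + (v j).2) / 2 - c.2)))).
    by rewrite /w /place /Defs.rot /=; field.
  rewrite m1 m2.
  have -> : 2 * pi * - (rho * (a * (cos th * - (apothem i j * (side v i j).2) - sin th * (apothem i j * (side v i j).1)) +
       b * (sin th * - (apothem i j * (side v i j).2) + cos th * (apothem i j * (side v i j).1)))) =
      - (2 * pi * rho * apothem i j * across i j a b th) by rewrite /across; ring.
  set z := along i j a b th.
  have -> : sinc (pi * - (rho * z)) = sinc (pi * (rho * z)).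
    by rewrite mulrN /sinc oppr_eq0 sinN mulNr invrN mulrN opprK.
  by rewrite sinN; ring.
rewrite sqrrN (le_trans (sqr_sum_le x))// card_prod card_ord natrM -expr2.
rewrite ler_wpM2l ?sqr_ge0// -(pair_bigA _ (fun i j => x (i, j) ^+ 2)) /=.
apply: ler_sum => i _; rewrite [leRHS]big_mkcond; apply: ler_sum => j _ /=.
rewrite /x /=; case: ifPn => _; last by rewrite expr0n.
rewrite exprMn ler_wpM2r ?sqr_ge0// exprMn ler_piMr ?sqr_ge0//.
by rewrite -[leLHS]ger0_norm ?sqr_ge0// normrX expr_le1// cos_max.
Qed.

End InscribedPolygon.

Section SeriesBounds.
Variable R : realType.
Notation mu := (@lebesgue_measure R).

Lemma nneseries_le (f : nat -> R) (C : R) : (forall k, 0 <= f k) ->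
  (forall N, \sum_(0 <= k < N) f k <= C) -> (\sum_(0 <= k <oo) (f k)%:E <= C%:E)%E.
Proof.
move=> f0 fC; apply: lime_le.
  by apply: is_cvg_nneseries => k _ _; rewrite lee_fin.
by apply: nearW => N; rewrite sumEFin lee_fin.
Qed.

(** Tonelli, with each term bounded after integration. *)
Lemma int_double_series_le (b : nat -> nat -> R -> R) (beta : nat -> nat -> R) (gam : nat -> R) (C : R) :
  (forall k1 k2, pcf (b k1 k2)) -> (forall k1 k2 th, 0 <= b k1 k2 th) ->
  (forall k1 k2, integ 0 (2 * pi) (b k1 k2) <= beta k1 k2) ->
  (forall k2 N, \sum_(0 <= k1 < N) beta k1 k2 <= gam k2) ->
  (forall N, \sum_(0 <= k2 < N) gam k2 <= C) ->
  measurable_fun `[(0 : R), 2 * pi]%classic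
    (fun th => \sum_(0 <= k2 <oo) \sum_(0 <= k1 <oo) (b k1 k2 th)%:E)%E /\
  (\int[mu]_(th in `[0%R, (2 * pi)%R]) (8%:E * \sum_(0 <= k2 <oo) \sum_(0 <= k1 <oo) (b k1 k2 th)%:E) <=
   (8 * C)%:E)%E.
Proof.
move=> pb b0 ib bg gC.
have mb k1 k2 (D : set R) : measurable_fun D (fun th => (b k1 k2 th)%:E) by exact: measurable_EFin_pcf.
have b0E k1 k2 th : (0 <= (b k1 k2 th)%:E)%E by rewrite lee_fin.
have mb1 k2 (D : set R) : measurable_fun D (fun th => \sum_(0 <= k1 <oo) (b k1 k2 th)%:E)%E.
  by apply: (@ge0_emeasurable_sum _ _ R D (fun k th => (b k k2 th)%:E) xpredT).
have s0 k2 th : (0 <= \sum_(0 <= k1 <oo) (b k1 k2 th)%:E)%E by exact: nneseries_ge0.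
have mb2 (D : set R) : measurable_fun D (fun th => \sum_(0 <= k2 <oo) \sum_(0 <= k1 <oo) (b k1 k2 th)%:E)%E.
  by apply: (@ge0_emeasurable_sum _ _ R D (fun k th => \sum_(0 <= k1 <oo) (b k1 k th)%:E)%E xpredT).
have beta0 k1 k2 : 0 <= beta k1 k2 by rewrite (le_trans _ (ib k1 k2))// int_ge0.
split; first exact: mb2.
rewrite ge0_integralZl_EFin//; [|by move=> th _; apply: nneseries_ge0 => k _ _; exact: s0|exact: mb2].
rewrite EFinM lee_wpmul2l//.
rewrite (@integral_nneseries _ _ R mu _ _ (fun k th => \sum_(0 <= k1 <oo) (b k1 k th)%:E)%E)//; last by move=> k; exact: mb1.
apply: (@le_trans _ _ (\sum_(0 <= k2 <oo) (gam k2)%:E)%E); last first.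
  apply: nneseries_le => // k2.
  by have := bg k2 0%N; rewrite big_geq.
apply: lee_nneseries => k2 _; first by move=> _; exact: integral_ge0.
rewrite (@integral_nneseries _ _ R mu _ _ (fun k th => (b k k2 th)%:E))//; last by move=> k; exact: mb.
apply: (@le_trans _ _ (\sum_(0 <= k1 <oo) (beta k1 k2)%:E)%E); last exact: nneseries_le.
apply: lee_nneseries => k1 _; first by move=> _; exact: integral_ge0.
by rewrite EFin_int// lee_fin.
Qed.

End SeriesBounds.

(** * Integrable majorants for the Fourier coefficients *)

Section Majorant.
Variables (R : realType) (n : nat) (v : 'I_n -> R * R) (ant : 'I_n -> 'I_n) (c : R * R) (r : R).
Hypothesis vi : injective v.
Hypothesis antE : forall k, v (ant k) = (2 * c.1 - (v k).1, 2 * c.2 - (v k).2).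
Hypothesis circ : forall k, ((v k).1 - c.1) ^+ 2 + ((v k).2 - c.2) ^+ 2 = r ^+ 2.
Variables (rho Z : R).
Hypotheses (rho0 : 0 < rho) (Z0 : 0 < Z).
Implicit Types (a b th z g : R) (i j : 'I_n).

Definition bump i j a b z th : R :=
  `|across v i j a b th| / (z ^+ 2 + (rho * along v i j a b th) ^+ 2).

Definition perimeter : R := \sum_i \sum_(j | edge v i j) len v i j.

(** [g1] weights the bump of width 1 and [g2] that of width [Z]: the pair (1, 0) is the crude bound,
    (2 eps^2, 2) the fine one. *)
Definition edge_majorant g1 g2 a b th i j : R :=
  ((2 * pi * (a ^+ 2 + b ^+ 2))^-1) ^+ 2 * (2 * rho ^+ 2 * (Num.sqrt (a ^+ 2 + b ^+ 2) * len v i j) *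
    (g1 * bump i j a b 1 th + g2 * bump i j a b Z th)).

Definition majorant g1 g2 a b th : R := n%:R ^+ 2 *
  \sum_i \sum_(j | edge v i j) edge_majorant g1 g2 a b th i j.

Lemma bump_ge0 i j a b z th : 0 <= bump i j a b z th.
Proof. by rewrite /bump divr_ge0// addr_ge0 ?sqr_ge0. Qed.

Lemma pcf_majorant_bump i j a b z : 0 < z -> pcf (bump i j a b z).
Proof.
move=> z0; apply: pcf_bump => //; last exact: continuous_trig.
rewrite (_ : across _ _ _ _ _ = fun th => (b * (side v i j).1 - a * (side v i j).2) * cos th +
  (- (a * (side v i j).1 + b * (side v i j).2)) * sin th); first exact: continuous_trig.
by apply/funext => th; rewrite /across mulNr.
Qed.

Lemma int_bump i j a b z : 0 < z -> integ 0 (2 * pi) (bump i j a b z) <= 3 * pi / (z * rho).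
Proof. by move=> z0; exact: int_wave_bump. Qed.

Lemma edge_majorant_ge0 g1 g2 a b th i j : 0 <= g1 -> 0 <= g2 -> 0 <= edge_majorant g1 g2 a b th i j.
Proof.
move=> g10 g20; rewrite /edge_majorant mulr_ge0 ?sqr_ge0// mulr_ge0//.
  by apply: mulr_ge0; rewrite mulr_ge0 ?sqr_ge0 ?sqrtr_ge0.
by rewrite addr_ge0// mulr_ge0// bump_ge0.
Qed.

Lemma majorant_ge0 g1 g2 a b th : 0 <= g1 -> 0 <= g2 -> 0 <= majorant g1 g2 a b th.
Proof.
move=> g10 g20; rewrite mulr_ge0 ?sqr_ge0// sumr_ge0// => i _; rewrite sumr_ge0// => j _.
exact: edge_majorant_ge0.
Qed.

Lemma pcf_edge_majorant g1 g2 a b i j : pcf (fun th => edge_majorant g1 g2 a b th i j).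
Proof.
by apply: pcfZ; apply: pcfZ; apply: pcfD; apply: pcfZ; exact: pcf_majorant_bump.
Qed.

Lemma pcf_majorant g1 g2 a b : pcf (majorant g1 g2 a b).
Proof.
apply: pcfZ; apply: pcf_sum => i _; apply: pcf_sum => j _; exact: pcf_edge_majorant.
Qed.

Lemma ftrans_majorant_crude a b d th : 0 < a ^+ 2 + b ^+ 2 ->
  ftrans (fun k => place rho th (v k)) a b d ^+ 2 <= majorant 1 0 a b th.
Proof.
move=> k0; rewrite (le_trans (ftrans_place_le vi antE circ a b d th rho0))//.
apply: ler_wpM2l; first exact: sqr_ge0.
apply: ler_sum => i _; apply: ler_sum => j e; have ij : i != j by case/edgeP: e.
apply: ler_wpM2l; first exact: sqr_ge0.
rewrite mul1r mul0r addr0; apply: edge_term_crude => //.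
  by rewrite mulr_gt0 ?sqrtr_gt0// dot_side_gt0.
by apply: along_across; rewrite sqr_sqrtr// ltW.
Qed.

Lemma ftrans_majorant_fine a b d th eps : 1 <= a ^+ 2 + b ^+ 2 ->
  (forall i j, edge v i j -> 4 * pi * `|apothem v c i j| * Z ^+ 2 <= len v i j * rho) ->
  (forall i j, edge v i j ->
    `|sin (pi * (rho * (2 * apothem v c i j * (Num.sqrt (a ^+ 2 + b ^+ 2) * len v i j))))| <= eps) ->
  ftrans (fun k => place rho th (v k)) a b d ^+ 2 <= majorant (2 * eps ^+ 2) 2 a b th.
Proof.
move=> k1 rZ se; rewrite (le_trans (ftrans_place_le vi antE circ a b d th rho0))//.
apply: ler_wpM2l; first exact: sqr_ge0.
apply: ler_sum => i _; apply: ler_sum => j e; have ij : i != j by case/edgeP: e.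
apply: ler_wpM2l; first exact: sqr_ge0.
have l0 : 0 < len v i j by rewrite sqrtr_gt0 dot_side_gt0.
have k0 : 0 < a ^+ 2 + b ^+ 2 by rewrite (lt_le_trans ltr01).
apply: edge_term_fine => //.
- by rewrite mulr_gt0// sqrtr_gt0.
- by apply: along_across; rewrite sqr_sqrtr// ltW.
- have := rZ i j e; move: (apothem v c i j) (len v i j) l0 => A l l0 rz.
  rewrite !exprMn sqr_sqrtr; last exact: ltW.
  apply: (@le_trans _ _ ((l * rho) ^+ 2 * rho ^+ 2)); last first.
    rewrite (_ : _ * (rho ^+ 2) ^+ 2 = (a ^+ 2 + b ^+ 2) * ((l * rho) ^+ 2 * rho ^+ 2)); last by ring.
    by rewrite ler_peMl// mulr_ge0 ?sqr_ge0.
  apply: (@le_trans _ _ ((4 * pi * `|A| * Z ^+ 2) ^+ 2 * rho ^+ 2)).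
    rewrite !exprMn real_normK ?num_real// -subr_ge0.
    rewrite (_ : _ - _ = 8 * ((pi * A * Z ^+ 2 * rho) ^+ 2)); last by ring.
    by rewrite mulr_ge0 ?sqr_ge0.
  rewrite ler_wpM2r ?sqr_ge0// ler_sqr ?nnegrE ?rz//.
    by apply: mulr_ge0 (sqr_ge0 _); rewrite !mulr_ge0 ?pi_ge0.
  by rewrite mulr_ge0 ?(ltW l0) ?(ltW rho0).
- apply: le_trans (se i j e); rewrite le_eqVlt; apply/orP; left; apply/eqP.
  by congr `|sin _|; ring.
Qed.

(** The squared normalization gives |k|^-4 and the length of the frequency one factor |k|; the
    angular integral turns [rho ^+ 2] into [rho]. The hypothesis on [a] covers both signs of
    [k1]. *)
Lemma int_majorant_le g1 g2 a (k1 k2 : nat) : 0 <= g1 -> 0 <= g2 -> a ^+ 2 = k1%:R ^+ 2 ->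
  integ 0 (2 * pi) (majorant g1 g2 a k2%:R) <=
  8 * n%:R ^+ 2 * perimeter * rho * (decay R k1 * decay R k2 * (g1 + g2 / Z)).
Proof.
move=> g10 g20 aE.
rewrite /majorant intZ; last by apply: pcf_sum => i _; apply: pcf_sum => j _; exact: pcf_edge_majorant.
rewrite int_sum; last by move=> i _; apply: pcf_sum => j _; exact: pcf_edge_majorant.
set X := decay R k1 * _ * _.
have -> : 8 * n%:R ^+ 2 * perimeter * rho * X = n%:R ^+ 2 * (perimeter * (8 * rho * X)) by ring.
apply: ler_wpM2l; first exact: sqr_ge0.
rewrite /perimeter mulr_suml; apply: ler_sum => i _.
rewrite int_sum; last by move=> j _; exact: pcf_edge_majorant.
rewrite mulr_suml; apply: ler_sum => j e.
have l0 : 0 <= len v i j by exact: sqrtr_ge0.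
have G0 : 0 <= g1 + g2 / Z by rewrite addr_ge0// divr_ge0// ltW.
have D0 := decay_gt0 R.
rewrite /edge_majorant !intZ; [|by apply: pcfD; apply: pcfZ; exact: pcf_majorant_bump
  |by apply: pcfZ; apply: pcfD; apply: pcfZ; exact: pcf_majorant_bump].
rewrite intD; [|by apply: pcfZ; exact: pcf_majorant_bump|by apply: pcfZ; exact: pcf_majorant_bump].
rewrite !intZ; [|exact: pcf_majorant_bump|exact: pcf_majorant_bump].
set q := Num.sqrt (a ^+ 2 + k2%:R ^+ 2).
(* At frequency 0 the majorant is 0, because [0^-1 = 0]. *)
have [k0|k0] := posnP (k1 + k2).
  have [k1z ->] : k1 = 0%N /\ k2 = 0%N by lia.
  have -> : a = 0 by apply/eqP; rewrite -sqrf_eq0 aE k1z expr0n.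
  rewrite !expr0n /= addr0 mulr0 invr0 expr0n mul0r.
  apply: mulr_ge0 => //; apply: mulr_ge0; first by rewrite mulr_ge0 ?(ltW rho0).
  by apply: mulr_ge0 G0; rewrite mulr_ge0// ltW.
have K1 : 0 < a ^+ 2 + k2%:R ^+ 2.
  by rewrite aE -!natrX -natrD ltr0n addn_gt0 !expn_gt0 !orbF -addn_gt0.
have q0 : 0 < q by rewrite sqrtr_gt0.
have qE : q ^+ 2 = a ^+ 2 + k2%:R ^+ 2 by rewrite sqr_sqrtr// ltW.
have c3 := inv_cube_le k0 q0; rewrite qE aE in c3; have {}c3 := c3 erefl.
have I1 := int_bump i j a k2%:R ltr01; have I2 := int_bump i j a k2%:R Z0.
have S : g1 * integ 0 (2 * pi) (bump i j a k2%:R 1) + g2 * integ 0 (2 * pi) (bump i j a k2%:R Z) <=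
    3 * pi / rho * (g1 + g2 / Z).
  apply: (@le_trans _ _ (g1 * (3 * pi / (1 * rho)) + g2 * (3 * pi / (Z * rho)))).
    by apply: lerD; apply: ler_wpM2l.
  by rewrite le_eqVlt; apply/orP; left; apply/eqP; field; rewrite ?gt_eqF.
rewrite -qE.
apply: (@le_trans _ _ ((2 * pi * q ^+ 2)^-1 ^+ 2 * (2 * rho ^+ 2 * (q * len v i j) * (3 * pi / rho * (g1 + g2 / Z))))).
  apply: ler_wpM2l; first exact: sqr_ge0.
  apply: ler_wpM2l => //; apply: mulr_ge0; first by rewrite mulr_ge0 ?sqr_ge0.
  by rewrite mulr_ge0 ?(ltW q0).
have -> : (2 * pi * q ^+ 2)^-1 ^+ 2 * (2 * rho ^+ 2 * (q * len v i j) * (3 * pi / rho * (g1 + g2 / Z))) =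
   (3 / 2 / pi) * (len v i j * rho * (g1 + g2 / Z) * (q ^+ 3)^-1).
  have := pi_gt0 R; move: (pi : R) (g1 + g2 / Z) => p G p0; field; rewrite ?gt_eqF//.
have X0 : 0 <= len v i j * rho * (g1 + g2 / Z) by rewrite !mulr_ge0 ?(ltW rho0).
apply: (@le_trans _ _ (1 * (len v i j * rho * (g1 + g2 / Z) * (q ^+ 3)^-1))).
  apply: ler_wpM2r; first by rewrite mulr_ge0// invr_ge0 exprn_ge0// ltW.
  by rewrite ler_pdivrMr ?pi_gt0// mul1r; have := pi_ge2 R; lra.
rewrite mul1r (_ : len v i j * (8 * rho * X) = len v i j * rho * (g1 + g2 / Z) * (8 * (decay R k1 * decay R k2))).
  exact: ler_wpM2l.
by rewrite /X; ring.
Qed.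

End Majorant.

(** * Inscribed symmetric polygons are irregular *)

Section IrregularIfInscribed.
Variables (R : realType) (n : nat) (v : 'I_n -> R * R).
Notation mu := (@lebesgue_measure R).
Hypotheses (irr : irredundant v) (n2 : (2 < n)%N).

(** A central symmetry of the hull permutes its extreme points, which are the vertices. *)
Lemma antipode_of_symmetric (c : R * R) :
  (forall x, hull v x -> hull v (2 * c.1 - x.1, 2 * c.2 - x.2)) ->
  exists ant : 'I_n -> 'I_n, forall k, v (ant k) = (2 * c.1 - (v k).1, 2 * c.2 - (v k).2).
Proof.
move=> sym.
have /fin_all_exists[ant antP] : forall k, exists l, v l = (2 * c.1 - (v k).1, 2 * c.2 - (v k).2).
  move=> k; have [hk ek] := vertex_extreme irr k.
  have [l ->] : exists l, (2 * c.1 - (v k).1, 2 * c.2 - (v k).2) = v l.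
    apply: (extreme_vertex (v := v)); split; first exact: sym.
    move=> y z s hy hz s01 [e1 e2].
    have := ek _ _ s (sym _ hy) (sym _ hz) s01; rewrite /=.
    case: (v k) e1 e2 => x1 x2 /= e1 e2 E.
    have [] := E ltac:(by congr pair; lra).
    by move=> h1 h2; rewrite [y]surjective_pairing [z]surjective_pairing; congr pair; lra.
  by exists l.
by exists ant.
Qed.

Lemma inscribed_small_discrepancy (c : R * R) (r : R) (eta : R) :
  (forall k, ((v k).1 - c.1) ^+ 2 + ((v k).2 - c.2) ^+ 2 = r ^+ 2) ->
  (forall x, hull v x -> hull v (2 * c.1 - x.1, 2 * c.2 - x.2)) ->
  0 < eta <= 1 -> exists2 rho : R, 1 <= rho &
  (L2sq_discrepancy (hull v) rho <=
    ((2 * pi)^-1 * (8 * (16 * n%:R ^+ 2 * perimeter v * rho * (15 * eta))))%:E)%E.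
Proof.
move=> circ sym /andP[eta0 eta1]; have [ant antE] := antipode_of_symmetric sym.
have cv := irredundant_convex_position irr; have [vi _ _] := cv.
have n1 : (1 < n)%N := ltnW n2.
(* These values make [2 * eps ^+ 2 + 2 / Z] at most [eta], the weight of a frequency treated by the
   fine bound. *)
pose Z := 4 / eta; have Z0 : 0 < Z by rewrite divr_gt0.
pose eps := eta / 2; have eps0 : 0 < eps by rewrite divr_gt0.
pose K := Num.Def.archi_bound ((2 / eta) ^+ 2).
have tailK : 2 / root1 R K <= eta.
  rewrite ler_pdivrMr ?root1_gt0// mulrC -ler_pdivrMr//.
  rewrite -ler_sqr ?nnegrE ?divr_ge0 ?(ltW eta0) ?(ltW (root1_gt0 _ _))// root1_sq.
  have /ltW/le_trans : (2 / eta) ^+ 2 < K%:R by apply: archi_boundP; exact: sqr_ge0.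
  by apply; rewrite ler_nat.
have dl : 2 * eps ^+ 2 + 2 / Z <= eta.
  rewrite /eps /Z (_ : _ + _ = eta ^+ 2 / 2 + eta / 2); last by field; rewrite gt_eqF.
  have : eta ^+ 2 <= eta by rewrite expr2 ler_piMl// ltW.
  lra.
(* Beyond this threshold [rho] satisfies the condition of [ftrans_majorant_fine] for all edges at
   once. *)
pose rhoZ := 1 + \sum_i \sum_(j | edge v i j) 4 * pi * `|apothem v c i j| * Z ^+ 2 / len v i j.
have term0 i j : 0 <= 4 * pi * `|apothem v c i j| * Z ^+ 2 / len v i j.
  apply: divr_ge0; last exact: sqrtr_ge0.
  by apply: mulr_ge0 (sqr_ge0 _); rewrite !mulr_ge0 ?pi_ge0.
have rhoZ1 : 1 <= rhoZ by rewrite lerDl; apply: sumr_ge0 => i _; exact: sumr_ge0.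
pose al (u : 'I_K.+1 * 'I_K.+1 * 'I_n * 'I_n) : R :=
  2 * apothem v c u.1.2 u.2 * (Num.sqrt (u.1.1.1%:R ^+ 2 + u.1.1.2%:R ^+ 2) * len v u.1.2 u.2).
have [rho rhoP rho_sin] := simultaneous_sin al (lt_le_trans ltr01 rhoZ1) eps0.
have rho1 : 1 <= rho by exact: le_trans rhoP.
have rho0 : 0 < rho by rewrite (lt_le_trans ltr01).
exists rho => //.
have rZ i j : edge v i j -> 4 * pi * `|apothem v c i j| * Z ^+ 2 <= len v i j * rho.
  move=> e; have ij : i != j by case/edgeP: e.
  have l0 : 0 < len v i j by rewrite sqrtr_gt0 dot_side_gt0.
  rewrite [leRHS]mulrC -ler_pdivrMr// (le_trans _ rhoP)// /rhoZ (bigD1 i)//= (bigD1 j)//=.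
  rewrite -[leLHS]add0r lerD// -addrA lerDl addr_ge0// sumr_ge0// => i' _.
  exact: sumr_ge0.
have [B HB] := placed_bound v rho.
rewrite (L2sq_discrepancyE cv n1 rho0 HB) EFinM lee_wpmul2l ?lee_fin ?invr_ge0 ?mulr_ge0 ?pi_ge0//.
pose low k1 k2 := (k1 <= K)%N && (k2 <= K)%N.
pose g1 k1 k2 : R := if low k1 k2 then 2 * eps ^+ 2 else 1.
pose g2 k1 k2 : R := if low k1 k2 then 2 else 0.
have g10 k1 k2 : 0 <= g1 k1 k2 by rewrite /g1; case: ifP => // _; rewrite mulr_ge0// sqr_ge0.
have g20 k1 k2 : 0 <= g2 k1 k2 by rewrite /g2; case: ifP.
pose M a k1 k2 th := majorant v rho Z (g1 k1 k2) (g2 k1 k2) a k2%:R th.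
pose b k1 k2 th := M k1%:R k1 k2 th + M (- k1%:R) k1 k2 th.
have pM a k1 k2 : pcf (M a k1 k2) by exact: pcf_majorant.
have b0 k1 k2 th : 0 <= b k1 k2 th by apply: addr_ge0; exact: majorant_ge0.
have pb k1 k2 : pcf (b k1 k2) by exact: pcfD.
have ftrans_le (k1 k2 : nat) (a : R) d th : (0 < k1 + k2)%N -> a ^+ 2 = k1%:R ^+ 2 ->
    ftrans (fun k => place rho th (v k)) a k2%:R d ^+ 2 <= M a k1 k2 th.
  move=> k0 aE; have K1 : 1 <= a ^+ 2 + k2%:R ^+ 2.
    by rewrite aE -!natrX -natrD ler1n addn_gt0 !expn_gt0 !orbF -addn_gt0.
  rewrite /M /g1 /g2; case: ifPn => [/andP[h1 h2]|_].
    apply: (ftrans_majorant_fine vi antE circ rho0 Z0) => // i j e; rewrite aE.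
    exact: (rho_sin (Ordinal (h1 : k1 < K.+1)%N, Ordinal (h2 : k2 < K.+1)%N, i, j)).
  by apply: (ftrans_majorant_crude vi antE circ Z rho0); rewrite (lt_le_trans ltr01).
pose D := 16 * n%:R ^+ 2 * perimeter v * rho.
have D0 : 0 <= D.
  apply: mulr_ge0 (ltW rho0); apply: mulr_ge0; first by rewrite mulr_ge0 ?sqr_ge0.
  by apply: sumr_ge0 => i _; apply: sumr_ge0 => j _; exact: sqrtr_ge0.
(* Low frequencies have weight at most [eta]; for the others the crude weight 1 is supplied by one
   of the indicators, to be paid for by the tail sum. *)
pose beta k1 k2 := D * (decay R k1 * decay R k2 * (eta + (K < k1)%N%:R + (K < k2)%N%:R)).
have ib k1 k2 : integ 0 (2 * pi) (b k1 k2) <= beta k1 k2.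
  rewrite /b intD; [|exact: pM|exact: pM].
  have G : g1 k1 k2 + g2 k1 k2 / Z <= eta + (K < k1)%N%:R + (K < k2)%N%:R.
    rewrite /g1 /g2; case: ifPn => [/andP[h1 h2]|].
      by rewrite -addrA (le_trans dl)// lerDl addr_ge0.
    rewrite /low negb_and -!ltnNge mul0r addr0 => /orP[->|->].
      by rewrite addrAC addrC lerDl addr_ge0// ltW.
    by rewrite addrC lerDl addr_ge0// ltW.
  apply: (@le_trans _ _ (8 * n%:R ^+ 2 * perimeter v * rho * (decay R k1 * decay R k2 * (g1 k1 k2 + g2 k1 k2 / Z)) +
     8 * n%:R ^+ 2 * perimeter v * rho * (decay R k1 * decay R k2 * (g1 k1 k2 + g2 k1 k2 / Z)))).
    by apply: lerD; apply: int_majorant_le => //; rewrite ?sqrrN.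
  rewrite (_ : _ + _ = D * (decay R k1 * decay R k2 * (g1 k1 k2 + g2 k1 k2 / Z))); last by rewrite /D; ring.
  apply: ler_wpM2l => //; apply: ler_wpM2l => //.
  by rewrite mulr_ge0// ltW// decay_gt0.
pose gam k2 := D * (decay R k2 * (3 * eta + eta + 3 * (K < k2)%N%:R)).
have bg k2 N : \sum_(0 <= k1 < N) beta k1 k2 <= gam k2.
  rewrite /beta /gam -mulr_sumr; apply: ler_wpM2l => //.
  have -> : \sum_(0 <= k1 < N) decay R k1 * decay R k2 * (eta + (K < k1)%N%:R + (K < k2)%N%:R) =
      decay R k2 * ((eta + (K < k2)%N%:R) * \sum_(0 <= k1 < N) decay R k1 +
        \sum_(0 <= k1 < N) (K < k1)%N%:R * decay R k1).
    by rewrite mulr_sumr -big_split mulr_sumr; apply: eq_bigr => k1 _ /=; ring.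
  apply: ler_wpM2l; first by rewrite ltW// decay_gt0.
  rewrite (_ : 3 * eta + eta + _ = (eta + (K < k2)%N%:R) * 3 + eta); last by ring.
  apply: lerD; last exact: le_trans (sum_decay_tail _ _ _) tailK.
  by apply: ler_wpM2l (sum_decay _ _); rewrite addr_ge0// ltW.
(* The full sum, at most 3, gives 12 [eta], and the tail gives 3 [eta]. *)
have gC N : \sum_(0 <= k2 < N) gam k2 <= D * (15 * eta).
  rewrite /gam -mulr_sumr; apply: ler_wpM2l => //.
  have -> : \sum_(0 <= k2 < N) decay R k2 * (3 * eta + eta + 3 * (K < k2)%N%:R) =
      4 * eta * \sum_(0 <= k2 < N) decay R k2 + 3 * \sum_(0 <= k2 < N) (K < k2)%N%:R * decay R k2.
    by rewrite !mulr_sumr -big_split; apply: eq_bigr => k2 _ /=; ring.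
  rewrite (_ : 15 * eta = 4 * eta * 3 + 3 * eta); last by ring.
  apply: lerD; last by apply: ler_wpM2l => //; exact: le_trans (sum_decay_tail _ _ _) tailK.
  by apply: ler_wpM2l (sum_decay _ _); rewrite mulr_ge0// ltW.
have [mser ser] := int_double_series_le pb b0 ib bg gC.
apply: le_trans ser.
have s0 th : (0 <= \sum_(0 <= k2 <oo) \sum_(0 <= k1 <oo) (b k1 k2 th)%:E)%E.
  by apply: nneseries_ge0 => k2 _ _; apply: nneseries_ge0 => k1 _ _; rewrite lee_fin.
apply: (@le_integral_off_seq R _ _ [::]) => //.
- by apply: emeasurable_funM => //; exact: measurable_cst.
- by move=> th _; apply: integral_ge0 => t1 _; apply: integral_ge0 => t2 _; rewrite lee_fin sqr_ge0.
- by move=> th _; rewrite mule_ge0.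
move=> th /= /andP[th0 th1] _; split; first by rewrite in_itv /= th0 ltW.
have cw : convex_position (fun k => place rho th (v k)) by exact: convex_position_place.
apply: (L2_count_le cw n1 (HB th)) => [k1 k2|k1 k2 d d' k0]; first exact: b0.
by apply: lerD; apply: ftrans_le => //; rewrite sqrrN.
Qed.

Lemma inscribed_not_L2_regular :
  inscribed_centrally_symmetric (hull v) -> ~ L2_regular (hull v).
Proof.
move=> [c [r [_ [circ sym]]]] [c1 [c10 reg]].
have circ' k : ((v k).1 - c.1) ^+ 2 + ((v k).2 - c.2) ^+ 2 = r ^+ 2 by exact/circ/vertex_extreme.
pose C := (2 * pi)^-1 * (8 * (16 * n%:R ^+ 2 * perimeter v * 15)).
have C0 : 0 <= C.
  apply: mulr_ge0; first by rewrite invr_ge0 mulr_ge0 ?pi_ge0.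
  apply: mulr_ge0 => //; apply: mulr_ge0 => //; apply: mulr_ge0; first by rewrite mulr_ge0 ?sqr_ge0.
  by apply: sumr_ge0 => i _; apply: sumr_ge0 => j _; exact: sqrtr_ge0.
(* Chosen so that [C * eta < c1 ^+ 2]; then the single [rho] obtained for [eta] contradicts the
   lower bound. *)
pose eta := Num.min 1 (c1 ^+ 2 / (C + 1)).
have c2 : 0 < c1 ^+ 2 by rewrite exprn_gt0.
have C1 : 0 < C + 1 by rewrite ltr_wpDl.
have eta01 : 0 < eta <= 1 by rewrite lt_min ltr01 divr_gt0//= ge_min lexx.
have Ceta : C * eta < c1 ^+ 2.
  have h : eta <= c1 ^+ 2 / (C + 1) by rewrite ge_min lexx orbT.
  apply: le_lt_trans (ler_wpM2l C0 h) _.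
  by rewrite mulrCA gtr_pMr// ltr_pdivrMr// mul1r ltrDl.
have [rho rho1 le] := inscribed_small_discrepancy circ' sym eta01.
have rho0 : 0 < rho by rewrite (lt_le_trans ltr01).
have := reg rho rho1; apply/negP; rewrite -ltNge /L2norm_discrepancy.
pose U := C * eta * rho.
have UE : (2 * pi)^-1 * (8 * (16 * n%:R ^+ 2 * perimeter v * rho * (15 * eta))) = U.
  by rewrite /U /C; ring.
rewrite UE in le.
have eta0 : 0 <= eta by case/andP: eta01 => /ltW.
have U0 : 0 <= U by apply: mulr_ge0 (ltW rho0); exact: mulr_ge0.
apply: (@le_lt_trans _ _ (U%:E `^ 2^-1)%E).
  have L0 : (0 <= L2sq_discrepancy (hull v) rho)%E.
    apply: mule_ge0; first by rewrite lee_fin invr_ge0 mulr_ge0 ?pi_ge0.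
    apply: integral_ge0 => th _; apply: integral_ge0 => t1 _; apply: integral_ge0 => t2 _.
    exact: mule_ge0.
  by apply: gt0_ler_poweR => //; rewrite in_itv /= leey andbT ?lee_fin.
rewrite poweR_EFin lte_fin.
have -> : c1 * rho `^ 2^-1 = (c1 ^+ 2 * rho) `^ 2^-1.
  by rewrite powRM ?(ltW c2) ?(ltW rho0)// -powR_mulrn ?(ltW c10)// -powRrM mulfV// powRr1// ltW.
apply: gt0_ltr_powR => //; last by rewrite /U ltr_pM2r.
by rewrite nnegrE mulr_ge0// ltW.
Qed.

End IrregularIfInscribed.

Theorem theorem3 (R : realType) (P : set (R * R)) :
  convex_polygon P ->
  (L2_regular P <-> ~ inscribed_centrally_symmetric P).
Proof.
move=> [[n0 [v0 ->]] [c [r [r0 ball]]]].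
have [n [v [irr hE]]] := irredundant_hull v0.
have {}hE : conv_hull_pts v0 = hull v by rewrite hE.
rewrite hE in ball *.
have n2 : (2 < n)%N := interior_three_vertices r0 ball.
split=> [reg ins|nins]; first exact: (inscribed_not_L2_regular irr n2 ins reg).
by have [] := L2_regular_or_inscribed (irredundant_convex_position irr) n2.
Qed.
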